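(* Consider the policy optimization problem $\max_{\theta\in\mathbb{R}^d}J(\theta)$, $J(\theta)=\mathbb{E}_{\tau\sim p(\cdot|\theta)}[\mathcal{R}(\tau)]$, with trajectory gradient $g(\tau|\theta)$, suppose assumptions (A1)–(A3) of the context hold, let $\epsilon>0$, and run AbaSVRPG with $\eta=\frac1{2L}$, $m=\big(\frac{L^2\sigma^2}{Q\epsilon}\big)^{1/3}$, $B=\big(\frac{Q\sigma^4}{L^2\epsilon^2}\big)^{1/3}$, $\alpha=48$, $\beta=6$, with $L$ and $Q$ the constants of the context. Then the overall STO complexity of AbaSVRPG to achieve $\mathbb{E}\|\nabla J(\theta_\xi)\|^2\le\epsilon$ is $$\underbrace{2KB+\sum_{k=0}^{\lfloor K/m\rfloor}\frac{\alpha\sigma^2}{\frac\beta m\sum_{i=km-m}^{km-1}\|v_i\|^2+\epsilon}}_{\text{complexity of AbaSVRPG}}\ <\ \underbrace{2KB+\sum_{k=0}^{\lfloor K/m\rfloor}\frac{\alpha\sigma^2}{\epsilon}}_{\text{complexity of vanilla SVRPG}}=\mathcal{O}\big(\epsilon^{-5/3}+\epsilon^{-1}\big),$$ where $K$ denotes the total number of iterations.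
   Context: Setting. A discounted MDP with state space $\mathcal{S}$, action space $\mathcal{A}$, transition model $\mathcal{P}(s'|s,a)$, reward $\mathcal{R}(s,a)\in[-R,R]$, discount $\gamma\in[0,1)$, initial state distribution $\rho$, finite horizon $H$; policies $\pi_\theta(\cdot|s)$, $\theta\in\mathbb{R}^d$. $p(\cdot|\theta)$ is the distribution of the trajectory $\tau=(s_0,a_0,\dots,s_{H-1},a_{H-1})$ under $\pi_\theta$ with $s_0\sim\rho$; $\mathcal{R}(\tau)=\sum_{t}\gamma^t\mathcal{R}(s_t,a_t)$ (sum over the time steps of the trajectory). $g(\tau|\theta)$ is a trajectory gradient, for instance REINFORCE, $g=\big(\sum_t\gamma^t\mathcal{R}(s_t,a_t)-b(s_t,a_t)\big)\big(\sum_t\nabla\log\pi_\theta(a_t|s_t)\big)$, or G(PO)MDP, $g=\sum_t(\gamma^t\mathcal{R}(s_t,a_t)-b(s_t,a_t))\sum_{i\le t}\nabla\log\pi_\theta(a_i|s_i)$, with $b$ a bias (baseline) function. $\theta^*=\arg\max_{\theta\in\mathbb{R}^d}J(\theta)$. Assumptions. (A1) $\mathbb{E}_{\tau\sim p(\cdot|\theta)}[g(\tau|\theta)]=\nabla J(\theta)$ for all $\theta$. (A2) There are finite constants $G,C_H,R\ge0$ with $|\nabla_{\theta_i}\log\pi_\theta(a|s)|\le G$, $|\mathcal{R}(s,a)|\le R$, $|\frac{\partial^2}{\partial\theta_i\partial\theta_j}\log\pi_\theta(a|s)|\le C_H$ for all $(s,a)$, $\theta$, $1\le i,j\le d$. (A3)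 There is $\sigma^2<\infty$ with $\mathbb{E}_{\tau\sim p(\cdot|\theta)}\|g(\tau|\theta)-\nabla J(\theta)\|^2\le\sigma^2$ for all $\theta\in\mathbb{R}^d$. Constants. Under (A1)–(A3) it is known from earlier work (Papini et al. 2018; Xu et al. 2019) that there exist constants $L>0$, $L_g$, $\Gamma$, $\alpha_\omega>0$ such that: $\|\nabla J(\theta_1)-\nabla J(\theta_2)\|\le L\|\theta_1-\theta_2\|$; $\|g(\tau|\theta_1)-g(\tau|\theta_2)\|\le L_g\|\theta_1-\theta_2\|$ for all $\tau$; $\|g(\tau|\theta)\|^2\le\Gamma$; and $\mathbb{E}_{\tau\sim p(\cdot|\theta_1)}\big|1-\frac{p(\tau|\theta_2)}{p(\tau|\theta_1)}\big|^2\le\alpha_\omega\|\theta_1-\theta_2\|^2$. Fix such constants and set $Q=2(L_g^2+\Gamma\alpha_\omega)$. Importance weight: $\omega(\tau|\theta_1,\theta_2)=p(\tau|\theta_2)/p(\tau|\theta_1)$. AbaSVRPG. Inputs: $\theta_0\in\mathbb{R}^d$, $\eta,\epsilon,\alpha,\beta>0$, epoch length $m$, mini-batch size $B$. For $k=0,1,\dots,K$, with $n_k=\lfloor k/m\rfloor m$: if $k\equiv0\pmod m$, draw $\tau_1,\dots,\tau_N$ i.i.d. from $p(\cdot|\theta_k)$ with $N=\frac{\alpha\sigma^2}{\frac\beta m\sum_{i=n_k-m}^{n_k-1}\|v_i\|^2+\epsilon}$ (convention $\|v_{-1}\|=\dots=\|v_{-m}\|=0$), set $v_k=\frac1N\sum_{i=1}^Ng(\tau_i|\theta_k)$,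 $\tilde\theta=\theta_k$, $\tilde v=v_k$; otherwise draw $\tau_1,\dots,\tau_B$ i.i.d. from $p(\cdot|\theta_k)$ and set $v_k=\frac1B\sum_{i=1}^B\big(g(\tau_i|\theta_k)-\omega(\tau_i|\theta_k,\tilde\theta)g(\tau_i|\tilde\theta)\big)+\tilde v$. In both cases $\theta_{k+1}=\theta_k+\eta v_k$. Output: $\theta_\xi$ uniformly at random from $\{\theta_0,\dots,\theta_K\}$. Sizes that are not integers are understood to be rounded. STO complexity: number of trajectory-gradient computations needed to attain the stated accuracy, counted as in the displayed expressions; vanilla SVRPG is the same method with fixed outer batch size $\alpha\sigma^2/\epsilon$. $\mathcal{O}(\cdot)$ hides constants that do not depend on $\epsilon$.
   Formalization: The strict ''<'' fails if σ=0, ⌊K/m⌋=0 or all relevant v_i=0 (e.g. zero reward); proved instead: ''≤'' always, ''<'' exactly when σ>0 and some v_i≠0 with i<⌊K/m⌋m, and ''<'' in expectation if σ>0, K≥m, ∇J(θ_0)≠0. *)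

(* Defs.v *)
From HB Require Import structures.
From mathcomp Require Import all_boot all_order all_algebra.
From mathcomp Require Import all_classical all_reals all_analysis.
From mathcomp Require Import measurable_realfun.

Set Implicit Arguments.
Unset Strict Implicit.
Unset Printing Implicit Defensive.
Import Order.TTheory GRing.Theory Num.Theory.
Import numFieldNormedType.Exports.
Local Open Scope classical_set_scope.
Local Open Scope ring_scope.

(* The norm that the library puts on 'rV[R]_d is the sup norm, so the Euclidean
   norm is defined here. *)
Definition enorm (R : realType) (d : nat) (x : 'rV[R]_d) : R :=
  Num.sqrt (\sum_(i < d) x 0 i ^+ 2).

Definition pderiv (R : realType) (d : nat) (i : 'I_d) (f : 'rV[R]_d -> R)
  (x : 'rV[R]_d) : R := 'D_(delta_mx 0 i) f x.

Definition grad (R : realType) (d : nat) (f : 'rV[R]_d -> R) (x : 'rV[R]_d) :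
  'rV[R]_d := \row_i pderiv i f x.

(* Rounding of a nonnegative real size: upwards, and to at least 1. *)
Definition roundup (R : realType) (x : R) : nat := maxn 1 `|Num.ceil x|%N.

Section model.
Context (R : realType) (dS dA : measure_display)
        (S : measurableType dS) (A : measurableType dA).

Record mdp := MDP {
  trans : R.-pker (S * A) ~> S ;
  reward : S -> A -> R ;
  measurable_reward : measurable_fun [set: S * A] (fun x => reward x.1 x.2) ;
  gamma : R ;
  gamma_ge0 : 0 <= gamma ;
  gamma_lt1 : gamma < 1 ;
  init : probability S R ;
  horizon : nat }.

(* pi_theta(. | s) is a probability kernel with a density pi_theta(a | s) with
   respect to a fixed sigma-finite measure on the actions (the counting measure
   for discrete actions, the Lebesgue measure for continuous ones). The density
   is positive since log pi_theta(a | s) has to be defined for all theta, s, a. *)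
Record policy (d : nat) := Policy {
  act_ref : {sigma_finite_measure set A -> \bar R} ;
  dens : 'rV[R]_d -> S -> A -> R ;
  dens_gt0 : forall theta s a, 0 < dens theta s a ;
  measurable_dens : forall theta,
    measurable_fun [set: S * A] (fun x => dens theta x.1 x.2) ;
  act : 'rV[R]_d -> R.-pker S ~> A ;
  act_dens : forall theta s U, measurable U ->
    act theta s U = (\int[act_ref]_(a in U) (dens theta s a)%:E)%E }.

End model.

Section trajectory_kernel.
Context (R : realType) (dS dA : measure_display)
        (S : measurableType dS) (A : measurableType dA).

Section cons_kernel.
Variables (n : nat) (k : R.-pker S ~> n.-tuple (S * A)).

Definition cons_pair (x : S * A) (t : n.-tuple (S * A)) :
  n.+1.-tuple (S * A) := [tuple of x :: t].

Lemma measurable_cons_pair x : measurable_fun setT (cons_pair x).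
Proof. exact: measurable_cons. Qed.

Definition kcons (z : (S * A) * S) :
    {measure set (n.+1.-tuple (S * A)) -> \bar R} :=
  measure_function_pushforward__canonical__measure_function_Measure
    (k z.2) (measurable_cons_pair z.1).

Let ksnd : (S * A) * S -> {measure set (n.-tuple (S * A)) -> \bar R} :=
  k \o snd.

Let measurable_ksnd U : measurable U -> measurable_fun [set: (S * A) * S] (ksnd ^~ U).
Proof.
move=> mU; apply: (@measurableT_comp _ _ _ _ _ _ (k ^~ U) _ snd) => //.
exact: measurable_kernel.
Qed.

HB.instance Definition _ := isKernel.Build _ _ _ _ R ksnd measurable_ksnd.

Let ksnd_prob z : ksnd z setT = 1%E.
Proof. exact: prob_kernel. Qed.

HB.instance Definition _ := Kernel_isProbability.Build _ _ _ _ R ksnd ksnd_prob.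

Let measurable_kcons U : measurable U -> measurable_fun [set: (S * A) * S] (kcons ^~ U).
Proof.
move=> mU.
pose f (zt : ((S * A) * S) * n.-tuple (S * A)) := cons_pair zt.1.1 zt.2.
have mf : measurable_fun setT f.
  apply: measurable_cons; last exact: measurable_snd.
  by apply: measurableT_comp => //; exact: measurable_fst.
have mV : measurable (f @^-1` U) by rewrite -[X in measurable X]setTI; exact: mf.
have := measurable_fun_xsection_finite_kernel ksnd (mem_set mV).
apply: eq_measurable_fun => z _ /=.
by rewrite /ksnd /kcons /pushforward xsectionE.
Qed.

HB.instance Definition _ := isKernel.Build _ _ _ _ R kcons measurable_kcons.

Let kcons_prob z : kcons z setT = 1%E.
Proof. by rewrite /kcons /= /pushforward preimage_setT prob_kernel. Qed.

HB.instance Definition _ :=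
  Kernel_isProbability.Build _ _ _ _ R kcons kcons_prob.

End cons_kernel.

Section step_kernel.
Variables (pi : R.-pker S ~> A) (p : R.-pker (S * A) ~> S).
Variables (n : nat) (k : R.-pker S ~> n.-tuple (S * A)).

Definition traj_step (s : S) : {measure set (n.+1.-tuple (S * A)) -> \bar R} :=
  (pi \; (p \; kcons k))%E s.

Lemma traj_stepE s U : traj_step s U =
  (\int[pi s]_a \int[p (s, a)]_s' k s' [set t | U (cons_pair (s, a) t)])%E.
Proof. by []. Qed.

Let measurable_traj_step U : measurable U -> 
    measurable_fun [set: S] (traj_step ^~ U).
Proof. by move=> mU; exact: measurable_kernel. Qed.

HB.instance Definition _ :=
  isKernel.Build _ _ _ _ R traj_step measurable_traj_step.

Let traj_step_prob s : traj_step s setT = 1%E.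
Proof.
rewrite traj_stepE (eq_integral (cst 1%E)) ?integral_cst ?mul1e ?prob_kernel//.
move=> a _; rewrite (eq_integral (cst 1%E)) ?integral_cst ?mul1e ?prob_kernel//.
by move=> s' _; exact: prob_kernel.
Qed.

HB.instance Definition _ :=
  Kernel_isProbability.Build _ _ _ _ R traj_step traj_step_prob.

End step_kernel.

(* Law of (s_0, a_0, ..., s_{n-1}, a_{n-1}) given s_0; the state s_n reached
   after the last action is integrated out. *)
Fixpoint traj_ker (pi : R.-pker S ~> A) (p : R.-pker (S * A) ~> S) (n : nat) :
    R.-pker S ~> n.-tuple (S * A) :=
  if n isn't n'.+1 then kdirac (measurable_cst [tuple])
  else traj_step pi p (traj_ker pi p n').

Section mixture.
Variables (n : nat) (rho : probability S R) (k : R.-pker S ~> n.-tuple (S * A)).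

Definition mixture (U : set (n.-tuple (S * A))) : \bar R :=
  (\int[rho]_s k s U)%E.

Let mixture0 : mixture set0 = 0%E.
Proof. by rewrite /mixture integral0_eq. Qed.

Let mixture_ge0 U : (0 <= mixture U)%E.
Proof. exact: integral_ge0. Qed.

Let mixture_sigma_additive : semi_sigma_additive mixture.
Proof.
move=> U mU tU mUU.
have -> : mixture (\bigcup_i U i) = (\sum_(0 <= i <oo) mixture (U i))%E.
  rewrite -integral_nneseries//; last by move=> i; exact: measurable_kernel.
  apply: eq_integral => s _.
  by apply/esym/cvg_lim => //; exact: measure_semi_sigma_additive.
by apply: is_cvg_ereal_nneg_natsum => i _; exact: mixture_ge0.
Qed.

HB.instance Definition _ := isMeasure.Build _ _ R mixture
  mixture0 mixture_ge0 mixture_sigma_additive.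

Let mixture_setT : mixture setT = 1%E.
Proof.
rewrite /mixture (eq_integral (cst 1%E)); last by move=> s _; exact: prob_kernel.
by rewrite integral_cst// mul1e; exact: probability_setT.
Qed.

HB.instance Definition _ := Measure_isProbability.Build _ _ R mixture
  mixture_setT.

End mixture.
End trajectory_kernel.

Section problem.
Context (R : realType) (dS dA : measure_display)
        (S : measurableType dS) (A : measurableType dA).
Variables (M : mdp R S A) (d : nat) (pi : policy R S A d).
Local Notation Theta := 'rV[R]_d.

Definition traj : Type := (horizon M).-tuple (S * A).
HB.instance Definition _ := Measurable.on traj.

Definition traj_dist (theta : Theta) : probability traj R :=
  mixture (init M) (traj_ker (act pi theta) (trans M) (horizon M)).

Definition state (tau : traj) (t : 'I_(horizon M)) : S := (tnth tau t).1.
Definition action (tau : traj) (t : 'I_(horizon M)) : A := (tnth tau t).2.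

Definition return_of (tau : traj) : R :=
  \sum_(t < horizon M) gamma M ^+ t * reward M (state tau t) (action tau t).

Definition J (theta : Theta) : R := fine 'E_(traj_dist theta)[return_of].

(* Density of p(. | theta) with respect to the reference measure
     init(ds_0) act_ref(da_0) trans(ds_1 | s_0, a_0) act_ref(da_1) ...
   The initial and transition laws do not depend on theta, so they are part of
   the reference measure; no density of trans or init is required. *)
Definition likelihood (tau : traj) (theta : Theta) : R :=
  \prod_(t < horizon M) dens pi theta (state tau t) (action tau t).

Definition iweight (tau : traj) (theta1 theta2 : Theta) : R :=
  likelihood tau theta2 / likelihood tau theta1.

Definition log_dens (s : S) (a : A) (theta : Theta) : R :=
  ln (dens pi theta s a).

Variable g : traj -> Theta -> Theta.

(* The equation with the expectation implies integrability, as g is measurable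
   and grad J is finite. *)
Definition unbiased_gradient : Prop :=
  [/\ forall theta i, measurable_fun [set: traj] (fun tau => g tau theta 0 i),
      forall theta, differentiable (J : Theta -> R^o) theta &
      forall theta i,
        'E_(traj_dist theta)[fun tau => (g tau theta 0 i)%R]%E
        = (grad J theta 0 i)%:E].

Definition regular_policy (G C_H Rmax : R) : Prop :=
  [/\ 0 <= G, 0 <= C_H, 0 <= Rmax,
      forall s a, `|reward M s a| <= Rmax &
      forall s a (i : 'I_d),
        (forall theta,
           derivable (log_dens s a : Theta -> R^o) theta (delta_mx 0 i) /\
           `|pderiv i (log_dens s a) theta| <= G) /\
        (forall theta (j : 'I_d),
           derivable (pderiv i (log_dens s a) : Theta -> R^o) theta
             (delta_mx 0 j) /\
           `|pderiv j (pderiv i (log_dens s a)) theta| <= C_H)].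

Definition bounded_variance (sigma : R) : Prop :=
  0 <= sigma /\
  forall theta,
    ('E_(traj_dist theta)[fun tau => (enorm (g tau theta - grad J theta) ^+ 2)%R]
     <= (sigma ^+ 2)%:E)%E.

Definition smoothness_constants (L Lg Gamma alphaw : R) : Prop :=
  [/\ forall theta1 theta2,
        enorm (grad J theta1 - grad J theta2) <= L * enorm (theta1 - theta2),
      forall tau theta1 theta2,
        enorm (g tau theta1 - g tau theta2) <= Lg * enorm (theta1 - theta2),
      forall tau theta, enorm (g tau theta) ^+ 2 <= Gamma &
      forall theta1 theta2,
        ('E_(traj_dist theta1)[fun tau => (`|1 - iweight tau theta1 theta2| ^+ 2)%R]
         <= (alphaw * enorm (theta1 - theta2) ^+ 2)%:E)%E].

(* An outer batch rule maps the estimates v_0, v_1, ... and an iteration k to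
   the (unrounded) batch size drawn at k. *)
Definition batch_rule : Type := (nat -> Theta) -> nat -> R.

(* The sum over k - m <= i < k with truncated subtraction is empty at k = 0,
   which is the convention v_{-1} = ... = v_{-m} = 0; the rule is only used at
   multiples k of m. *)
Definition aba_rule (alpha beta sigma eps : R) (m : nat) : batch_rule :=
  fun v k => alpha * sigma ^+ 2 /
    (beta / m%:R * (\sum_(k - m <= i < k) enorm (v i) ^+ 2) + eps).

Definition vanilla_rule (alpha sigma eps : R) : batch_rule :=
  fun _ _ => alpha * sigma ^+ 2 / eps.

Definition sto_cost (N : batch_rule) (m B K : nat) (v : nat -> Theta) : R :=
  2 * K%:R * B%:R + \sum_(0 <= k < (K %/ m).+1) N v (k * m)%N.

Section run.
Context (dO : measure_display) (Omega : measurableType dO)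
        (P : probability Omega R).

(* Events generated by the trajectories drawn before iteration k. *)
Definition history (tau : nat -> nat -> Omega -> traj) (k : nat) :
  set (set Omega) :=
  <<s [set E | exists j i (U : set traj),
                 [/\ (j < k)%N, measurable U & E = tau j i @^-1` U]] >>.

Definition minibatch (n : nat) (x : nat -> Theta) : Theta :=
  n%:R^-1 *: \sum_(i < n) x i.

(* tau k i is the i-th trajectory available at iteration k; only as many of
   them as the batch size of iteration k enter v k. run_sample says that, given
   the past, tau k 0, tau k 1, ... are i.i.d. with law p(. | theta k). *)
Record svrpg_run (N : batch_rule) (eta : R) (m B K : nat) (theta0 : Theta)
    (tau : nat -> nat -> Omega -> traj) (theta v : nat -> Omega -> Theta)
    (xi : Omega -> nat) : Prop := SvrpgRun {
  run_measurable : forall k i, (k <= K)%N -> measurable_fun setT (tau k i) ;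
  run_sample : forall k n (U : 'I_n -> set traj) E, (k <= K)%N ->
    (forall i, measurable (U i)) -> history tau k E ->
    P (E `&` \bigcap_(i in [set: 'I_n]) (tau k i @^-1` U i)) =
    (\int[P]_(w in E) \prod_(i < n) traj_dist (theta k w) (U i))%E ;
  run_init : forall w, theta 0%N w = theta0 ;
  run_outer : forall k w, (k <= K)%N -> (m %| k)%N ->
    v k w = minibatch (roundup (N (v^~ w) k))
              (fun i => g (tau k i w) (theta k w)) ;
  run_inner : forall k w, (k <= K)%N -> ~~ (m %| k)%N ->
    let nk := (k %/ m * m)%N in
    v k w = minibatch B
              (fun i => g (tau k i w) (theta k w)
                 - iweight (tau k i w) (theta k w) (theta nk w)
                   *: g (tau k i w) (theta nk w))
            + v nk w ;
  run_step : forall k w, (k <= K)%N ->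
    theta k.+1 w = theta k w + eta *: v k w ;
  run_measurable_output : measurable_fun setT xi ;
  run_output : forall k E, (k <= K)%N -> history tau K.+1 E ->
    P (E `&` xi @^-1` [set k]) = (K.+1%:R^-1%:E * P E)%E }.

End run.
End problem.

(* Main.v *)
Require Import Defs.
From HB Require Import structures.
From mathcomp Require Import all_boot all_order all_algebra.
From mathcomp Require Import all_classical all_reals all_analysis.
From mathcomp Require Import measurable_realfun.
From mathcomp Require Import ring lra zify.
From mathcomp Require Import giry.

Set Implicit Arguments.
Unset Strict Implicit.
Unset Printing Implicit Defensive.
Import Order.TTheory GRing.Theory Num.Theory.
Import numFieldNormedType.Exports.
Local Open Scope classical_set_scope.
Local Open Scope ring_scope.

(** Let [e k] be the error [v k - grad J (theta k)]. The proof is a descent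
    argument in which the errors are paid for by the squared step lengths.

    Descent ([descent_step]). As [grad J] is [L]-Lipschitz and [eta] is
    [1 / (2 L)], an ascent step satisfies
      [|grad J|^2 / 2 + |v|^2 / 4 <= 2 L (J' - J) + |e|^2 / 2].
    Summed over the run, the values of [J] telescope to a quantity bounded by the
    rewards, and it remains to absorb [sum E|e k|^2] in [sum E|v k|^2].

    Errors ([outer_error_le], [inner_error_le]). The estimators are centred given
    the past, so the samples of a mini-batch are conditionally orthogonal and a
    batch divides the conditional variance by its size
    ([minibatch_second_moment]). At a checkpoint that variance is at most
    [sigma^2], and the adaptive batch size turns it into an eighth of the mean
    squared step length of the previous epoch, plus [eps / 48]. Inside an epoch
    the importance weight bounds the variance by a multiple of the squared
    distance to the checkpoint ([corrected_g_sq]), hence by the step lengths since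
    then, and the error of the checkpoint is carried over. With the prescribed
    [m] and [B] the two contributions sum to at most
    [(1/4 + 1/8) sum E|v k|^2], up to [eps / 48] per iteration ([error_sum_le]),
    and the descent inequality absorbs the first part. What is left is a
    bound on the average of [E|grad J (theta k)|^2], and this average is what the
    random output index computes ([output_second_moment]).

    The vanilla rule is the adaptive rule with [beta = 0], so one argument covers
    both. Accuracy is reached once [K + 1] exceeds a constant over [eps], and the
    rate follows by substituting the sizes ([vanilla_cost_le]). The adaptive rule
    never asks for more samples than the vanilla one, and for fewer at a
    checkpoint as soon as some step of the epoch before it moves
    ([sto_cost_lt_iff]); the first estimate is unbiased, so if
    [grad J theta0 != 0] this happens with positive probability
    ([expected_saving]).

    Two measure-theoretic points carry the probabilistic part. The sigma-algebra
    of the past is used as a measurable structure on the sample space, and a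
    fresh sample is integrated out against its conditional law
    ([cond_law_integral]). For this, densities, estimators and gradients have to
    be jointly measurable in the trajectory and the parameter; they are, because
    the estimators, the gradients and the logarithms of the densities are
    measurable in the former and Lipschitz in the latter
    ([measurable_fun_lipschitz_param]). *)

(** * Euclidean norm and smooth functions *)

Section euclidean.
Context (R : realType) (d : nat).
Implicit Types x y z : 'rV[R]_d.

Lemma rowB x y c : (x - y) 0 c = x 0 c - y 0 c.
Proof. by rewrite !mxE. Qed.

Lemma rowZ a x c : (a *: x) 0 c = a * x 0 c.
Proof. by rewrite mxE. Qed.

Definition dotr x y : R := \sum_(i < d) x 0 i * y 0 i.

Lemma enorm_ge0 x : 0 <= enorm x.
Proof. exact: sqrtr_ge0. Qed.

Lemma enorm_sqE x : enorm x ^+ 2 = \sum_(i < d) x 0 i ^+ 2.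
Proof. by rewrite sqr_sqrtr// sumr_ge0// => i _; exact: sqr_ge0. Qed.

Lemma enorm0 : enorm (0 : 'rV[R]_d) = 0.
Proof. by rewrite /enorm big1 ?sqrtr0// => i _; rewrite mxE expr0n. Qed.

Lemma enorm_eq0 x : (enorm x == 0) = (x == 0).
Proof.
apply/idP/idP => [|/eqP->]; last by rewrite enorm0.
rewrite -sqrf_eq0 enorm_sqE psumr_eq0; last by move=> i _; exact: sqr_ge0.
move=> /allP h; apply/eqP/rowP => i; rewrite mxE.
by have /implyP := h i (mem_index_enum _); rewrite sqrf_eq0 => /(_ isT)/eqP.
Qed.

Lemma enorm_coord_sq x i : x 0 i ^+ 2 <= enorm x ^+ 2.
Proof.
by rewrite enorm_sqE (bigD1 i)//= lerDl sumr_ge0// => j _; exact: sqr_ge0.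
Qed.

Lemma enorm_coord x i : `|x 0 i| <= enorm x.
Proof.
rewrite -(ler_pXn2r (ltn0Sn 1)) ?nnegrE ?enorm_ge0//.
by rewrite real_normK ?num_real// enorm_coord_sq.
Qed.

Lemma enormZ_sq c x : enorm (c *: x) ^+ 2 = c ^+ 2 * enorm x ^+ 2.
Proof.
by rewrite !enorm_sqE mulr_sumr; apply: eq_bigr => i _; rewrite mxE exprMn.
Qed.

Lemma enorm_sqD x y :
  enorm (x + y) ^+ 2 = enorm x ^+ 2 + 2 * dotr x y + enorm y ^+ 2.
Proof.
rewrite !enorm_sqE /dotr mulr_sumr -!big_split/=; apply: eq_bigr => i _.
by rewrite !mxE; ring.
Qed.

Lemma dotrBl x y z : dotr (x - y) z = dotr x z - dotr y z.
Proof. by rewrite -sumrB; apply: eq_bigr => i _; rewrite !mxE mulrBl. Qed.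

(** Young's inequality, which stands in for Cauchy-Schwarz throughout: the
    weight [c] is adapted to each use. *)
Lemma dotr_young c x y : 0 < c ->
  - (c * enorm x ^+ 2 + c^-1 * enorm y ^+ 2) <= 2 * dotr x y.
Proof.
move=> c0; have := sqr_ge0 (enorm (c *: x + y)).
rewrite enorm_sqD enormZ_sq.
have -> : dotr (c *: x) y = c * dotr x y.
  by rewrite mulr_sumr; apply: eq_bigr => i _; rewrite mxE mulrA.
move=> h; rewrite -(ler_pM2l c0).
by rewrite mulrN mulrDr !mulrA divff ?gt_eqF// mul1r -expr2; lra.
Qed.

Lemma enorm_sqD_le x y :
  enorm (x + y) ^+ 2 <= 2 * enorm x ^+ 2 + 2 * enorm y ^+ 2.
Proof.
rewrite !enorm_sqE !mulr_sumr -big_split/=; apply: ler_sum => i _; rewrite mxE.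
by have := sqr_ge0 (x 0 i - y 0 i); nra.
Qed.

Lemma sqr_sum_le (F : nat -> R) (a b : nat) :
  (\sum_(a <= i < b) F i) ^+ 2 <= (b - a)%:R * \sum_(a <= i < b) F i ^+ 2.
Proof.
have [ab|ba] := leqP a b; last by rewrite !big_geq ?mulr0 ?expr0n// ltnW.
rewrite -(subnKC ab); move: (b - a)%N => n {b ab}; rewrite addKn.
elim: n => [|n IHn]; first by rewrite addn0 !big_geq// expr0n mulr0.
rewrite addnS !big_nat_recr ?leq_addr//=.
set s := \sum_(_ <= i < _) F i in IHn *.
set q := \sum_(_ <= i < _) F i ^+ 2 in IHn *.
set x := F _.
case: n => [|n] in s q x IHn *.
  have -> : s = 0 by rewrite /s addn0 big_geq.
  have -> : q = 0 by rewrite /q addn0 big_geq.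
  by rewrite !add0r mul1r.
set r : R := n.+1%:R in IHn *.
have r0 : 0 < r by rewrite ltr0n.
have -> : n.+2%:R = r + 1 :> R by rewrite /r -natr1.
have xs : r * (2 * s * x) <= s ^+ 2 + r ^+ 2 * x ^+ 2.
  by have := sqr_ge0 (s - r * x); lra.
rewrite -(ler_pM2l r0); nra.
Qed.

Lemma enorm_sum_sq_le (v : nat -> 'rV[R]_d) (a b : nat) :
  enorm (\sum_(a <= i < b) v i) ^+ 2 <=
  (b - a)%:R * \sum_(a <= i < b) enorm (v i) ^+ 2.
Proof.
rewrite enorm_sqE.
under [X in _ <= _ * X]eq_bigr do rewrite enorm_sqE.
rewrite exchange_big/= mulr_sumr; apply: ler_sum => c _.
by rewrite summxE sqr_sum_le.
Qed.

End euclidean.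

Section line.
Context (R : realType) (d : nat).
Implicit Types (f : 'rV[R]_d -> R) (x v : 'rV[R]_d).

Lemma is_derive_line f x v t : derivable (f : 'rV[R]_d -> R^o) (x + t *: v) v ->
  is_derive t (1 : R) (fun s : R => f (x + s *: v) : R^o) ('D_v (f : 'rV[R]_d -> R^o) (x + t *: v)).
Proof.
move=> df.
have E : (fun h : R => h^-1 *: (((fun s : R => f (x + s *: v) : R^o) \o shift t) (h *: (1 : R)) -
    f (x + t *: v))) =
  (fun h : R => h^-1 *: (((f : 'rV[R]_d -> R^o) \o shift (x + t *: v)) (h *: v) - f (x + t *: v))).
  apply/funext => h /=; congr (_ *: (f _ - _)).
  by rewrite -[h *: 1]/(h * 1) mulr1 scalerDl addrCA addrA.
by split; rewrite ?/derivable ?/derive E.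
Qed.

Lemma lipschitz_line f x v (C t : R) :
  (forall s, derivable (f : 'rV[R]_d -> R^o) (x + s *: v) v /\
     `|'D_v (f : 'rV[R]_d -> R^o) (x + s *: v)| <= C) ->
  `|f (x + t *: v) - f x| <= C * `|t|.
Proof.
move=> df.
pose D s := 'D_v (f : 'rV[R]_d -> R^o) (x + s *: v).
have der s : is_derive s (1 : R) (fun s : R => f (x + s *: v) : R^o) (D s).
  by apply: is_derive_line; have [] := df s.
have lip a b : a < b -> `|f (x + b *: v) - f (x + a *: v)| <= C * (b - a).
  move=> ab.
  have [|c _ ->] := @MVT R (fun s => f (x + s *: v)) D a b ab.
  - by apply: derivable_within_continuous => s _; have [] := der s.
  - by rewrite normrM (gtr0_norm (x := b - a)) ?subr_gt0// ler_wpM2r ?subr_ge0 ?(ltW ab)// (df c).2.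
have [t0|t0|->] := ltrgtP t 0.
- by have := lip _ _ t0; rewrite scale0r addr0 distrC sub0r (ltr0_norm t0).
- by have := lip _ _ t0; rewrite scale0r addr0 subr0 (gtr0_norm t0).
- by rewrite scale0r addr0 subrr normr0 mulr0.
Qed.

(** Moving from [y] to [x] one coordinate at a time, each step is a line along
    which the mean value theorem applies; only the existence of partial
    derivatives is needed. *)
Lemma lipschitz_partial f (C : R) :
  (forall x i, derivable (f : 'rV[R]_d -> R^o) x (delta_mx 0 i) /\
     `|pderiv i f x| <= C) ->
  forall x y, `|f x - f y| <= C * \sum_(i < d) `|x 0 i - y 0 i|.
Proof.
move=> df x y.
pose h k : 'rV[R]_d := \row_i (if (i < k)%N then x 0 i else y 0 i).
have h0 : h 0%N = y by apply/rowP => i; rewrite mxE.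
have hd : h d = x by apply/rowP => i; rewrite mxE ltn_ord.
have step (i : 'I_d) : `|f (h i.+1) - f (h i)| <= C * `|x 0 i - y 0 i|.
  have -> : h i.+1 = h i + (x 0 i - y 0 i) *: delta_mx 0 i.
    apply/rowP => j; rewrite !mxE eqxx/=.
    have [->|ji] := eqVneq j i; first by rewrite ltnn leqnn mulr1 addrC subrK.
    by rewrite mulr0 addr0 ltnS leq_eqVlt val_eqE (negPf ji).
  by apply: lipschitz_line => s; exact: df.
rewrite -{1}hd -{1}h0 -(telescope_sumr (fun k => f (h k))) // mulr_sumr big_mkord.
by apply: (le_trans (ler_norm_sum _ _ _)); exact: ler_sum.
Qed.

Lemma derive_dotr f x v : differentiable (f : 'rV[R]_d -> R^o) x ->
  'D_v (f : 'rV[R]_d -> R^o) x = dotr (grad f x) v.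
Proof.
move=> df; rewrite deriveE// [in LHS](row_sum_delta v) linear_sum.
apply: eq_bigr => i _; rewrite linearZ/= mxE /pderiv deriveE// mulrC.
by [].
Qed.

(** Adding [L / 2 * s ^+ 2 * enorm v ^+ 2] to the restriction of [f] to the
    segment, minus its tangent, gives a function of [s] whose derivative is
    nonnegative by the Lipschitz bound; the mean value theorem concludes. *)
Lemma smooth_lower_bound f (L : R) x v : 0 < L ->
  (forall z, differentiable (f : 'rV[R]_d -> R^o) z) ->
  (forall y z, enorm (grad f y - grad f z) <= L * enorm (y - z)) ->
  f x + dotr (grad f x) v - L / 2 * enorm v ^+ 2 <= f (x + v).
Proof.
move=> L0 df lip.
pose D t := dotr (grad f (x + t *: v)) v.
have der t : is_derive t (1 : R) (fun s : R => f (x + s *: v) : R^o) (D t).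
  by rewrite /D -derive_dotr//; apply: is_derive_line; exact/diff_derivable.
pose N := enorm v ^+ 2.
pose psi (s : R) : R := f (x + s *: v) - dotr (grad f x) v * s + L / 2 * N * s ^+ 2.
have dpsi t : is_derive t (1 : R) psi (D t - dotr (grad f x) v + L * N * t).
  apply: is_derive_eq.
  by rewrite /GRing.scale/=; field.
have [|c] := @MVT R psi (fun t => D t - dotr (grad f x) v + L * N * t) 0 1 ltr01.
- by apply: derivable_within_continuous => s _; have [] := dpsi s.
rewrite in_itv/= => /andP[c0 c1]; rewrite subr0 mulr1 => E.
suff : 0 <= psi 1 - psi 0.
  by rewrite /psi scale0r scale1r addr0 -/N; lra.
rewrite E /D -dotrBl.
have Lc0 : 0 < (L * c)^-1 by rewrite invr_gt0 mulr_gt0.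
have := dotr_young (grad f (x + c *: v) - grad f x) v Lc0.
rewrite invrK -/N.
have : enorm (grad f (x + c *: v) - grad f x) ^+ 2 <= (L * c) ^+ 2 * N.
  apply: (@le_trans _ _ ((L * enorm (c *: v)) ^+ 2)).
    rewrite ler_pXn2r ?nnegrE ?enorm_ge0 ?mulr_ge0 ?enorm_ge0 ?(ltW L0)//.
    by apply: le_trans (lip _ _) _; rewrite addrC addKr.
  by rewrite exprMn enormZ_sq mulrA -exprMn.
move=> h1 h2.
have : (L * c)^-1 * enorm (grad f (x + c *: v) - grad f x) ^+ 2 <= L * c * N.
  by rewrite ler_pdivrMl ?mulr_gt0// mulrA -expr2.
by move: h2; lra.
Qed.

End line.

Lemma enorm_le_l1 (R : realType) (d : nat) (x : 'rV[R]_d) :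
  enorm x <= \sum_(i < d) `|x 0 i|.
Proof.
have s0 : 0 <= \sum_(i < d) `|x 0 i| by rewrite sumr_ge0.
rewrite -(ler_pXn2r (ltn0Sn 1)) ?nnegrE ?enorm_ge0// enorm_sqE expr2 mulr_suml.
apply: ler_sum => i _; rewrite -real_normK ?num_real// expr2 ler_wpM2l//.
by rewrite (bigD1 i)//= lerDl sumr_ge0.
Qed.

(** A map that is measurable in [t] and Lipschitz in a vector parameter is
    jointly measurable: after rounding the parameter down to the grid of mesh
    [1 / n], the map is a countable union of maps that are measurable in [t]. *)
Lemma measurable_fun_lipschitz_param (R : realType) (d : nat)
    (dX dT : measure_display) (X : measurableType dX) (T : measurableType dT)
    (theta : X -> 'rV[R]_d) (f : T -> 'rV[R]_d -> R) (C : R) :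
  (forall i, measurable_fun setT (fun x => theta x 0 i)) ->
  (forall u, measurable_fun setT (f^~ u)) ->
  (forall t u w, `|f t u - f t w| <= C * \sum_(i < d) `|u 0 i - w 0 i|) ->
  measurable_fun setT (fun z : X * T => f z.2 (theta z.1)).
Proof.
move=> mtheta mf lip.
pose q n x : 'rV[int]_d := \row_i Num.floor (n.+1%:R * theta x 0 i).
pose r n (z : 'rV[int]_d) : 'rV[R]_d := \row_i ((z 0 i)%:~R / n.+1%:R).
have rq n x i : `|theta x 0 i - r n (q n x) 0 i| <= n.+1%:R^-1.
  rewrite !mxE; set y := _ * theta x 0 i.
  have -> : theta x 0 i = y / n.+1%:R by rewrite /y mulrC mulKf ?pnatr_eq0.
  rewrite -mulrBl normrM [X in _ * X]ger0_norm// ler_piMl//.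
  have /andP[h1 h2] := floor_itv y.
  by rewrite ger0_norm ?subr_ge0// lerBlDr ltW// addrC -[1]/(1%:~R) -intrD.
apply: (@measurable_fun_cvg _ _ _ _ (fun n z => f z.2 (r n (q n z.1)))); last first.
  move=> [x t] _ /=.
  have H : `|f t (theta x) - f t (r n (q n x))| @[n --> \oo] --> (0 : R).
    apply: (@squeeze_cvgr _ _ _ _ (fun=> 0) (fun n => (`|C| * d%:R) * n.+1%:R^-1)).
    - near=> n; rewrite normr_ge0/=.
      apply: (le_trans (lip _ _ _)).
      apply: (@le_trans _ _ (`|C| * \sum_(i < d) `|theta x 0 i - r n (q n x) 0 i|)).
        by rewrite ler_wpM2r ?sumr_ge0// ler_norm.
      rewrite -mulrA ler_wpM2l//.
      apply: (@le_trans _ _ (\sum_(i < d) n.+1%:R^-1)); first exact: ler_sum.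
      by rewrite sumr_const card_ord mulr_natl.
    - exact: cvg_cst.
    - by rewrite -(mulr0 (`|C| * d%:R)); apply: cvgMr; exact: cvg_harmonic.
  apply/cvgrPdist_lt => e e0.
  move/cvgrPdist_lt : H => /(_ _ e0); apply: filterS => n.
  by rewrite sub0r normrN normr_id.
move=> n _ Y mY; rewrite setTI.
have -> : (fun z : X * T => f z.2 (r n (q n z.1))) @^-1` Y =
    \bigcup_(w : 'rV[int]_d) ((q n @^-1` [set w]) `*` ((f^~ (r n w)) @^-1` Y)).
  apply/seteqP; split => [[x t] /= Yxt|[x t] [w _] [/= <-]//].
  by exists (q n x).
apply: countable_bigcupT_measurable => // w; apply: measurableX; last first.
  by rewrite -[X in measurable X]setTI; exact: mf.
have -> : q n @^-1` [set w] =
    \bigcap_(i in [set: 'I_d]) ((fun x => n.+1%:R * theta x 0 i) @^-1`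
       `[(w 0 i)%:~R, (w 0 i + 1)%:~R[%classic).
  apply/seteqP; split => [x /= <- i _ /=|x h]; first by rewrite in_itv/= mxE floor_itv.
  apply/rowP => i; rewrite mxE; apply/eqP; rewrite floor_eq.
  by have := h i Logic.I; rewrite /= in_itv.
apply: fin_bigcap_measurable => // i _; rewrite -[X in measurable X]setTI.
by apply: measurable_funM => //; exact: measurable_cst.
Unshelve. all: by end_near. Qed.

(** * Conditional laws *)

Lemma in_preimage (aT rT : Type) (f : aT -> rT) (E : set rT) w :
  (w \in f @^-1` E) = (f w \in E).
Proof. by apply/idP/idP; rewrite !inE. Qed.

Section giry_kernel.
Context (R : realType) (dX dT : measure_display)
  (X : measurableType dX) (T : measurableType dT) (k : X -> giry T R).
Hypothesis mk : measurable_fun setT k.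

Lemma measurable_dirac_prod d (Z : measurableType d) (pr : Z -> X) d' (Y : measurableType d') (q : Z -> Y) :
  measurable_fun setT pr -> measurable_fun setT q ->
  measurable_fun setT (fun z => giry_prod (giry_ret (q z), k (pr z))).
Proof.
move=> mpr mq; apply: (measurableT_comp measurable_giry_prod).
apply/measurable_fun_pairP; split.
  exact: measurableT_comp measurable_giry_ret mq.
exact: measurableT_comp mk mpr.
Qed.

Lemma dirac_prodE d (Y : measurableType d) y x E U : measurable E -> measurable U ->
  giry_prod (giry_ret y, k x) (E `*` U) = ((\1_E (y : Y))%:E * k x U)%E.
Proof. by move=> mE mU; rewrite /giry_prod/= product_measure1E//= diracE. Qed.

Lemma dirac_prod_int d (Y : measurableType d) (y : Y) x (f : Y * T -> \bar R) :
  measurable_fun setT f -> (forall z, 0 <= f z)%E ->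
  (\int[giry_prod (giry_ret y, k x)]_z f z = \int[k x]_t f (y, t))%E.
Proof.
move=> mf f0; have := giry_int_prod1 (giry_ret y) (k x) mf f0.
rewrite /giry_int => ->.
have := @giry_int_ret _ Y R y (fun y => \int[k x]_t f (y, t))%E.
rewrite /giry_int; apply.
exact: (measurable_fun_fubini_tonelli_F f mf f0).
Qed.

Lemma measurable_giry_section_int (f : X * T -> \bar R) :
  measurable_fun setT f -> (forall z, 0 <= f z)%E ->
  measurable_fun setT (fun x => \int[k x]_t f (x, t))%E.
Proof.
move=> mf f0.
have -> : (fun x => \int[k x]_t f (x, t))%E =
    (giry_int ^~ f) \o (fun x => giry_prod (giry_ret x, k x)).
  by apply/funext => x /=; rewrite /giry_int dirac_prod_int.
apply: measurableT_comp; first exact: measurable_giry_int.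
exact: (measurable_dirac_prod (pr := id) (q := id)).
Qed.

End giry_kernel.

(** Rectangles form a pi-system that generates the product sigma-algebra. *)
Lemma measure_prod_unique_rect (R : realType) (dX dT : measure_display)
  (X : measurableType dX) (T : measurableType dT)
  (m1 m2 : {measure set (X * T) -> \bar R}) :
  (m1 setT < +oo)%E ->
  (forall E U, measurable E -> measurable U -> m1 (E `*` U) = m2 (E `*` U)) ->
  forall A, measurable A -> m1 A = m2 A.
Proof.
move=> m1oo m12.
apply: (measure_unique [set A `*` B | A in measurable & B in measurable] (fun=> setT)) => //.
- by rewrite measurable_prod_measurableType.
- move=> _ _ [A mA [B mB <-]] [A' mA' [B' mB' <-]].
  exists (A `&` A'); first exact: measurableI.
  by exists (B `&` B'); [exact: measurableI|rewrite setXI].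
- by move=> _; exists setT => //; exists setT => //; rewrite setXTT.
- by rewrite bigcup_const//; exists 0%N.
- by move=> _ [A mA [B mB <-]]; exact: m12.
Qed.

Section conditional_law.
Context (R : realType) (dO dX dT : measure_display)
  (Omega : measurableType dO) (X : measurableType dX) (T : measurableType dT).
Variable P : probability Omega R.
Variables (pr : Omega -> X) (k : X -> giry T R).
Hypothesis mpr : measurable_fun setT pr.
Hypothesis mk : measurable_fun setT k.

(** The defining property of a regular conditional law of [tau] given [pr]. *)
Definition has_cond_law (tau : Omega -> T) := forall E U,
  measurable E -> measurable U ->
  P (pr @^-1` E `&` tau @^-1` U) = (\int[P]_(w in pr @^-1` E) k (pr w) U)%E.

Let mpre E : measurable E -> measurable (pr @^-1` E).
Proof. by move=> mE; rewrite -[X in measurable X]setTI; exact: mpr. Qed.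

Lemma cond_law_bind d (Y : measurableType d) (q : Omega -> Y)
    (mq : measurable_fun setT q) E U : measurable E -> measurable U ->
  giry_bind (P : giry Omega R) (measurable_dirac_prod mk mpr mq) (E `*` U) =
  (\int[P]_(w in q @^-1` E) k (pr w) U)%E.
Proof.
move=> mE mU; have mEU : measurable (E `*` U) by exact: measurableX.
rewrite -[E `*` U in LHS]setIT -integral_indic//.
have := giry_int_bind (P : giry Omega R) (measurable_dirac_prod mk mpr mq)
  (h := EFin \o \1_(E `*` U)).
rewrite /giry_int => -> //; last 2 first.
- exact/measurable_EFinP/measurable_indic.
- by move=> z; rewrite lee_fin.
rewrite [RHS]integral_mkcond; apply: eq_integral => w _.
rewrite integral_indic// setIT; apply: (eq_trans (dirac_prodE k _ _ mE mU)).
rewrite patchE indicE in_preimage.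
by case: (q w \in E); rewrite ?mul1e ?mul0e.
Qed.

(** Freezing: once the information [pr w] is fixed, [tau] may be integrated out
    against its conditional law. *)
Lemma cond_law_integral (tau : Omega -> T) (f : X * T -> \bar R) :
  measurable_fun setT tau -> has_cond_law tau ->
  measurable_fun setT f -> (forall z, 0 <= f z)%E ->
  (\int[P]_w f (pr w, tau w) = \int[P]_w \int[k (pr w)]_t f (pr w, t))%E.
Proof.
move=> mtau ltau mf f0.
have mpt : measurable_fun setT (fun w => (pr w, tau w)) by exact/measurable_fun_pairP.
pose mb := giry_bind (P : giry Omega R) (measurable_dirac_prod mk mpr mpr).
have -> : (\int[P]_w f (pr w, tau w) =
    \int[pushforward P (fun w => (pr w, tau w))]_z f z)%E.
  by rewrite ge0_integral_pushforward.
transitivity (\int[mb]_z f z)%E.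
  apply: eq_measure_integral => A mA _.
  apply: (measure_prod_unique_rect
    (m1 := measure_function_pushforward__canonical__measure_function_Measure P mpt)) => //.
    by rewrite /= /pushforward/= preimage_setT probability_setT ltry.
  move=> E U mE mU.
  exact: (eq_trans (ltau _ _ mE mU) (esym (cond_law_bind mpr mE mU))).
have := giry_int_bind (P : giry Omega R) (measurable_dirac_prod mk mpr mpr) mf f0.
rewrite /giry_int => ->.
by apply: eq_integral => w _; rewrite dirac_prod_int.
Qed.

(** A function whose conditional mean vanishes has mean zero: the positive and
    negative parts have the same conditional means, hence the same means. *)
Lemma cond_law_centered (tau : Omega -> T) (f : X * T -> R) :
  measurable_fun setT tau -> has_cond_law tau -> measurable_fun setT f ->
  (forall x, \int[k x]_t (f (x, t))%:E = 0)%E ->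
  P.-integrable setT (fun w => (f (pr w, tau w))%:E) ->
  (\int[P]_w (f (pr w, tau w))%:E = 0)%E.
Proof.
move=> mtau ltau mf f0 intf.
have mfE : measurable_fun setT (EFin \o f) by exact/measurable_EFinP.
have eqk x : (\int[k x]_t ((EFin \o f)^\+ (x, t)) = \int[k x]_t ((EFin \o f)^\- (x, t)))%E.
  have : (\int[k x]_t ((EFin \o f)^\+ (x, t)) -
          \int[k x]_t ((EFin \o f)^\- (x, t)) = 0)%E.
    apply: (etrans _ (f0 x)); rewrite [RHS]integralE.
    by congr (_ - _)%E; apply: eq_integral => t _; rewrite ?funeposE ?funenegE.
  case: (\int[k x]_t _)%E => [a| |]; case: (\int[k x]_t _)%E => [b| |]//=.
  by rewrite -EFinB => -[/eqP]; rewrite subr_eq0 => /eqP->.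
have E1 := cond_law_integral mtau ltau (measurable_funepos mfE) (funepos_ge0 _).
have E2 := cond_law_integral mtau ltau (measurable_funeneg mfE) (funeneg_ge0 _).
have fin := integrable_neg_fin_num measurableT intf.
rewrite integralE; move: fin; set b := (\int[P]_w _^\- w)%E; set a := (\int[P]_w _)%E.
suff -> : a = b by move=> ?; exact: subee.
rewrite /a /b; transitivity (\int[P]_w (EFin \o f)^\+ (pr w, tau w))%E.
  by apply: eq_integral => w _; rewrite !funeposE.
rewrite E1 (eq_integral _ _ (fun w _ => eqk (pr w))) -E2.
by apply: eq_integral => w _; rewrite !funenegE.
Qed.

(** If [tau1] and [tau2] are conditionally independent given [pr], then [tau2]
    keeps its conditional law when [tau1] is added to the information. Hence a
    product of two centred samples can be integrated one factor at a time. *)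
Lemma cond_law_second (tau1 tau2 : Omega -> T) (mtau1 : measurable_fun setT tau1) :
  measurable_fun setT tau2 -> has_cond_law tau1 ->
  (forall E U V, measurable E -> measurable U -> measurable V ->
    P (pr @^-1` E `&` (tau1 @^-1` U `&` tau2 @^-1` V)) =
    (\int[P]_(w in pr @^-1` E) (k (pr w) U * k (pr w) V))%E) ->
  forall W V, measurable W -> measurable V ->
  P ((fun w => (pr w, tau1 w)) @^-1` W `&` tau2 @^-1` V) =
  (\int[P]_(w in (fun w => (pr w, tau1 w)) @^-1` W) k (pr w) V)%E.
Proof.
move=> mtau2 l1 l12 W V mW mV.
have mpt : measurable_fun setT (fun w => (pr w, tau1 w)) by exact/measurable_fun_pairP.
have mV2 : measurable (tau2 @^-1` V) by rewrite -[X in measurable X]setTI; exact: mtau2.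
pose mb := giry_bind (P : giry Omega R) (measurable_dirac_prod mk mpr mpt).
have mTV : measurable ([set: X * T] `*` V) by exact: measurableX.
pose mb' := measure_function_pushforward__canonical__measure_function_Measure
  (mrestr mb mTV) measurable_fst.
pose mP := measure_function_pushforward__canonical__measure_function_Measure
  (mrestr P mV2) mpt.
have mbE W' : measurable W' ->
    (mb' : {measure set _ -> \bar R}) W' = (\int[P]_(w in (fun w => (pr w, tau1 w)) @^-1` W') k (pr w) V)%E.
  move=> mW'; rewrite -(cond_law_bind mpt)//.
  rewrite /mb'/= /pushforward /mrestr; congr (mb _).
  by apply/seteqP; split => [[x t] [? []]|[x t] []].
rewrite -mbE//.
apply: (measure_prod_unique_rect (m1 := mP)) => //.
  rewrite /mP /= /pushforward /mrestr /= preimage_setT setTI.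
  by rewrite (le_lt_trans (probability_le1 _ _))// ltry.
move=> E U mE mU; rewrite mbE//; last exact: measurableX.
transitivity (\int[P]_(w in pr @^-1` E) (k (pr w) U * k (pr w) V))%E.
  rewrite -l12// /mP/= /pushforward /mrestr; congr (P _).
  by apply/seteqP; split => w /=; tauto.
pose f (z : X * T) := ((\1_E z.1 * \1_U z.2)%:E * k z.1 V)%E.
have mf : measurable_fun setT f.
  apply: emeasurable_funM.
    apply/measurable_EFinP; apply: measurable_funM;
      by apply: measurableT_comp => //; exact: measurable_indic.
  apply: (measurableT_comp (measurable_giry_ev mV)).
  exact: measurableT_comp.
have f0 z : (0 <= f z)%E by rewrite mule_ge0// lee_fin mulr_ge0.
transitivity (\int[P]_w f (pr w, tau1 w))%E; last first.
  rewrite [RHS]integral_mkcond; apply: eq_integral => w _.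
  rewrite patchE /f/= !indicE.
  have -> : (w \in (fun w => (pr w, tau1 w)) @^-1` (E `*` U)) =
            (pr w \in E) && (tau1 w \in U).
    by apply/idP/andP; rewrite !inE.
  by case: (pr w \in E); case: (tau1 w \in U); rewrite /= ?mulr1 ?mulr0 ?mul0e ?mul1e.
rewrite cond_law_integral// integral_mkcond; apply: eq_integral => w _.
rewrite patchE /f/= in_preimage indicE; case: (pr w \in E); last first.
  by rewrite integral0_eq// => t _; rewrite mul0r mul0e.
under eq_integral do rewrite mul1r.
rewrite ge0_integralZr//; last exact/measurable_EFinP/measurable_indic.
by rewrite integral_indic// setIT.
Qed.

End conditional_law.

(** * Changing the policy in the law of a trajectory *)

Section integral_functional.
Local Open Scope ereal_scope.
Context (R : realType) (d : measure_display) (T : measurableType d).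
Variables (nu : {measure set T -> \bar R}) (L : (T -> \bar R) -> \bar R).
Hypothesis L_indic : forall U, measurable U -> L (EFin \o \1_U) = nu U.
Hypothesis L_scale : forall (c : R) f, (0 <= c)%R -> measurable_fun setT f ->
  (forall x, 0 <= f x) -> L (fun x => c%:E * f x) = c%:E * L f.
Hypothesis L_add : forall f g, measurable_fun setT f -> (forall x, 0 <= f x) ->
  measurable_fun setT g -> (forall x, 0 <= g x) ->
  L (fun x => f x + g x) = L f + L g.
Hypothesis L_lim : forall f : (T -> \bar R)^nat,
  (forall n, measurable_fun setT (f n)) -> (forall n x, 0 <= f n x) ->
  (forall x, {homo f ^~ x : n m / (n <= m)%N >-> n <= m}) ->
  L (fun x => limn (f ^~ x)) = limn (fun n => L (f n)).

Import HBNNSimple.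

(** Lebesgue integration against [nu] is the only additive, homogeneous and
    monotonically continuous functional that extends [nu]. It transports
    identities between measures to integrals. *)
Lemma integral_functional f : measurable_fun setT f -> (forall x, 0 <= f x) ->
  L f = \int[nu]_x f x.
Proof.
move=> mf f0.
have Lsum (s : seq R) (c : R -> R) (A : R -> set T) :
    (forall y, y \in s -> 0 <= c y)%R -> (forall y, measurable (A y)) ->
    L (fun x => \sum_(y <- s) (c y * \1_(A y) x)%:E) = \sum_(y <- s) (c y)%:E * nu (A y).
  move=> c0 mA.
  have m1 y : measurable_fun setT (EFin \o \1_(A y) : T -> \bar R).
    exact/measurable_EFinP/measurable_indic.
  have mc y : measurable_fun setT (fun x => (c y * \1_(A y) x)%:E).
    by apply/measurable_EFinP; apply: measurable_funM => //; exact: measurable_indic.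
  elim: s c0 => [|y s IHs] c0.
    have -> : (fun x => \sum_(y <- [::]) (c y * \1_(A y) x)%:E) =
        (fun x => 0%:E * (EFin \o \1_(A 0%R)) x).
      by apply/funext => x; rewrite big_nil mul0e.
    by rewrite L_scale ?mul0e ?big_nil// => x; rewrite lee_fin.
  under [X in L X]eq_fun do rewrite big_cons.
  have cy : (0 <= c y)%R by apply: c0; rewrite mem_head.
  have cs z : z \in s -> (0 <= c z)%R by move=> zs; apply: c0; rewrite in_cons zs orbT.
  rewrite L_add//; last 3 first.
  - by move=> x; rewrite lee_fin mulr_ge0.
  - by apply: emeasurable_sum => z.
  - move=> x; rewrite big_seq; apply: sume_ge0 => z zs.
    by rewrite lee_fin mulr_ge0// cs.
  rewrite big_cons IHs//; congr (_ + _).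
  rewrite -L_indic// -L_scale//; last by move=> x; rewrite lee_fin.
pose h := nnsfun_approx measurableT mf.
have cvh x : (EFin \o h n) x @[n --> \oo] --> f x by exact: cvg_nnsfun_approx.
have mh n : measurable_fun setT (EFin \o h n) by exact/measurable_EFinP.
have ndh x : {homo (fun n => (EFin \o h n) x) : n m / (n <= m)%N >-> n <= m}.
  by move=> a b ab; rewrite lee_fin; exact/lefP/nd_nnsfun_approx.
have -> : f = (fun x => limn (fun n => (EFin \o h n) x)).
  by apply/funext => x; apply/esym/cvg_lim.
rewrite L_lim//; last by move=> n x; rewrite lee_fin.
rewrite monotone_convergence//; last by move=> n x _; rewrite lee_fin.
congr (limn _); apply/funext => n.
have hE x : (EFin \o h n) x = \sum_(y <- finmap.enum_fset (fset_set (range (h n)))) (y * \1_(h n @^-1` [set y]) x)%:E.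
  by rewrite /= fimfunE fsbig_finite// sumEFin.
have -> : EFin \o h n = fun x =>
    \sum_(y <- finmap.enum_fset (fset_set (range (h n)))) (y * \1_(h n @^-1` [set y]) x)%:E.
  by apply/funext => x; exact: hE.
have r0 y : y \in finmap.enum_fset (fset_set (range (h n))) -> (0 <= y)%R.
  by rewrite in_fset_set// inE => -[x _ <-].
rewrite Lsum//.
rewrite ge0_integral_sum//; last 2 first.
- move=> y; apply/measurable_EFinP; apply: measurable_funM => //.
- by move=> y x _; exact: nnfun_muleindic_ge0.
rewrite [LHS]big_seq [RHS]big_seq; apply: eq_bigr => y /r0 y0.
under eq_integral do rewrite EFinM.
rewrite ge0_integralZl//; last exact/measurable_EFinP.
by rewrite integral_indic// setIT.
Qed.

End integral_functional.

Section density.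
Local Open Scope ereal_scope.
Context (R : realType) (d : measure_display) (T : measurableType d).

Lemma integral_density (mu nu : {measure set T -> \bar R}) (p : T -> R) f :
  measurable_fun setT p -> (forall t, 0 <= p t)%R ->
  (forall U, measurable U -> nu U = \int[mu]_(t in U) (p t)%:E) ->
  measurable_fun setT f -> (forall t, 0 <= f t) ->
  \int[nu]_t f t = \int[mu]_t (f t * (p t)%:E).
Proof.
move=> mp p0 nuE mf f0; apply/esym.
have mpE : measurable_fun setT (EFin \o p) by exact/measurable_EFinP.
have p0E t : 0 <= (p t)%:E by rewrite lee_fin.
apply: (@integral_functional _ _ _ nu (fun f => \int[mu]_t (f t * (p t)%:E))) => //.
- move=> U mU; rewrite nuE// [RHS]integral_mkcond; apply: eq_integral => t _.
  by rewrite patchE /= indicE; case: (t \in U); rewrite ?mul1e ?mul0e.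
- move=> c h c0 mh h0; under eq_integral do rewrite -muleA.
  rewrite ge0_integralZl//; last 2 first.
  + by apply: emeasurable_funM.
  + by move=> t _; exact: mule_ge0.
- move=> h1 h2 m1 h10 m2 h20.
  under eq_integral do rewrite ge0_muleDl//.
  rewrite ge0_integralD//; try by move=> t _; exact: mule_ge0.
  + by apply: emeasurable_funM.
  + by apply: emeasurable_funM.
- move=> h mh h0 nd; rewrite -monotone_convergence//; last 3 first.
  + by move=> n; apply: emeasurable_funM.
  + by move=> n t _; exact: mule_ge0.
  + by move=> t _ a b ab; apply: lee_wpmul2r => //; exact: nd.
  apply: eq_integral => t _; apply/esym/cvg_lim => //.
  apply: cvgeZr => //.
  exact: ereal_nondecreasing_is_cvgn.
Qed.

End density.

Section mixture_integral.
Local Open Scope ereal_scope.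
Context (R : realType) (dS dA : measure_display)
        (S : measurableType dS) (A : measurableType dA).

Lemma mixture_integral n (rho : probability S R) (k : R.-pker S ~> n.-tuple (S * A)) f :
  measurable_fun setT f -> (forall t, 0 <= f t) ->
  \int[mixture rho k]_t f t = \int[rho]_s \int[k s]_t f t.
Proof.
move=> mf f0; apply/esym.
have mk g : measurable_fun setT g -> (forall t, 0 <= g t) ->
    measurable_fun setT (fun s => \int[k s]_t g t).
  by move=> mg g0; apply: measurable_fun_integral_kernel => //; exact: measurable_kernel.
apply: (@integral_functional _ _ _ (mixture rho k)
  (fun f => \int[rho]_s \int[k s]_t f t)) => //.
- move=> U mU; apply: eq_integral => s _.
  by rewrite integral_indic// setIT.
- move=> c h c0 mh h0; rewrite -ge0_integralZl//; last 2 first.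
  + exact: mk.
  + by move=> s _; exact: integral_ge0.
  by apply: eq_integral => s _; rewrite ge0_integralZl.
- move=> h1 h2 m1 h10 m2 h20.
  rewrite -ge0_integralD//; try by move=> s _; exact: integral_ge0.
  + by apply: eq_integral => s _; rewrite ge0_integralD.
  + exact: mk.
  + exact: mk.
- move=> h mh h0 nd; rewrite -monotone_convergence//; last 3 first.
  + by move=> n'; exact: mk.
  + by move=> n' s _; exact: integral_ge0.
  + by move=> s _ a b ab; apply: ge0_le_integral => // t _; exact: nd.
  by apply: eq_integral => s _; rewrite monotone_convergence// => t _ a b; exact: nd.
Qed.

Lemma kcons_integral n (k : R.-pker S ~> n.-tuple (S * A)) z f :
  measurable_fun setT f -> (forall t, 0 <= f t) ->
  \int[kcons k z]_t f t = \int[k z.2]_t f (cons_pair z.1 t).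
Proof.
move=> mf f0; rewrite /kcons/= ge0_integral_pushforward//.
exact: measurable_cons_pair.
Qed.

Lemma traj_step_integral (pi : R.-pker S ~> A) (p : R.-pker (S * A) ~> S) n
    (k : R.-pker S ~> n.-tuple (S * A)) s f :
  measurable_fun setT f -> (forall t, 0 <= f t) ->
  \int[traj_step pi p k s]_t f t =
  \int[pi s]_a \int[p (s, a)]_s' \int[k s']_t f (cons_pair (s, a) t).
Proof.
move=> mf f0; rewrite /traj_step integral_kcomp//; apply: eq_integral => a _.
rewrite integral_kcomp//; apply: eq_integral => s' _.
exact: kcons_integral.
Qed.

(** Induction on the horizon: the first action contributes its own factor, and
    the others come from the kernel of the shorter trajectories. Initial and
    transition laws do not depend on the policy and are never differentiated. *)
Lemma traj_ker_reweight (pi1 pi2 : R.-pker S ~> A) (p : R.-pker (S * A) ~> S)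
    (w : S -> A -> R) :
  (forall s a, 0 <= w s a)%R ->
  measurable_fun setT (fun x : S * A => w x.1 x.2) ->
  (forall s h, measurable_fun setT h -> (forall a, 0 <= h a) ->
    \int[pi2 s]_a h a = \int[pi1 s]_a (h a * (w s a)%:E)) ->
  forall n s f, measurable_fun setT f -> (forall t, 0 <= f t) ->
  \int[traj_ker pi2 p n s]_t f t =
  \int[traj_ker pi1 p n s]_t
    (f t * (\prod_(i < n) w (tnth t i).1 (tnth t i).2)%R%:E).
Proof.
move=> w0 mw hw; elim => [|n IHn] s f mf f0.
  rewrite [traj_ker pi1 p 0]/= [traj_ker pi2 p 0]/=.
  by apply: eq_integral => t _; rewrite big_ord0 mule1.
have prod_ge0 m (t : m.-tuple (S * A)) :
    (0 <= \prod_(i < m) w (tnth t i).1 (tnth t i).2)%R by apply: prodr_ge0 => i _.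
have mprod m : measurable_fun setT
    (fun t : m.-tuple (S * A) => (\prod_(i < m) w (tnth t i).1 (tnth t i).2)%R).
  apply: measurable_prod => i _.
  apply: (measurableT_comp mw); exact: measurable_tnth.
have fcons a s' : measurable_fun setT
   (fun t : n.-tuple (S * A) => f (cons_pair (s', a) t)).
  by apply: measurableT_comp => //; exact: measurable_cons_pair.
have mfp m (g : m.-tuple (S * A) -> \bar R) : measurable_fun setT g ->
    measurable_fun setT (fun t : m.-tuple (S * A) =>
      g t * (\prod_(i < m) w (tnth t i).1 (tnth t i).2)%R%:E).
  by move=> mg; apply: emeasurable_funM => //; apply/measurable_EFinP; exact: mprod.
rewrite [LHS]traj_step_integral// [RHS]traj_step_integral//; last 2 first.
- exact: mfp.
- by move=> t; rewrite mule_ge0// lee_fin.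
pose F a := \int[p (s, a)]_s' \int[traj_ker pi1 p n s']_t
   (f (cons_pair (s, a) t) * (\prod_(i < n) w (tnth t i).1 (tnth t i).2)%R%:E).
transitivity (\int[pi2 s]_a F a).
  by apply: eq_integral => a _; apply: eq_integral => s' _; rewrite IHn.
rewrite hw; last 2 first.
- pose h (t : n.+1.-tuple (S * A)) := f t *
    (\prod_(i < n) w (tnth t (lift ord0 i)).1 (tnth t (lift ord0 i)).2)%R%:E.
  have mh : measurable_fun setT h.
    apply: emeasurable_funM => //; apply/measurable_EFinP.
    apply: measurable_prod => i _.
    apply: (measurableT_comp mw); exact: measurable_tnth.
  have h0 t : 0 <= h t.
    by rewrite mule_ge0// lee_fin; apply: prodr_ge0 => i _.
  have -> : F = (fun x => \int[(p \; kcons (traj_ker pi1 p n))%E x]_t h t) \o (pair s).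
    apply/funext => a /=; rewrite integral_kcomp//; apply: eq_integral => s' _.
    rewrite kcons_integral//; apply: eq_integral => t _ /=; congr (_ * _%:E); apply: eq_bigr => i _.
    by rewrite /cons_pair tnthS.
  apply: measurableT_comp; last exact: measurable_pair1.
  apply: measurable_fun_integral_kernel => // U mU.
  exact: measurable_kernel.
- move=> a; apply: integral_ge0 => s' _; apply: integral_ge0 => t _.
  by rewrite mule_ge0// lee_fin.
apply: eq_integral => a _; rewrite /F -ge0_integralZr//; last 3 first.
- apply: measurable_fun_integral_kernel => //; first exact: measurable_kernel.
  + by move=> t; rewrite mule_ge0// lee_fin.
  + exact: mfp.
- move=> s' _; apply: integral_ge0 => t _.
  by rewrite mule_ge0// lee_fin.
- by rewrite lee_fin.
apply: eq_integral => s' _; rewrite -ge0_integralZr//; last 3 first.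
- exact: mfp.
- by move=> t _; rewrite mule_ge0// lee_fin.
- by rewrite lee_fin.
apply: eq_integral => t _; rewrite big_ord_recl -muleA -EFinM mulrC.
by congr (_ * (_ * _)%:E); apply: eq_bigr => i _; rewrite /cons_pair tnthS.
Qed.

End mixture_integral.

Section policy_regularity.
Context (R : realType) (dS dA : measure_display)
        (S : measurableType dS) (A : measurableType dA).
Variables (M : mdp R S A) (d : nat) (pi : policy R S A d).
Variables (G C_H Rmax : R).
Hypothesis A2 : regular_policy M pi G C_H Rmax.
Local Notation Theta := 'rV[R]_d.

Lemma expR_log_dens s a (u : Theta) : expR (log_dens pi s a u) = dens pi u s a.
Proof. by rewrite /log_dens lnK// posrE dens_gt0. Qed.

(** Bounded scores make the log-density Lipschitz in the parameter, which gives
    the joint measurability of the density that the model does not assume. *)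
Lemma measurable_dens_param dX (X : measurableType dX) (theta : X -> Theta) :
  (forall i, measurable_fun setT (fun x => theta x 0 i)) ->
  measurable_fun setT (fun z : X * (S * A) => dens pi (theta z.1) z.2.1 z.2.2).
Proof.
move=> mtheta.
have m := @measurable_fun_lipschitz_param R d dX _ X _ theta
  (fun sa u => log_dens pi sa.1 sa.2 u) G mtheta.
apply: (eq_measurable_fun (fun z : X * (S * A) => expR (log_dens pi z.2.1 z.2.2 (theta z.1)))).
  by move=> z _; rewrite expR_log_dens.
apply: measurableT_comp; first exact: measurable_expR.
apply: m => [u|[s a] u w].
  rewrite /log_dens; apply: (measurableT_comp (@measurable_ln R)).
  exact: measurable_dens.
apply: (@lipschitz_partial _ _ (log_dens pi s a)) => x i.
by have [_ _ _ _ h] := A2; exact: (h s a i).1.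
Qed.

Lemma measurable_likelihood dX (X : measurableType dX) (theta : X -> Theta) :
  (forall i, measurable_fun setT (fun x => theta x 0 i)) ->
  measurable_fun setT (fun z : X * traj M => likelihood pi z.2 (theta z.1)).
Proof.
move=> mtheta; apply: measurable_prod => t _.
pose q (z : X * traj M) : X * (S * A) := (z.1, tnth z.2 t).
have mq : measurable_fun setT q.
  apply/measurable_fun_pairP; split; first exact: measurable_fst.
  apply: (measurableT_comp (f := fun x => tnth x t)); first exact: measurable_tnth.
  exact: measurable_snd.
exact: (measurableT_comp (measurable_dens_param mtheta) mq).
Qed.

Lemma likelihood_gt0 tau (u : Theta) : 0 < likelihood (M := M) pi tau u.
Proof. by apply: prodr_gt0 => t _; exact: dens_gt0. Qed.

Lemma iweight_ge0 tau (u1 u2 : Theta) : 0 <= iweight (M := M) pi tau u1 u2.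
Proof. by rewrite divr_ge0// ltW// likelihood_gt0. Qed.

Lemma measurable_iweight dX (X : measurableType dX) (th1 th2 : X -> Theta) :
  (forall i, measurable_fun setT (fun x => th1 x 0 i)) ->
  (forall i, measurable_fun setT (fun x => th2 x 0 i)) ->
  measurable_fun setT (fun z : X * traj M => iweight pi z.2 (th1 z.1) (th2 z.1)).
Proof.
move=> m1 m2; apply: (eq_measurable_fun (fun z : X * traj M =>
    expR (ln (likelihood pi z.2 (th2 z.1)) - ln (likelihood pi z.2 (th1 z.1))))).
  by move=> z _; rewrite expRB !lnK// posrE likelihood_gt0.
apply: (measurableT_comp (@measurable_expR R)); apply: measurable_funB;
  apply: (measurableT_comp (@measurable_ln R)); exact: measurable_likelihood.
Qed.

Lemma measurable_iweight_cst (u1 u2 : Theta) :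
  measurable_fun setT (fun tau : traj M => iweight pi tau u1 u2).
Proof.
have h := @measurable_iweight _ (traj M) (fun=> u1) (fun=> u2)
  (fun i => measurable_cst _) (fun i => measurable_cst _).
apply: (measurableT_comp h (g := fun t : traj M => (t, t))).
by apply/measurable_fun_pairP; split; exact: measurable_id.
Qed.

Lemma traj_dist_integral (u : Theta) (f : traj M -> \bar R) :
  measurable_fun setT f -> (forall tau, 0 <= f tau)%E ->
  (\int[traj_dist M pi u]_tau f tau =
   \int[init M]_s \int[traj_ker (act pi u) (trans M) (horizon M) s]_t f t)%E.
Proof. exact: mixture_integral. Qed.

(* From here on the law is known only through its integrals. *)
Local Opaque traj_dist.

Lemma traj_dist_reweight (u1 u2 : Theta) (f : traj M -> \bar R) :
  measurable_fun setT f -> (forall tau, 0 <= f tau)%E ->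
  (\int[traj_dist M pi u2]_tau f tau =
   \int[traj_dist M pi u1]_tau (f tau * (iweight pi tau u1 u2)%:E))%E.
Proof.
move=> mf f0.
have mi := measurable_iweight_cst u1 u2.
have mfi : measurable_fun setT (fun tau => f tau * (iweight pi tau u1 u2)%:E)%E.
  by apply: emeasurable_funM => //; exact/measurable_EFinP.
have fi0 tau : (0 <= f tau * (iweight pi tau u1 u2)%:E)%E.
  by rewrite mule_ge0// lee_fin iweight_ge0.
rewrite (traj_dist_integral u2 mf f0) (traj_dist_integral u1 mfi fi0).
apply: eq_integral => s _.
pose w s a := dens pi u2 s a / dens pi u1 s a.
have w0 s' a : 0 <= w s' a by rewrite divr_ge0// ltW// dens_gt0.
have mdens u : measurable_fun setT (fun x : S * A => dens pi u x.1 x.2).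
  exact: measurable_dens.
have mw : measurable_fun setT (fun x : S * A => w x.1 x.2).
  apply: (eq_measurable_fun (fun x : S * A => expR (ln (dens pi u2 x.1 x.2) - ln (dens pi u1 x.1 x.2)))).
    by move=> z _; rewrite expRB !lnK// posrE dens_gt0.
  apply: (measurableT_comp (@measurable_expR R)); apply: measurable_funB;
    exact: (measurableT_comp (@measurable_ln R)).
have mds u s' : measurable_fun setT (fun a : A => dens pi u s' a).
  exact: (measurableT_comp (mdens u) (measurable_pair1 s')).
have mws s' : measurable_fun setT (fun a : A => w s' a).
  exact: (measurableT_comp mw (measurable_pair1 s')).
have hw s' (h : A -> \bar R) : measurable_fun setT h -> (forall a, 0 <= h a)%E ->
    (\int[act pi u2 s']_a h a = \int[act pi u1 s']_a (h a * (w s' a)%:E))%E.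
  move=> mh h0.
  have mhw : measurable_fun setT (fun a => h a * (w s' a)%:E)%E.
    by apply: emeasurable_funM => //; exact/measurable_EFinP.
  have hw0 a : (0 <= h a * (w s' a)%:E)%E by rewrite mule_ge0// lee_fin.
  have pos u a : 0 <= dens pi u s' a by exact/ltW/dens_gt0.
  rewrite (integral_density (mds u2 s') (pos u2) (act_dens pi u2 s') mh h0).
  rewrite (integral_density (mds u1 s') (pos u1) (act_dens pi u1 s') mhw hw0).
  apply: eq_integral => a _; rewrite -muleA -EFinM /w divfK// gt_eqF//.
  exact: dens_gt0.
rewrite (traj_ker_reweight (trans M) w0 mw hw s mf f0); apply: eq_integral => t _.
by rewrite /iweight /likelihood -prodf_div.
Qed.

(** Positive and negative parts are reweighted separately. *)
Lemma traj_dist_reweight_signed (u1 u2 : Theta) (f : traj M -> R) :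
  measurable_fun setT f ->
  (\int[traj_dist M pi u2]_tau (f tau)%:E =
   \int[traj_dist M pi u1]_tau (f tau * iweight pi tau u1 u2)%:E)%E.
Proof.
move=> mf.
have mfE : measurable_fun setT (EFin \o f) by exact/measurable_EFinP.
have Hp := traj_dist_reweight u1 u2 (measurable_funepos mfE) (funepos_ge0 _).
have Hn := traj_dist_reweight u1 u2 (measurable_funeneg mfE) (funeneg_ge0 _).
rewrite integralE [in RHS]integralE; rewrite Hp Hn; congr (_ - _)%E.
- apply: eq_integral => tau _; rewrite !funeposE /= -!EFin_max -EFinM.
  have := iweight_ge0 tau u1 u2; move: (iweight _ _ _ _) (f tau) => r x r0.
  by congr EFin; rewrite (maxr_pMl _ _ r0) mul0r.
- apply: eq_integral => tau _; rewrite !funenegE /= -!EFin_max -EFinM.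
  have := iweight_ge0 tau u1 u2; move: (iweight _ _ _ _) (f tau) => r x r0.
  by congr EFin; rewrite (maxr_pMl _ _ r0) mul0r mulNr.
Qed.

(** Seen from the fixed parameter [0], the probability of an event is the
    integral of a jointly measurable weight. *)
Lemma measurable_traj_dist dX (X : measurableType dX) (theta : X -> Theta) :
  (forall i, measurable_fun setT (fun x => theta x 0 i)) ->
  measurable_fun setT (fun x => traj_dist M pi (theta x) : giry (traj M) R).
Proof.
move=> mtheta; apply: measurable_giry_codensity => // B mB.
have mB1 : measurable_fun setT (EFin \o \1_B : traj M -> \bar R).
  exact/measurable_EFinP/measurable_indic.
rewrite (_ : (fun x => _) = (fun x => (\int[traj_dist M pi 0]_tau
    ((EFin \o \1_B) tau * (iweight pi tau 0 (theta x))%:E))%E)); last first.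
  have B0 tau : (0 <= (EFin \o \1_B : traj M -> \bar R) tau)%E by rewrite lee_fin.
  apply/funext => x; rewrite -(traj_dist_reweight 0 (theta x) mB1 B0).
  by rewrite integral_indic// setIT.
apply: (measurable_fun_fubini_tonelli_F
  (fun z : X * traj M => (EFin \o \1_B) z.2 * (iweight pi z.2 0 (theta z.1))%:E)%E).
- apply: emeasurable_funM; first exact: (measurableT_comp mB1 measurable_snd).
  apply/measurable_EFinP.
  exact: (measurable_iweight (th1 := fun=> 0) (fun i => measurable_cst _) mtheta).
- by move=> z; rewrite mule_ge0 ?lee_fin ?iweight_ge0.
Qed.

Lemma J_bounded (u : Theta) : `|J M pi u| <= Rmax * (horizon M)%:R.
Proof.
have [_ _ R0 hR _] := A2.
have g0 := gamma_ge0 M; have g1 := gamma_lt1 M.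
have b (tau : traj M) : `|return_of tau| <= Rmax * (horizon M)%:R.
  rewrite /return_of; apply: (le_trans (ler_norm_sum _ _ _)).
  apply: (@le_trans _ _ (\sum_(t < horizon M) Rmax)).
    apply: ler_sum => t _; rewrite normrM ger0_norm ?exprn_ge0//.
    by rewrite (le_trans _ (hR (state tau t) (action tau t)))// ler_piMl// exprn_ile1// ltW.
  by rewrite sumr_const card_ord mulr_natr.
have mr : measurable_fun setT (@return_of _ _ _ _ _ M).
  apply: measurable_sum => t; apply: measurable_funM; first exact: measurable_cst.
  apply: (measurableT_comp (@measurable_reward _ _ _ _ _ M)
    (g := fun tau : traj M => tnth tau t)).
  exact: measurable_tnth.
have h : (`|'E_(traj_dist M pi u)[@return_of _ _ _ _ _ M]| <= (Rmax * (horizon M)%:R)%:E)%E.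
  rewrite unlock; apply: (le_trans (le_abse_integral _ _ _)) => //; first exact/measurable_EFinP.
  apply: (@le_trans _ _ (\int[traj_dist M pi u]_tau (Rmax * (horizon M)%:R)%:E)%E).
    apply: ge0_le_integral => //.
    - by apply: measurableT_comp => //; exact/measurable_EFinP.
    - by move=> tau _; rewrite /= lee_fin.
  by rewrite integral_cst// [X in (_ * X)%E]probability_setT mule1.
have fin : ('E_(traj_dist M pi u)[@return_of _ _ _ _ _ M] \is a fin_num)%E.
  by rewrite fin_num_abs (le_lt_trans h)// ltry.
by move: h; rewrite -(fineK fin) abse_EFin lee_fin.
Qed.

End policy_regularity.

(** * Second moments and mini-batches *)

Definition rintegrable (R : realType) (d : measure_display) (T : measurableType d)
  (mu : probability T R) (f : T -> R) : Prop :=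
  mu.-integrable setT (fun t => (f t)%:E).

Section square_integrable.
Context (R : realType) (d : measure_display) (T : measurableType d).
Variable mu : probability T R.
Implicit Types f g : T -> R.
Local Notation int1 := (rintegrable mu).

(** Measurability of [f] is kept apart, since it does not follow from that of the
    square. *)
Definition sq_integrable f := measurable_fun setT f /\ int1 (fun t => f t ^+ 2).

Lemma integrable_measurable f : int1 f -> measurable_fun setT f.
Proof. by move=> /measurable_int/measurable_EFinP. Qed.

Lemma integrable_dominated f g : measurable_fun setT f ->
  (forall t, `|f t| <= g t) -> int1 g -> int1 f.
Proof.
move=> mf fg ig; apply: le_integrable ig => //; first exact/measurable_EFinP.
move=> t _ /=; rewrite lee_fin (le_trans (fg t))// ler_norm//.
Qed.

Lemma integrable_add f g : int1 f -> int1 g -> int1 (fun t => f t + g t).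
Proof.
move=> fi gi; apply: eq_integrable (integrableD measurableT fi gi) => //.
Qed.

Lemma integrable_scale c f : int1 f -> int1 (fun t => c * f t).
Proof. by move=> fi; apply: eq_integrable (integrableZl measurableT c fi). Qed.

Lemma integrable_bigsum I (s : seq I) (F : I -> T -> R) :
  (forall i, int1 (F i)) -> int1 (fun t => \sum_(i <- s) F i t).
Proof.
move=> Fi; apply: eq_integrable (integrable_sum measurableT s (P := xpredT) (fun i _ => Fi i)) => //.
by move=> t _ /=; rewrite sumEFin.
Qed.

Lemma integrable_constant c : int1 (fun=> c).
Proof. exact: finite_measure_integrable_cst. Qed.

Lemma integrable_bounded f C : measurable_fun setT f -> (forall t, `|f t| <= C) -> int1 f.
Proof. by move=> mf fC; apply: (integrable_dominated mf fC); exact: integrable_constant. Qed.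

Lemma Rintegral_add f g : int1 f -> int1 g ->
  \int[mu]_t (f t + g t) = \int[mu]_t f t + \int[mu]_t g t.
Proof. exact: RintegralD. Qed.

Lemma Rintegral_scale c f : int1 f -> \int[mu]_t (c * f t) = c * \int[mu]_t f t.
Proof. exact: RintegralZl. Qed.

Lemma Rintegral_bigsum I (s : seq I) (F : I -> T -> R) : (forall i, int1 (F i)) ->
  \int[mu]_t (\sum_(i <- s) F i t) = \sum_(i <- s) \int[mu]_t F i t.
Proof.
move=> Fi; elim: s => [|i s IHs].
  rewrite big_nil; under eq_Rintegral do rewrite big_nil.
  by rewrite Rintegral_cst// mul0r.
rewrite big_cons -IHs -RintegralD//; [|exact: Fi|exact: integrable_bigsum].
by apply: eq_Rintegral => t _; rewrite big_cons.
Qed.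

Lemma Rintegral_constant c : \int[mu]_t c = c.
Proof. by rewrite Rintegral_cst// [X in fine X]probability_setT mulr1. Qed.

Lemma Rintegral_mono f g : int1 f -> int1 g -> (forall t, f t <= g t) ->
  \int[mu]_t f t <= \int[mu]_t g t.
Proof. by move=> fi gi fg; apply: le_Rintegral => // t _. Qed.

Lemma EFin_Rintegral f : int1 f -> (\int[mu]_t f t)%:E = (\int[mu]_t (f t)%:E)%E.
Proof. by move=> fi; rewrite fineK// integrable_fin_num. Qed.

Lemma integrable_mul f g : sq_integrable f -> sq_integrable g ->
  int1 (fun t => f t * g t).
Proof.
move=> [mf fi] [mg gi]; apply: (integrable_dominated (g := fun t => f t ^+ 2 + g t ^+ 2)).
- exact: measurable_funM.
- move=> t; rewrite ler_norml; apply/andP; split.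
    by have := sqr_ge0 (f t + g t); have := sqr_ge0 (f t); have := sqr_ge0 (g t); nra.
  by have := sqr_ge0 (f t - g t); have := sqr_ge0 (f t); have := sqr_ge0 (g t); nra.
- exact: integrable_add.
Qed.

Lemma sq_integrable_constant c : sq_integrable (fun=> c).
Proof. by split; [exact: measurable_cst|exact: integrable_constant]. Qed.

Lemma sq_integrable1 f : sq_integrable f -> int1 f.
Proof.
move=> fi; have := integrable_mul fi (sq_integrable_constant 1).
by apply: eq_integrable => // t _; rewrite mulr1.
Qed.

Lemma sq_integrable_add f g : sq_integrable f -> sq_integrable g ->
  sq_integrable (fun t => f t + g t).
Proof.
move=> sf sg; have fg := integrable_mul sf sg; move: sf sg => [mf fi] [mg gi].
split; first exact: measurable_funD.
have := integrable_add (integrable_add fi gi) (integrable_scale 2 fg).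
by apply: eq_integrable => // t _; congr EFin; ring.
Qed.

Lemma sq_integrable_sum (s : seq nat) (F : nat -> T -> R) :
  (forall i, i \in s -> sq_integrable (F i)) ->
  sq_integrable (fun t => \sum_(i <- s) F i t).
Proof.
elim: s => [|i s IHs] h.
  have -> : (fun t => \sum_(i <- [::]) F i t) = (fun=> 0).
    by apply/funext => t; rewrite big_nil.
  exact: sq_integrable_constant.
have -> : (fun t => \sum_(i <- i :: s) F i t) = (fun t => F i t + \sum_(i <- s) F i t).
  by apply/funext => t; rewrite big_cons.
apply: sq_integrable_add; first by apply: h; rewrite mem_head.
by apply: IHs => j js; apply: h; rewrite in_cons js orbT.
Qed.

Lemma sq_integrable_dominated f g : measurable_fun setT f ->
  (forall t, f t ^+ 2 <= g t) -> int1 g -> sq_integrable f.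
Proof.
move=> mf fg ig; split => //; apply: (integrable_dominated _ _ ig).
  exact: measurable_funX.
by move=> t; rewrite ger0_norm ?sqr_ge0.
Qed.

(** Pythagoras: adding the summands one by one, each is orthogonal to the sum of
    the previous ones. *)
Lemma orthogonal_sum_sq n (F : nat -> T -> R) (Z : T -> R) :
  (forall i, (i < n)%N -> sq_integrable (F i)) -> sq_integrable Z ->
  (forall i j, (i < j)%N -> (j < n)%N -> \int[mu]_t (F i t * F j t) = 0) ->
  (forall i, (i < n)%N -> \int[mu]_t (Z t * F i t) = 0) ->
  \int[mu]_t ((\sum_(0 <= i < n) F i t + Z t) ^+ 2) =
  \sum_(0 <= i < n) \int[mu]_t (F i t ^+ 2) + \int[mu]_t (Z t ^+ 2).
Proof.
elim: n => [|n IHn] hF hZ hFF hZF.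
  rewrite big_geq// add0r; apply: eq_Rintegral => t _.
  by rewrite big_geq// add0r.
have hF' i : (i < n)%N -> sq_integrable (F i) by move=> /ltnW; exact: hF.
have sS : sq_integrable (fun t => \sum_(0 <= i < n) F i t + Z t).
  apply: sq_integrable_add => //; apply: sq_integrable_sum => i.
  by rewrite mem_index_iota => /hF'.
have sFn := hF n (ltnSn n).
rewrite big_nat_recr//= addrAC -IHn//; last 2 first.
- by move=> i j ij jn; apply: hFF => //; exact: ltnW.
- by move=> i /ltnW; exact: hZF.
have iFi i : int1 (fun t => if (i < n)%N then F i t * F n t else 0).
  by case: (ltnP i n) => [/hF' h|_]; [exact: integrable_mul|exact: integrable_constant].
have E0 : \int[mu]_t ((\sum_(0 <= i < n) F i t + Z t) * F n t) = 0.
  transitivity (\int[mu]_t (\sum_(0 <= i < n) (if (i < n)%N then F i t * F n t else 0) + Z t * F n t)).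
    apply: eq_Rintegral => t _; rewrite mulrDl mulr_suml; congr (_ + _).
    by apply: eq_big_nat => i /andP[_ ->].
  rewrite Rintegral_add//; [|exact: integrable_bigsum|exact: integrable_mul].
  rewrite Rintegral_bigsum// hZF// addr0 big_nat big1// => i /andP[_ ilt].
  by rewrite ilt hFF.
transitivity (\int[mu]_t ((\sum_(0 <= i < n) F i t + Z t) ^+ 2 + F n t ^+ 2 +
    2 * ((\sum_(0 <= i < n) F i t + Z t) * F n t))).
  by apply: eq_Rintegral => t _; rewrite big_nat_recr//=; ring.
have i1 := sS.2; have i2 := sFn.2; have i3 := integrable_mul sS sFn.
rewrite Rintegral_add//; [|exact: integrable_add|exact: integrable_scale].
by rewrite (Rintegral_add i1 i2) (Rintegral_scale _ i3) E0 mulr0 addr0.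
Qed.

(** The bias-variance decomposition; in particular centring cannot increase the
    second moment. *)
Lemma second_moment_centered f m : sq_integrable f -> \int[mu]_t f t = m ->
  \int[mu]_t ((f t - m) ^+ 2) + m ^+ 2 = \int[mu]_t (f t ^+ 2).
Proof.
move=> sf Ef; have i1 := sq_integrable1 sf; have i2 := sf.2.
have E : \int[mu]_t ((f t - m) ^+ 2) =
    \int[mu]_t (f t ^+ 2 + ((- (2 * m)) * f t + m ^+ 2)).
  by apply: eq_Rintegral => t _; ring.
have i3 := integrable_constant (m ^+ 2).
have i4 := integrable_scale (- (2 * m)) i1.
rewrite E Rintegral_add//; last exact: integrable_add.
rewrite (Rintegral_add i4 i3) (Rintegral_scale _ i1).
by rewrite Rintegral_constant Ef; ring.
Qed.

End square_integrable.

Section conditional_minibatch.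
Context (R : realType) (d : nat) (dO dX dT : measure_display)
  (Omega : measurableType dO) (X : measurableType dX) (T : measurableType dT).
Variable P : probability Omega R.
Variables (pr : Omega -> X) (k : X -> probability T R).
Hypothesis mpr : measurable_fun setT pr.
Hypothesis mk : measurable_fun setT (k : X -> giry T R).
Local Notation int1 := (rintegrable P).

(** A bound on the conditional means is enough: the unconditional mean of a
    nonnegative function is the mean of the conditional ones. *)
Lemma cond_law_integrable (tau : Omega -> T) (f : X * T -> R) (s : X -> R) :
  measurable_fun setT tau -> has_cond_law P pr (k : X -> giry T R) tau ->
  measurable_fun setT f -> (forall z, 0 <= f z) ->
  (forall x, \int[k x]_t (f (x, t))%:E <= (s x)%:E)%E ->
  int1 (fun w => s (pr w)) ->
  int1 (fun w => f (pr w, tau w)) /\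
  \int[P]_w f (pr w, tau w) <= \int[P]_w s (pr w).
Proof.
move=> mtau ltau mf f0 fs si.
have mfE : measurable_fun setT (EFin \o f) by exact/measurable_EFinP.
have f0E z : (0 <= (EFin \o f) z)%E by rewrite lee_fin.
have E := cond_law_integral mpr mk mtau ltau mfE f0E.
have hle : (\int[P]_w (f (pr w, tau w))%:E <= \int[P]_w (s (pr w))%:E)%E.
  rewrite [leLHS]E; apply: ge0_le_integral => //.
  - by move=> w _; exact: integral_ge0.
  - exact: (measurableT_comp (measurable_giry_section_int mk mfE f0E) mpr).
  - by case/integrableP : si.
  - by move=> w _; exact: fs.
have mft : measurable_fun setT (fun w => f (pr w, tau w)).
  by apply: (measurableT_comp mf); exact/measurable_fun_pairP.
have fi : int1 (fun w => f (pr w, tau w)).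
  apply/integrableP; split; first exact/measurable_EFinP.
  under eq_integral do rewrite gee0_abs ?lee_fin//.
  rewrite (le_lt_trans hle)//.
  by have /fin_numPlt/andP[] := integrable_fin_num measurableT si.
by split => //; rewrite -lee_fin !EFin_Rintegral.
Qed.

Variables (tau : nat -> Omega -> T).
Hypothesis mtau : forall i, measurable_fun setT (tau i).
Hypothesis law1 : forall i, has_cond_law P pr (k : X -> giry T R) (tau i).
Hypothesis law2 : forall i j, (i < j)%N ->
  forall E U V, measurable E -> measurable U -> measurable V ->
    P (pr @^-1` E `&` (tau i @^-1` U `&` tau j @^-1` V)) =
    (\int[P]_(w in pr @^-1` E) (k (pr w) U * k (pr w) V))%E.

Variables (y : X * T -> 'rV[R]_d) (s : X -> R) (z : X -> 'rV[R]_d) (a : nat -> X -> R).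
Hypothesis my : forall c, measurable_fun setT (fun xt => y xt 0 c).
Hypothesis y0 : forall x c, (\int[k x]_t (y (x, t) 0 c)%:E = 0)%E.
Hypothesis ys : forall x, (\int[k x]_t (enorm (y (x, t)) ^+ 2)%:E <= (s x)%:E)%E.
Hypothesis si : int1 (fun w => s (pr w)).
Hypothesis ms : measurable_fun setT s.
Hypothesis mz : forall c, measurable_fun setT (fun x => z x 0 c).
Hypothesis zi : int1 (fun w => enorm (z (pr w)) ^+ 2).
Hypothesis ma : forall i, measurable_fun setT (a i).
Hypothesis a01 : forall i x, 0 <= a i x <= 1.

Lemma measurable_enorm_sq d' (Z : measurableType d') (h : Z -> 'rV[R]_d) :
  (forall c, measurable_fun setT (fun x => h x 0 c)) ->
  measurable_fun setT (fun x => enorm (h x) ^+ 2).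
Proof.
move=> mh; under eq_fun do rewrite enorm_sqE.
by apply: measurable_sum => c; exact: measurable_funX.
Qed.

(** The error of a mini-batch is the sum of conditionally independent centred
    terms and of a term that is already determined; all cross terms vanish. *)
Lemma minibatch_second_moment n :
  int1 (fun w => enorm (\sum_(0 <= i < n) a i (pr w) *: y (pr w, tau i w) + z (pr w)) ^+ 2) /\
  \int[P]_w (enorm (\sum_(0 <= i < n) a i (pr w) *: y (pr w, tau i w) + z (pr w)) ^+ 2) <=
  \int[P]_w ((\sum_(0 <= i < n) a i (pr w) ^+ 2) * s (pr w)) +
  \int[P]_w (enorm (z (pr w)) ^+ 2).
Proof.
have mys := measurable_enorm_sq my.
have s0 x : 0 <= s x.
  rewrite -lee_fin (le_trans _ (ys x))//; apply: integral_ge0 => t _.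
  by rewrite lee_fin sqr_ge0.
pose F i c w := a i (pr w) * y (pr w, tau i w) 0 c.
have mpt i : measurable_fun setT (fun w => (pr w, tau i w)).
  by apply/measurable_fun_pairP; split; [exact: mpr|exact: mtau].
have map i : measurable_fun setT (fun w => a i (pr w)) by exact: measurableT_comp.
have mF i c : measurable_fun setT (F i c).
  apply: measurable_funM => //; exact: (measurableT_comp (my c) (mpt i)).
have mas i : measurable_fun setT (fun x => a i x ^+ 2 * s x).
  by apply: measurable_funM => //; exact: measurable_funX.
have asi i : int1 (fun w => a i (pr w) ^+ 2 * s (pr w)).
  apply: (integrable_dominated _ _ si).
    exact: (measurableT_comp (mas i) mpr).
  move=> w; have /andP[h0 h1] := a01 i (pr w).
  by rewrite ger0_norm ?mulr_ge0 ?sqr_ge0// ler_piMl// exprn_ile1.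
have Fi i := @cond_law_integrable (tau i)
  (fun xt => a i xt.1 ^+ 2 * enorm (y xt) ^+ 2) (fun x => a i x ^+ 2 * s x) (mtau i) (law1 i).
have {Fi} Fi i : int1 (fun w => a i (pr w) ^+ 2 * enorm (y (pr w, tau i w)) ^+ 2) /\
    \int[P]_w (a i (pr w) ^+ 2 * enorm (y (pr w, tau i w)) ^+ 2) <=
    \int[P]_w (a i (pr w) ^+ 2 * s (pr w)).
  apply: Fi => //.
  - apply: measurable_funM => //; apply: measurable_funX.
    by apply: (measurableT_comp (ma i)).
  - by move=> xt; rewrite mulr_ge0 ?sqr_ge0.
  - move=> x /=; under eq_integral do rewrite EFinM.
    rewrite ge0_integralZl//; first by rewrite [leRHS]EFinM lee_wpmul2l ?ys// lee_fin sqr_ge0.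
    + apply/measurable_EFinP.
      exact: (measurableT_comp mys (measurable_pair1 x)).
    + by move=> t _; rewrite lee_fin sqr_ge0.
    + by rewrite lee_fin sqr_ge0.
have sF i c : sq_integrable P (F i c).
  apply: (sq_integrable_dominated (mF i c) _ (Fi i).1) => w.
  by rewrite /F exprMn ler_wpM2l ?sqr_ge0// enorm_coord_sq.
have mzp c : measurable_fun setT (fun w => z (pr w) 0 c).
  exact: (measurableT_comp (mz c) mpr).
have sZ c : sq_integrable P (fun w => z (pr w) 0 c).
  by apply: (sq_integrable_dominated (mzp c) _ zi) => w; exact: enorm_coord_sq.
have yint x c : rintegrable (k x) (fun t => y (x, t) 0 c).
  apply: (@sq_integrable1 _ _ _ (k x) (fun t => y (x, t) 0 c)).
  apply: (sq_integrable_dominated (g := fun t => enorm (y (x, t)) ^+ 2)).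
  - exact: (measurableT_comp (my c) (measurable_pair1 x)).
  - by move=> t; exact: enorm_coord_sq.
  - apply/integrableP; split.
      apply/measurable_EFinP.
      exact: (measurableT_comp mys (measurable_pair1 x)).
    under eq_integral do rewrite gee0_abs ?lee_fin ?sqr_ge0//.
    by rewrite (le_lt_trans (ys x))// ltry.
have FF c i j : (i < j)%N -> \int[P]_w (F i c w * F j c w) = 0.
  move=> ij.
  pose pr2 w := (pr w, tau i w).
  pose k2 (xt : X * T) : probability T R := k xt.1.
  have mk2 : measurable_fun setT (k2 : X * T -> giry T R).
    exact: (measurableT_comp mk measurable_fst).
  have l2 : has_cond_law P pr2 (k2 : X * T -> giry T R) (tau j).
    move=> W V mW mV.
    exact: (cond_law_second mpr mk (mtau i) (mtau j) (law1 i) (law2 ij)).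
  pose f (q : X * T * T) : R := a i q.1.1 * y q.1 0 c * (a j q.1.1 * y (q.1.1, q.2) 0 c).
  rewrite /Rintegral.
  have m11 : measurable_fun setT (fun q : X * T * T => q.1.1).
    exact: (measurableT_comp measurable_fst measurable_fst).
  have -> : (\int[P]_w (F i c w * F j c w)%:E = \int[P]_w (f (pr2 w, tau j w))%:E)%E by [].
  rewrite (cond_law_centered (mpt i) mk2 (mtau j) l2)//.
  - apply: measurable_funM; apply: measurable_funM.
    + exact: (measurableT_comp (ma i) m11).
    + exact: (measurableT_comp (my c) measurable_fst).
    + exact: (measurableT_comp (ma j) m11).
    + apply: (measurableT_comp (my c)); apply/measurable_fun_pairP; split => //.
      exact: measurable_snd.
  - move=> [x t1] /=; rewrite /k2 /f /=.
    under eq_integral do rewrite mulrA EFinM.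
    by rewrite (integralZl measurableT (yint x c)) /= y0 mule0.
  - exact: (integrable_mul (sF i c) (sF j c)).
have ZF c i : \int[P]_w (z (pr w) 0 c * F i c w) = 0.
  pose f (q : X * T) : R := z q.1 0 c * (a i q.1 * y q 0 c).
  rewrite /Rintegral.
  have -> : (\int[P]_w (z (pr w) 0 c * F i c w)%:E = \int[P]_w (f (pr w, tau i w))%:E)%E by [].
  rewrite (cond_law_centered mpr mk (mtau i) (law1 i))//.
  - apply: measurable_funM; last apply: measurable_funM => //.
    + exact: (measurableT_comp (mz c) measurable_fst).
    + exact: (measurableT_comp (ma i) measurable_fst).
  - move=> x; rewrite /f /=.
    under eq_integral do rewrite mulrA EFinM.
    by rewrite (integralZl measurableT (yint x c)) /= y0 mule0.
  - exact: (integrable_mul (sZ c) (sF i c)).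
have coord c w : (\sum_(0 <= i < n) a i (pr w) *: y (pr w, tau i w) + z (pr w)) 0 c =
    \sum_(0 <= i < n) F i c w + z (pr w) 0 c.
  by rewrite mxE summxE; congr (_ + _); apply: eq_bigr => i _; rewrite mxE.
have sS c : sq_integrable P (fun w => \sum_(0 <= i < n) F i c w + z (pr w) 0 c).
  apply: sq_integrable_add => //.
  by apply: (sq_integrable_sum (F := fun i w => F i c w)) => i _.
have Ee : (fun w => enorm (\sum_(0 <= i < n) a i (pr w) *: y (pr w, tau i w) + z (pr w)) ^+ 2) =
   (fun w => \sum_(c < d) (\sum_(0 <= i < n) F i c w + z (pr w) 0 c) ^+ 2).
  by apply/funext => w; rewrite enorm_sqE; apply: eq_bigr => c _; rewrite coord.
rewrite Ee; split.
  by apply: integrable_bigsum => c; exact: (sS c).2.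
rewrite Rintegral_bigsum; last by move=> c; exact: (sS c).2.
have O c := orthogonal_sum_sq (n := n) (F := fun i => F i c) (fun i _ => sF i c)
  (sZ c) (fun i j ij _ => FF c i j ij) (fun i _ => ZF c i).
under eq_bigr do rewrite O.
rewrite big_split/= lerD//; last first.
  rewrite -Rintegral_bigsum; last by move=> c; exact: (sZ c).2.
  rewrite le_eqVlt; apply/orP; left; apply/eqP; apply: eq_Rintegral => w _.
  by rewrite enorm_sqE.
rewrite exchange_big/=.
apply: (@le_trans _ _ (\sum_(0 <= i < n) \int[P]_w (a i (pr w) ^+ 2 * s (pr w)))); last first.
  rewrite -Rintegral_bigsum//.
  rewrite le_eqVlt; apply/orP; left; apply/eqP; apply: eq_Rintegral => w _.
  by rewrite mulr_suml.
apply: ler_sum => i _; apply: le_trans (Fi i).2.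
rewrite -Rintegral_bigsum; last by move=> c; exact: (sF i c).2.
rewrite le_eqVlt; apply/orP; left; apply/eqP; apply: eq_Rintegral => w _.
by rewrite enorm_sqE mulr_sumr; apply: eq_bigr => c _; rewrite /F exprMn.
Qed.

End conditional_minibatch.

(** * Gradient estimators along one trajectory *)

Section estimators.
Context (R : realType) (dS dA : measure_display)
        (S : measurableType dS) (A : measurableType dA).
Variables (M : mdp R S A) (d : nat) (pi : policy R S A d).
Variables (g : traj M -> 'rV[R]_d -> 'rV[R]_d).
Variables (G C_H Rmax sigma L Lg Gamma alphaw : R).
Hypothesis A1 : unbiased_gradient pi g.
Hypothesis A2 : regular_policy M pi G C_H Rmax.
Hypothesis A3 : bounded_variance pi g sigma.
Hypothesis Hconst : smoothness_constants pi g L Lg Gamma alphaw.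
Local Notation Theta := 'rV[R]_d.
Local Notation mu := (traj_dist M pi).
Local Notation gradJ := (grad (J M pi)).
Local Opaque traj_dist likelihood.

Lemma Gamma_ge0 : 0 <= Gamma.
Proof.
by have [_ _ h _] := Hconst; apply: le_trans (h point 0); exact: sqr_ge0.
Qed.

Lemma measurable_g u c : measurable_fun setT (fun tau => g tau u 0 c).
Proof. by have [h _ _] := A1; exact: h. Qed.

Lemma g_bounded tau u c : `|g tau u 0 c| <= 1 + Gamma.
Proof.
have [_ _ h _] := Hconst; have := le_trans (enorm_coord_sq (g tau u) c) (h tau u).
rewrite -real_normK ?num_real//; move: (`|_|) => x.
by have := sqr_ge0 (x - 1); nra.
Qed.

Lemma measurable_g_param dX (X : measurableType dX) (theta : X -> Theta) c :
  (forall i, measurable_fun setT (fun x => theta x 0 i)) ->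
  measurable_fun setT (fun z : X * traj M => g z.2 (theta z.1) 0 c).
Proof.
move=> mtheta; have [_ h _ _] := Hconst.
apply: (measurable_fun_lipschitz_param (f := fun tau u => g tau u 0 c) (C := `|Lg|) mtheta).
  by move=> u; exact: measurable_g.
move=> tau u w; have := enorm_coord (g tau u - g tau w) c; rewrite !mxE => hc.
apply: (le_trans hc); apply: (le_trans (h _ _ _)).
apply: (@le_trans _ _ (`|Lg| * enorm (u - w))).
  by rewrite ler_wpM2r ?enorm_ge0// ler_norm.
rewrite ler_wpM2l// (le_trans (enorm_le_l1 _))//.
by rewrite le_eqVlt; apply/orP; left; apply/eqP; apply: eq_bigr => i _; rewrite !mxE.
Qed.

Lemma measurable_gradJ_param dX (X : measurableType dX) (theta : X -> Theta) c :
  (forall i, measurable_fun setT (fun x => theta x 0 i)) ->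
  measurable_fun setT (fun x : X => gradJ (theta x) 0 c).
Proof.
move=> mtheta; have [h _ _ _] := Hconst.
have m := @measurable_fun_lipschitz_param R d dX _ X X theta
  (fun _ u => gradJ u 0 c) `|L| mtheta (fun=> measurable_cst _).
have mxx : measurable_fun setT (fun x : X => (x, x)).
  by apply/measurable_fun_pairP; split; exact: measurable_id.
apply: (measurableT_comp (m _) mxx) => _ u w.
have := enorm_coord (gradJ u - gradJ w) c; rewrite rowB => hc.
apply: (le_trans hc); apply: (le_trans (h _ _)).
apply: (@le_trans _ _ (`|L| * enorm (u - w))).
  by rewrite ler_wpM2r ?enorm_ge0// ler_norm.
rewrite ler_wpM2l// (le_trans (enorm_le_l1 _))//.
by rewrite le_eqVlt; apply/orP; left; apply/eqP; apply: eq_bigr => i _; rewrite !mxE.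
Qed.

Lemma g_mean u c : (\int[mu u]_tau (g tau u 0 c)%:E = (gradJ u 0 c)%:E)%E.
Proof. by have [_ _ h] := A1; rewrite -h unlock. Qed.

Lemma g_rintegrable u w c : rintegrable (mu u) (fun tau => g tau w 0 c).
Proof. exact: (integrable_bounded _ (measurable_g w c) (fun tau => g_bounded tau w c)). Qed.

Lemma enorm_g_rintegrable u w : rintegrable (mu u) (fun tau => enorm (g tau w) ^+ 2).
Proof.
apply: (integrable_bounded _ (C := Gamma)).
  by apply: measurable_enorm_sq => c; exact: measurable_g.
by move=> tau; have [_ _ h _] := Hconst; rewrite ger0_norm ?sqr_ge0.
Qed.

Lemma second_moment_centered_le (nu : probability (traj M) R) (h : traj M -> Theta) (m : Theta) :
  (forall c, measurable_fun setT (fun tau => h tau 0 c)) ->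
  rintegrable nu (fun tau => enorm (h tau) ^+ 2) ->
  (forall c, \int[nu]_tau h tau 0 c = m 0 c) ->
  [/\ rintegrable nu (fun tau => enorm (h tau - m) ^+ 2),
    \int[nu]_tau (enorm (h tau - m) ^+ 2) <= \int[nu]_tau (enorm (h tau) ^+ 2) &
    enorm m ^+ 2 <= \int[nu]_tau (enorm (h tau) ^+ 2)].
Proof.
move=> mh ih Eh.
have sh c : sq_integrable nu (fun tau => h tau 0 c).
  by apply: (sq_integrable_dominated (mh c) _ ih) => tau; exact: enorm_coord_sq.
have shm c : sq_integrable nu (fun tau => h tau 0 c - m 0 c).
  exact: sq_integrable_add (sh c) (sq_integrable_constant nu (- m 0 c)).
have E1 : (fun tau => enorm (h tau - m) ^+ 2) = fun tau => \sum_(c < d) (h tau 0 c - m 0 c) ^+ 2.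
  by apply/funext => tau; rewrite enorm_sqE; apply: eq_bigr => c _; rewrite !mxE.
have E2 : (fun tau => enorm (h tau) ^+ 2) = fun tau => \sum_(c < d) (h tau 0 c) ^+ 2.
  by apply/funext => tau; rewrite enorm_sqE.
have i1 c := (shm c).2; have i2 c := (sh c).2.
have B : \int[nu]_tau (enorm (h tau - m) ^+ 2) + enorm m ^+ 2 =
    \int[nu]_tau (enorm (h tau) ^+ 2).
  rewrite E1 E2 (Rintegral_bigsum _ i1) (Rintegral_bigsum _ i2) enorm_sqE -big_split/=.
  by apply: eq_bigr => c _; rewrite second_moment_centered.
split.
- by rewrite E1; exact: integrable_bigsum.
- by rewrite -B lerDl sqr_ge0.
- by rewrite -B lerDr Rintegral_ge0// => tau _; exact: sqr_ge0.
Qed.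

Lemma gradJ_bounded u : enorm (gradJ u) ^+ 2 <= Gamma.
Proof.
have [_ _ h _] := Hconst.
have Eg c : \int[mu u]_tau g tau u 0 c = gradJ u 0 c.
  by rewrite /Rintegral g_mean.
have [_ _] := second_moment_centered_le (measurable_g u) (enorm_g_rintegrable u u) Eg.
move=> /le_trans; apply; rewrite -[leRHS](Rintegral_constant (mu u)).
apply: Rintegral_mono => //; first exact: enorm_g_rintegrable.
exact: integrable_constant.
Qed.

Definition outer_noise u tau := g tau u - gradJ u.

Lemma outer_noise_mean u c : (\int[mu u]_tau (outer_noise u tau 0 c)%:E = 0)%E.
Proof.
rewrite /outer_noise.
under eq_integral do rewrite rowB EFinB.
rewrite (integralB measurableT (g_rintegrable u u c) (integrable_constant (mu u) (gradJ u 0 c))) g_mean.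
by rewrite -EFin_Rintegral ?Rintegral_constant ?subee//; exact: integrable_constant.
Qed.

Lemma outer_noise_sq u : (\int[mu u]_tau (enorm (outer_noise u tau) ^+ 2)%:E <= (sigma ^+ 2)%:E)%E.
Proof. by have [_ h] := A3; have := h u; rewrite unlock. Qed.

Lemma iweight_sq_integrable u w : sq_integrable (mu u) (fun tau => iweight pi tau u w).
Proof.
have [_ _ _ h] := Hconst.
have m1 : measurable_fun setT (fun tau : traj M => iweight pi tau u w).
  exact: (measurable_iweight_cst A2).
have s1 : sq_integrable (mu u) (fun tau => iweight pi tau u w - 1).
  have m2 : measurable_fun setT (fun tau : traj M => iweight pi tau u w - 1).
    by apply: measurable_funB => //; exact: measurable_cst.
  split => //; apply/integrableP; split.
    by apply/measurable_EFinP; exact: measurable_funX.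
  apply: (le_lt_trans _ (ltry (alphaw * enorm (u - w) ^+ 2))).
  apply: le_trans (h u w); rewrite unlock le_eqVlt; apply/orP; left; apply/eqP.
  apply: eq_integral => tau _; rewrite gee0_abs ?lee_fin ?sqr_ge0//.
  by rewrite real_normK ?num_real// -sqrrN opprB.
have := sq_integrable_add s1 (sq_integrable_constant (mu u) 1).
by under eq_fun do rewrite subrK.
Qed.

Definition corrected_g u w tau := g tau u - iweight pi tau u w *: g tau w.

Lemma measurable_corrected_g u w c :
  measurable_fun setT (fun tau => corrected_g u w tau 0 c).
Proof.
rewrite /corrected_g; under eq_fun do rewrite !mxE.
apply: measurable_funB; first exact: measurable_g.
by apply: measurable_funM; [exact: (measurable_iweight_cst A2)|exact: measurable_g].
Qed.

Lemma corrected_g_mean u w c :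
  \int[mu u]_tau (corrected_g u w tau 0 c) = (gradJ u - gradJ w) 0 c.
Proof.
have iw : rintegrable (mu u) (fun tau => g tau w 0 c * iweight pi tau u w).
  apply: (integrable_dominated (g := fun tau => (1 + Gamma) * iweight pi tau u w)).
  - by apply: measurable_funM; [exact: measurable_g|exact: (measurable_iweight_cst A2)].
  - move=> tau; rewrite normrM (ger0_norm (iweight_ge0 _ _ _ _)).
    by rewrite ler_wpM2r ?iweight_ge0 ?g_bounded.
  - by apply: integrable_scale; apply: sq_integrable1; exact: iweight_sq_integrable.
transitivity (\int[mu u]_tau (g tau u 0 c + (-1) * (g tau w 0 c * iweight pi tau u w))).
  by apply: eq_Rintegral => tau _; rewrite !mxE mulN1r [_ * g tau w _ _]mulrC.
rewrite (Rintegral_add (g_rintegrable u u c) (integrable_scale (-1) iw)).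
rewrite (Rintegral_scale _ iw) /Rintegral g_mean -(traj_dist_reweight_signed A2 _ _ (measurable_g w c)).
by rewrite g_mean mulN1r rowB.
Qed.

Lemma enorm_corrected_g_le u w tau : enorm (corrected_g u w tau) ^+ 2 <=
  2 * Lg ^+ 2 * enorm (u - w) ^+ 2 + 2 * Gamma * `|1 - iweight pi tau u w| ^+ 2.
Proof.
have [_ h1 h2 _] := Hconst.
have -> : corrected_g u w tau = (g tau u - g tau w) + (1 - iweight pi tau u w) *: g tau w.
  by rewrite scalerBl scale1r addrA subrK.
apply: (le_trans (enorm_sqD_le _ _)); rewrite enormZ_sq real_normK ?num_real//.
have : enorm (g tau u - g tau w) ^+ 2 <= Lg ^+ 2 * enorm (u - w) ^+ 2.
  rewrite -exprMn ler_pXn2r ?nnegrE ?enorm_ge0//.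
  by apply: le_trans (h1 tau u w); exact: enorm_ge0.
have := ler_wpM2l (sqr_ge0 (1 - iweight pi tau u w)) (h2 tau w).
by move: (enorm _ ^+ 2) (enorm _ ^+ 2) => x y'; lra.
Qed.

(** The importance weight turns the difference of two gradient estimates taken
    along one trajectory into a quantity of the order of the distance between
    the two parameters. *)
Lemma corrected_g_sq u w : rintegrable (mu u) (fun tau => enorm (corrected_g u w tau) ^+ 2) /\
  \int[mu u]_tau (enorm (corrected_g u w tau) ^+ 2) <=
  2 * (Lg ^+ 2 + Gamma * alphaw) * enorm (u - w) ^+ 2.
Proof.
have [_ _ _ h] := Hconst.
have m1 := measurable_enorm_sq (measurable_corrected_g u w).
have i1 : rintegrable (mu u) (fun tau => `|1 - iweight pi tau u w| ^+ 2).
  have s1 := sq_integrable_add (sq_integrable_constant (mu u) (-1)) (iweight_sq_integrable u w).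
  apply: (integrable_dominated _ _ s1.2).
    apply: measurable_funX; apply: measurableT_comp => //.
    by apply: measurable_funB; [exact: measurable_cst|exact: (measurable_iweight_cst A2)].
  by move=> tau; rewrite normrX normr_id real_normK ?num_real// -sqrrN opprB addrC.
have i2 := integrable_add (integrable_constant (mu u) (2 * Lg ^+ 2 * enorm (u - w) ^+ 2))
  (integrable_scale (2 * Gamma) i1).
have i0 : rintegrable (mu u) (fun tau => enorm (corrected_g u w tau) ^+ 2).
  apply: (integrable_dominated m1 _ i2) => tau.
  by rewrite ger0_norm ?sqr_ge0//; exact: enorm_corrected_g_le.
split => //; apply: (le_trans (Rintegral_mono i0 i2 (enorm_corrected_g_le u w))).
rewrite (Rintegral_add (integrable_constant (mu u) _) (integrable_scale (2 * Gamma) i1)).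
rewrite Rintegral_constant (Rintegral_scale _ i1).
have : \int[mu u]_tau (`|1 - iweight pi tau u w| ^+ 2) <= alphaw * enorm (u - w) ^+ 2.
  by rewrite -lee_fin EFin_Rintegral//; have := h u w; rewrite unlock.
have := Gamma_ge0; move: (\int[mu u]_tau _) (enorm _ ^+ 2) => x y'.
by move=> G0 /(ler_wpM2l G0); lra.
Qed.

Definition inner_noise u w tau := corrected_g u w tau - (gradJ u - gradJ w).

Lemma inner_noise_mean u w c : (\int[mu u]_tau (inner_noise u w tau 0 c)%:E = 0)%E.
Proof.
have [i1 _] := corrected_g_sq u w.
have i2 : rintegrable (mu u) (fun tau => corrected_g u w tau 0 c).
  apply: sq_integrable1; apply: (sq_integrable_dominated (measurable_corrected_g u w c) _ i1).
  by move=> tau; exact: enorm_coord_sq.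
have ic := integrable_constant (mu u) (- (gradJ u - gradJ w) 0 c).
have ia := integrable_add i2 ic.
rewrite (_ : (fun tau => _) = (fun tau => (corrected_g u w tau 0 c - (gradJ u - gradJ w) 0 c)%:E)).
  rewrite -(EFin_Rintegral ia) (Rintegral_add i2 ic) corrected_g_mean Rintegral_constant.
  by rewrite subrr.
by apply/funext => tau; rewrite /inner_noise rowB.
Qed.

Lemma inner_noise_sq u w : (\int[mu u]_tau (enorm (inner_noise u w tau) ^+ 2)%:E <=
  (2 * (Lg ^+ 2 + Gamma * alphaw) * enorm (u - w) ^+ 2)%:E)%E.
Proof.
have [i1 h] := corrected_g_sq u w.
have [i2 h2 _] := second_moment_centered_le (measurable_corrected_g u w) i1 (corrected_g_mean u w).
by rewrite -(EFin_Rintegral i2) lee_fin (le_trans h2).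
Qed.

End estimators.

(** * Rounded sizes and mini-batch weights *)

Section rounding.
Context (R : realType).
Implicit Types x y : R.

Lemma roundup_gt0 x : (0 < roundup x)%N.
Proof. by rewrite leq_max. Qed.

Lemma roundup_ge x : x <= (roundup x)%:R.
Proof.
apply: (le_trans (ceil_ge x)); apply: (@le_trans _ _ (`|Num.ceil x|%N)%:R).
  by rewrite natr_absz ler_int ler_norm.
by rewrite ler_nat leq_maxr.
Qed.

Lemma roundup_le x : 0 <= x -> (roundup x)%:R <= x + 1.
Proof.
move=> x0; rewrite /roundup; case: (leqP 1 `|Num.ceil x|%N) => h; last first.
  by rewrite lerDr.
have c0 : (0 <= Num.ceil x)%R by rewrite ceil_ge0 (lt_le_trans _ x0)// ltrN10.
rewrite natr_absz ger0_norm//; have := ceilB1_lt x.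
by rewrite intrD mulrN1z ltrBlDr => /ltW.
Qed.

Lemma roundup_mono x y : 0 <= x -> x <= y -> (roundup x <= roundup y)%N.
Proof.
move=> x0 xy; rewrite /roundup geq_max leq_maxl/= leq_max; apply/orP; right.
have c0 (z : R) : 0 <= z -> (0 <= Num.ceil z)%R.
  by move=> z0; rewrite ceil_ge0 (lt_le_trans _ z0)// ltrN10.
rewrite -lez_nat !gez0_abs ?c0//; last exact: le_trans xy.
exact: le_ceil.
Qed.

Lemma measurable_roundup : measurable_fun setT (@roundup R).
Proof.
move=> _ Y _; rewrite setTI.
have -> : @roundup R @^-1` Y =
    \bigcup_(z : int) (if maxn 1 `|z|%N \in Y then `](z - 1)%:~R, z%:~R]%classic else set0).
  apply/seteqP; split => [x Yx|x [z _]].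
    by exists (Num.ceil x) => //=; rewrite mem_set//= in_itv/= ceil_itv.
  case: ifPn => // /set_mem Yz /=; rewrite in_itv/= => /ceil_def E.
  by rewrite /roundup E.
apply: countable_bigcupT_measurable => // z; case: ifP => // _.
Qed.

Lemma measurable_fun_inv d (T : measurableType d) (f : T -> R) :
  (forall t, 0 < f t) -> measurable_fun setT f -> measurable_fun setT (fun t => (f t)^-1).
Proof.
move=> f0 mf; apply: (eq_measurable_fun (fun t => expR (- ln (f t)))).
  by move=> t _; rewrite expRN lnK// posrE.
apply: (measurableT_comp (@measurable_expR R)).
apply: measurable_funN.
exact: (measurableT_comp (@measurable_ln R)).
Qed.

(** The weight of sample [i] in a mini-batch of size [n], written so that a
    batch of random but bounded size is a sum of fixed length. *)
Definition batch_weight (n i : nat) : R := (i < n)%:R / n%:R.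

Lemma batch_weight_bounds n i : 0 <= batch_weight n i <= 1.
Proof.
rewrite /batch_weight; case: (ltnP i n) => h; last by rewrite mul0r lexx ler01.
have n0 : 0 < n%:R :> R by rewrite ltr0n (leq_ltn_trans _ h).
by rewrite mul1r invr_ge0 (ltW n0)/= invf_le1// ler1n (leq_ltn_trans _ h).
Qed.

Lemma sum_batch_weight (V : lmodType R) n nmax (x : nat -> V) : (n <= nmax)%N ->
  \sum_(0 <= i < nmax) batch_weight n i *: x i = n%:R^-1 *: \sum_(i < n) x i.
Proof.
move=> nn; rewrite (@big_cat_nat _ _ _ n)//= [X in _ + X]big_nat [X in _ + X]big1 ?addr0; last first.
  by move=> i /andP[ni _]; rewrite /batch_weight ltnNge ni mul0r scale0r.
rewrite big_mkord scaler_sumr; apply: eq_bigr => i _.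
by rewrite /batch_weight ltn_ord mul1r.
Qed.

Lemma sum_batch_weight1 n nmax : (0 < n <= nmax)%N ->
  \sum_(0 <= i < nmax) batch_weight n i = 1.
Proof.
move=> /andP[n0 nn]; have := sum_batch_weight (V := R^o) (fun=> 1) nn.
under eq_bigr do rewrite /GRing.scale/= mulr1.
move=> ->; rewrite sumr_const card_ord /GRing.scale/= mulVf// pnatr_eq0.
by rewrite -lt0n.
Qed.

Lemma sum_batch_weight_sq n nmax : (0 < n <= nmax)%N ->
  \sum_(0 <= i < nmax) batch_weight n i ^+ 2 = n%:R^-1.
Proof.
move=> nn; have := congr1 (fun z => n%:R^-1 * z) (sum_batch_weight1 nn).
rewrite mulr1 mulr_sumr => E; rewrite -[RHS]E; apply: eq_bigr => i _.
by rewrite /batch_weight; case: (i < n)%N => /=; rewrite ?mul1r ?mul0r ?mulr0 ?expr2 ?mul0r.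
Qed.

Lemma minibatch_weight d n nmax (x : nat -> 'rV[R]_d) : (n <= nmax)%N ->
  minibatch n x = \sum_(0 <= i < nmax) batch_weight n i *: x i.
Proof. by move=> nn; rewrite sum_batch_weight. Qed.

End rounding.

(** * Sums over epochs *)

Section epoch_sums.
Context (R : realType).
Variables (x : nat -> R).
Hypothesis x_ge0 : forall i, 0 <= x i.

(** After exchanging the sums, each [x i] is counted only for [k] in a window of
    length [C]. *)
Lemma window_sum_le n (a b lo : nat -> nat) C :
  (forall k, (k < n)%N -> (b k <= n)%N) ->
  (forall k i, (a k <= i < b k)%N -> (lo i <= k < lo i + C)%N) ->
  \sum_(0 <= k < n) \sum_(a k <= i < b k) x i <= C%:R * \sum_(0 <= i < n) x i.
Proof.
move=> bn abw.
apply: (@le_trans _ _ (\sum_(0 <= k < n) \sum_(0 <= i < n) (lo i <= k < lo i + C)%N%:R * x i)).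
  rewrite big_nat [leRHS]big_nat; apply: ler_sum => k /andP[_ kn].
  rewrite (big_nat_widenl _ 0%N)// (big_nat_widen _ _ n)/=; last exact: bn.
  rewrite big_mkcond/=; apply: ler_sum => i _; case: ifPn => [/andP[h1 h2]|_].
    by rewrite abw ?mul1r// h1.
  by rewrite mulr_ge0 ?ler0n.
rewrite exchange_big/= mulr_sumr; apply: ler_sum => i _.
rewrite -mulr_suml ler_wpM2r// -natr_sum ler_nat.
rewrite -big_mkcond/= sum1_count.
have -> : count (fun k => (lo i <= k < lo i + C)%N) (index_iota 0 n) =
    size [seq k <- index_iota 0 n | (lo i <= k < lo i + C)%N] by rewrite size_filter.
rewrite -[leqRHS](size_iota (lo i)); apply: uniq_leq_size.
  by rewrite filter_uniq// iota_uniq.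
by move=> k; rewrite mem_filter mem_iota => /andP[].
Qed.

Variables (m : nat).
Hypothesis m_gt0 : (0 < m)%N.
Local Notation epoch k := (k %/ m * m)%N.

Lemma current_epoch_sum_le n :
  \sum_(0 <= k < n) (k - epoch k)%:R * \sum_(epoch k <= i < k) x i <=
  (m.-1)%:R ^+ 2 * \sum_(0 <= i < n) x i.
Proof.
apply: (@le_trans _ _ ((m.-1)%:R * \sum_(0 <= k < n) \sum_(epoch k <= i < k) x i)).
  rewrite mulr_sumr; apply: ler_sum => k _; apply: ler_wpM2r.
    by rewrite sumr_ge0.
  by rewrite ler_nat; have := ltn_pmod k m_gt0; have := divn_eq k m; lia.
rewrite expr2 -mulrA ler_wpM2l//.
apply: (@window_sum_le n (fun k => epoch k) id S m.-1) => [k /ltnW//|k i].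
by have := ltn_pmod k m_gt0; have := divn_eq k m; lia.
Qed.

Lemma previous_epoch_sum_le n :
  \sum_(0 <= k < n) \sum_(epoch k - m <= i < epoch k) x i <=
  m%:R * \sum_(0 <= i < n) x i.
Proof.
apply: (@window_sum_le n (fun k => epoch k - m)%N (fun k => epoch k) (fun i => (i %/ m).+1 * m)%N m).
  by move=> k kn; apply: leq_trans (ltnW kn); exact: leq_divM.
move=> k i; have := ltn_pmod k m_gt0; have := divn_eq k m.
have := ltn_pmod i m_gt0; have := divn_eq i m.
move: (k %/ m)%N (k %% m)%N (i %/ m)%N (i %% m)%N => q r q' r' -> r'm -> rm h.
have : (q' < q)%N by rewrite -(ltn_pmul2r m_gt0); lia.
have : (q <= q'.+1)%N.
  by rewrite -ltnS -(ltn_pmul2r m_gt0); lia.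
move=> h1 h2; have -> : q = q'.+1 by lia.
by rewrite leq_addr /= ltn_add2l.
Qed.

End epoch_sums.

(** * Sample sizes and rates *)

Section costs.
Context (R : realType) (d : nat).
Implicit Types v : nat -> 'rV[R]_d.
Variables (alpha b sigma eps : R) (m : nat).
Hypotheses (alpha_gt0 : 0 < alpha) (b_ge0 : 0 <= b) (eps_gt0 : 0 < eps).

Lemma aba_denom_ge v k :
  eps <= b / m%:R * (\sum_(k - m <= i < k) enorm (v i) ^+ 2) + eps.
Proof.
rewrite lerDr mulr_ge0 ?divr_ge0 ?ler0n ?sumr_ge0// => i _; exact: sqr_ge0.
Qed.

Lemma aba_denom_gt0 v k :
  0 < b / m%:R * (\sum_(k - m <= i < k) enorm (v i) ^+ 2) + eps.
Proof. exact: lt_le_trans eps_gt0 (aba_denom_ge v k). Qed.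

Lemma aba_rule_ge0 v k : 0 <= aba_rule alpha b sigma eps m v k.
Proof.
apply: divr_ge0; first by rewrite mulr_ge0 ?sqr_ge0 ?(ltW alpha_gt0).
exact: ltW (aba_denom_gt0 v k).
Qed.

Lemma aba_rule_le v k :
  aba_rule alpha b sigma eps m v k <= vanilla_rule alpha sigma eps v k.
Proof.
rewrite /vanilla_rule; apply: ler_wpM2l; first by rewrite mulr_ge0 ?sqr_ge0 ?(ltW alpha_gt0).
by rewrite lef_pV2 ?posrE ?aba_denom_gt0// aba_denom_ge.
Qed.

Lemma aba_rule_lt v k i : 0 < b -> (0 < m)%N -> 0 < sigma ->
  (k - m <= i < k)%N -> v i != 0 ->
  aba_rule alpha b sigma eps m v k < vanilla_rule alpha sigma eps v k.
Proof.
move=> b0 m0 s0 ik vi.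
rewrite /vanilla_rule ltr_pM2l ?mulr_gt0 ?exprn_gt0// ltf_pV2 ?posrE ?aba_denom_gt0//.
rewrite ltrDr mulr_gt0 ?divr_gt0 ?ltr0n//.
rewrite (bigD1_seq i) ?iota_uniq ?mem_index_iota//=.
apply: ltr_wpDr; first by apply: sumr_ge0 => j _; exact: sqr_ge0.
by rewrite exprn_gt0// lt_neqAle eq_sym enorm_eq0 vi enorm_ge0.
Qed.

Lemma aba_rule_eq v k : (forall i, (k - m <= i < k)%N -> v i = 0) ->
  aba_rule alpha b sigma eps m v k = vanilla_rule alpha sigma eps v k.
Proof.
move=> v0; rewrite /aba_rule /vanilla_rule big_nat big1 ?mulr0 ?add0r// => i ik.
by rewrite v0// enorm0 expr0n.
Qed.

Lemma measurable_aba_rule d' (Z : measurableType d') (v : nat -> Z -> 'rV[R]_d) k :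
  (forall j, (j < k)%N -> forall c, measurable_fun setT (fun z => v j z 0 c)) ->
  measurable_fun setT (fun z => aba_rule alpha b sigma eps m (v^~ z) k).
Proof.
move=> mv; rewrite /aba_rule; apply: measurable_funM; first exact: measurable_cst.
apply: measurable_fun_inv; first by move=> z; exact: aba_denom_gt0.
apply: measurable_funD; last exact: measurable_cst.
apply: measurable_funM; first exact: measurable_cst.
have -> : (fun z => \sum_(k - m <= j < k) enorm (v j z) ^+ 2) =
    (fun z => \sum_(j <- index_iota (k - m) k) (if (j < k)%N then enorm (v j z) ^+ 2 else 0)).
  by apply/funext => z; apply: eq_big_nat => j /andP[_ ->].
apply: measurable_sum => j; case: (ltnP j k) => jk; last exact: measurable_cst.
exact: (measurable_enorm_sq (mv j jk)).
Qed.

Variables (B K : nat).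
Local Notation aba := (@aba_rule R d alpha b sigma eps m).
Local Notation vanilla := (@vanilla_rule R d alpha sigma eps).

Lemma sto_cost_le v : sto_cost aba m B K v <= sto_cost vanilla m B K v.
Proof. by rewrite /sto_cost lerD2l; apply: ler_sum => k _; exact: aba_rule_le. Qed.

(** Every checkpoint after the first uses the step lengths of the epoch that it
    closes, and these epochs cover the iterations before [K %/ m * m]. *)
Lemma sto_cost_lt v i : 0 < b -> (0 < m)%N -> 0 < sigma ->
  (i < K %/ m * m)%N -> v i != 0 ->
  sto_cost aba m B K v < sto_cost vanilla m B K v.
Proof.
move=> b0 m0 s0 iK vi; rewrite /sto_cost ltrD2l.
have kK : (i %/ m < K %/ m)%N by rewrite ltn_divLR.
have mem : (i %/ m).+1 \in index_iota 0 (K %/ m).+1 by rewrite mem_index_iota.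
rewrite (bigD1_seq _ mem) ?iota_uniq//= [ltRHS](bigD1_seq _ mem) ?iota_uniq//=.
apply: ltr_leD; last by apply: ler_sum => k _; exact: aba_rule_le.
apply: (@aba_rule_lt v _ i) => //.
by have := divn_eq i m; have := ltn_pmod i m0; rewrite mulSn; lia.
Qed.

Lemma sto_cost_lt_iff v : 0 < b -> (0 < m)%N -> 0 <= sigma ->
  sto_cost aba m B K v < sto_cost vanilla m B K v <->
  0 < sigma /\ exists2 i : nat, (i < K %/ m * m)%N & v i != 0.
Proof.
move=> b0 m0 sg0; split => [lt|[s0 [i iK vi]]]; last exact: sto_cost_lt vi.
split.
  rewrite lt_neqAle sg0 andbT eq_sym; apply/negP => /eqP s0.
  move: lt; rewrite /sto_cost (eq_bigr (vanilla v \o (fun k => k * m)%N)) ?ltxx// => k _.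
  by rewrite /aba_rule /vanilla_rule /= s0 expr0n/= mulr0 !mul0r.
apply: contrapT => nex; move: lt; rewrite /sto_cost.
rewrite (eq_big_nat _ _ (F2 := vanilla v \o (fun k => k * m)%N)) ?ltxx// => k /andP[_ kK].
apply: aba_rule_eq => i /andP[_ ik]; apply/eqP; apply: contrapT => /negP vi.
by apply: nex; exists i => //; apply: (leq_trans ik); rewrite leq_mul2r -ltnS kK orbT.
Qed.

End costs.

Section rates.
Context (R : realType).
Implicit Types a x y : R.

Lemma cbrtK a : 0 <= a -> (a `^ (1 / 3)) ^+ 3 = a.
Proof.
move=> a0; rewrite -powR_mulrn ?powR_ge0// -powRrM mul1r mulVf ?pnatr_eq0//.
by rewrite powRr1.
Qed.

Lemma cube_inj x y : 0 <= x -> 0 <= y -> x ^+ 3 = y ^+ 3 -> x = y.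
Proof. by move=> x0 y0 /eqP; rewrite eqrXn2// => /eqP. Qed.

Variables (L Q sigma eps : R).
Hypotheses (L_gt0 : 0 < L) (Q_gt0 : 0 < Q) (eps_gt0 : 0 < eps).
Let y := (L ^+ 2 * sigma ^+ 2 / (Q * eps)) `^ (1 / 3).
Let z := (Q * sigma ^+ 4 / (L ^+ 2 * eps ^+ 2)) `^ (1 / 3).

Let ya : 0 <= L ^+ 2 * sigma ^+ 2 / (Q * eps).
Proof. by rewrite divr_ge0// mulr_ge0 ?sqr_ge0// ltW. Qed.

Let za : 0 <= Q * sigma ^+ 4 / (L ^+ 2 * eps ^+ 2).
Proof. by rewrite divr_ge0// mulr_ge0 ?sqr_ge0 ?(ltW Q_gt0) ?exprn_even_ge0. Qed.

(** This balance of epoch length against batch size is what the exponents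
    [1 / 3] are chosen for: both sides have the same cube. *)
Lemma epoch_batch_balance : z * L ^+ 2 = y ^+ 2 * Q.
Proof.
have L2 : L ^+ 2 != 0 by rewrite sqrf_eq0 gt_eqF.
have -> : z = y ^+ 2 * Q / L ^+ 2; last by rewrite divfK.
apply: cube_inj; first exact: powR_ge0.
  apply: divr_ge0; last exact: sqr_ge0.
  by apply: mulr_ge0; [exact: sqr_ge0|exact: ltW].
have -> : (y ^+ 2 * Q / L ^+ 2) ^+ 3 = (y ^+ 3) ^+ 2 * Q ^+ 3 / (L ^+ 2) ^+ 3.
  by field; rewrite gt_eqF.
by rewrite !cbrtK//; field; rewrite !gt_eqF.
Qed.

(** Rounding the epoch length up costs nothing: a rounded length [m > 1] has
    [m - 1] below the unrounded one, and an epoch of length 1 has no inner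
    iteration. *)
Lemma rounded_balance : ((roundup y).-1)%:R ^+ 2 * Q <= (roundup z)%:R * L ^+ 2.
Proof.
apply: (@le_trans _ _ (z * L ^+ 2)); last first.
  by rewrite ler_wpM2r ?sqr_ge0// roundup_ge.
rewrite epoch_batch_balance ler_pM2r//.
rewrite ler_pXn2r ?nnegrE ?ler0n ?powR_ge0//.
have := roundup_le (powR_ge0 _ _ : 0 <= y).
by rewrite -{1}(prednK (roundup_gt0 y)) -natr1 lerD2r.
Qed.

Lemma rate_powers (x := eps `^ (- (1 / 3))) :
  [/\ 0 < x, eps^-1 = x ^+ 3, eps `^ (- 1) = x ^+ 3 & eps `^ (- (5 / 3)) = x ^+ 5].
Proof.
have x0 : 0 < x by exact: powR_gt0.
have E n : x ^+ n = eps `^ (- (1 / 3) * n%:R) by rewrite powRrM powR_mulrn// ltW.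
have E3 : eps `^ (- 1) = x ^+ 3.
  by rewrite E; congr (_ `^ _); field.
split => //; first by rewrite -E3 powR_inv1// ltW.
by rewrite E; congr (_ `^ _); field.
Qed.

Lemma cbrt_scale a : 0 <= a -> (a / eps) `^ (1 / 3) = a `^ (1 / 3) * eps `^ (- (1 / 3)).
Proof.
move=> a0; have [x0 E _ _] := rate_powers.
apply: cube_inj; rewrite ?powR_ge0// ?mulr_ge0 ?powR_ge0//.
by rewrite exprMn !cbrtK ?divr_ge0 ?(ltW eps_gt0)// E.
Qed.

Lemma cbrt_scale2 a : 0 <= a ->
  (a / eps ^+ 2) `^ (1 / 3) = a `^ (1 / 3) * (eps `^ (- (1 / 3))) ^+ 2.
Proof.
move=> a0; have [x0 E _ _] := rate_powers.
apply: cube_inj; rewrite ?powR_ge0// ?mulr_ge0 ?powR_ge0 ?sqr_ge0//.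
by rewrite exprMn !cbrtK ?divr_ge0 ?sqr_ge0// exprAC -E exprVn.
Qed.

(** With [x = eps `^ (- 1 / 3)], the number of iterations is of order [x ^+ 3],
    the inner batch of order [x ^+ 2] up to rounding, and the number of epochs of
    order [x ^+ 2], each of which costs [x ^+ 3]. *)
Lemma vanilla_cost_le d c (K : nat) (v : nat -> 'rV[R]_d) :
  0 <= c -> K%:R <= c / eps ->
  sto_cost (vanilla_rule 48 sigma eps) (roundup y) (roundup z) K v <=
  (2 * c * (Q * sigma ^+ 4 / L ^+ 2) `^ (1 / 3) + 2 * c +
   48 * sigma ^+ 2 * (c / (L ^+ 2 * sigma ^+ 2 / Q) `^ (1 / 3)) + 48 * sigma ^+ 2)
  * (eps `^ (- (5 / 3)) + eps `^ (- 1)).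
Proof.
move=> c0 Kc; have [x0 E -> ->] := rate_powers.
set x := eps `^ _ in x0 E *.
have yE : y = (L ^+ 2 * sigma ^+ 2 / Q) `^ (1 / 3) * x.
  rewrite -cbrt_scale; last first.
    by apply: divr_ge0; [by rewrite mulr_ge0 ?sqr_ge0|exact: ltW].
  by rewrite /y; congr (_ `^ _); field; rewrite !gt_eqF.
have zE : z = (Q * sigma ^+ 4 / L ^+ 2) `^ (1 / 3) * x ^+ 2.
  rewrite -cbrt_scale2; last first.
    apply: divr_ge0; last exact: sqr_ge0.
    by rewrite mulr_ge0 ?(ltW Q_gt0)// exprn_even_ge0.
  by rewrite /z; congr (_ `^ _); field; rewrite !gt_eqF.
move: (powR_ge0 (L ^+ 2 * sigma ^+ 2 / Q) (1 / 3)) yE.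
have m1E : 0 < sigma ^+ 2 -> 0 < (L ^+ 2 * sigma ^+ 2 / Q) `^ (1 / 3).
  by move=> s0; rewrite powR_gt0// divr_gt0// mulr_gt0// exprn_gt0.
set m1 := (_ `^ _) in m1E * => m10 yE.
move: (powR_ge0 (Q * sigma ^+ 4 / L ^+ 2) (1 / 3)) zE.
set b1 := (_ `^ _) => b10 zE.
rewrite /sto_cost /vanilla_rule sumr_const_nat subn0.
have x3 : 0 <= x ^+ 3 by rewrite exprn_ge0// ltW.
have x5 : 0 <= x ^+ 5 by rewrite exprn_ge0// ltW.
have KE : K%:R <= c * x ^+ 3 by rewrite -E.
have h1 : 2 * K%:R * (roundup z)%:R <= 2 * (c * x ^+ 3) * (b1 * x ^+ 2 + 1).
  apply: ler_pM; rewrite ?mulr_ge0 ?ler0n//; first by rewrite ler_pM2l.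
  by rewrite -zE; apply: roundup_le; exact: powR_ge0.
have h2 : 48 * sigma ^+ 2 / eps *+ (K %/ roundup y).+1 <=
    48 * sigma ^+ 2 * (c / m1) * x ^+ 5 + 48 * sigma ^+ 2 * x ^+ 3.
  have [s0|s0] := eqVneq (sigma ^+ 2) 0.
    by rewrite s0 mulr0 !mul0r mul0rn addr0.
  have s1 : 0 < sigma ^+ 2 by rewrite lt_neqAle eq_sym s0 sqr_ge0.
  rewrite -[_ *+ (_ %/ _).+1]mulr_natr -[(_ %/ _).+1%:R]natr1 mulrDr mulr1 E.
  apply: lerD => //.
  have m1p := m1E s1.
  have -> : 48 * sigma ^+ 2 * (c / m1) * x ^+ 5 =
      48 * sigma ^+ 2 * x ^+ 3 * (c * x ^+ 3 / (m1 * x)).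
    by field; rewrite !gt_eqF.
  apply: ler_wpM2l; first by rewrite mulr_ge0// mulr_ge0// sqr_ge0.
  rewrite -yE.
  have m0 : 0 < (roundup y)%:R :> R by rewrite ltr0n roundup_gt0.
  have y0 : 0 < y by rewrite yE mulr_gt0.
  apply: (@le_trans _ _ (K%:R / (roundup y)%:R)).
    by rewrite ler_pdivlMr// -natrM ler_nat leq_divM.
  apply: ler_pM; rewrite ?ler0n ?invr_ge0 ?ler0n//.
  by rewrite lef_pV2 ?posrE// roundup_ge.
apply: (le_trans (lerD h1 h2)).
have u1 : 0 <= c / m1 by rewrite divr_ge0.
have u2 := sqr_ge0 sigma.
have p1 : 0 <= c * b1 * x ^+ 3 by rewrite mulr_ge0// mulr_ge0.
have p2 : 0 <= c * x ^+ 5 by rewrite mulr_ge0.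
have p3 : 0 <= sigma ^+ 2 * (c / m1) * x ^+ 3 by rewrite mulr_ge0// mulr_ge0.
have p4 : 0 <= sigma ^+ 2 * x ^+ 5 by rewrite mulr_ge0.
have -> : 2 * (c * x ^+ 3) * (b1 * x ^+ 2 + 1) = 2 * (c * b1 * x ^+ 5) + 2 * (c * x ^+ 3).
  by ring.
move: p1 p2 p3 p4; move: (c / m1) (x ^+ 3) (x ^+ 5) (sigma ^+ 2) => q u w s.
by lra.
Qed.

End rates.

(** * Runs of the algorithm *)

Lemma subr_shift (V : zmodType) (a p q r : V) : a + r - p = a - (p - q) + (r - q).
Proof. by rewrite -addrA -[RHS]addrA; congr (a + _); rewrite opprB [RHS]addrC subrKA. Qed.

Lemma add_telescoped (R : realType) (c j2 j1 j0 T t x y : R) :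
  x <= c * (j1 - j0) + T -> y <= c * (j2 - j1) + t ->
  x + y <= c * (j2 - j0) + (T + t).
Proof. by move=> h1 h2; nra. Qed.

Section run.
Context (R : realType) (dS dA : measure_display)
        (S : measurableType dS) (A : measurableType dA).
Variables (M : mdp R S A) (d : nat) (pi : policy R S A d).
Variables (g : traj M -> 'rV[R]_d -> 'rV[R]_d).
Variables (G C_H Rmax sigma L Lg Gamma alphaw : R).
Hypothesis A1 : unbiased_gradient pi g.
Hypothesis A2 : regular_policy M pi G C_H Rmax.
Hypothesis A3 : bounded_variance pi g sigma.
Hypothesis Hconst : smoothness_constants pi g L Lg Gamma alphaw.
Local Notation Theta := 'rV[R]_d.
Local Notation mu := (traj_dist M pi).
Local Notation gradJ := (grad (J M pi)).
Local Opaque traj_dist likelihood.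

Variables (alpha b eps eta : R) (m B K : nat) (theta0 : Theta).
Hypotheses (alpha_gt0 : 0 < alpha) (b_ge0 : 0 <= b) (eps_gt0 : 0 < eps).
Hypotheses (m_gt0 : (0 < m)%N) (B_gt0 : (0 < B)%N).
Let N := @aba_rule R d alpha b sigma eps m.
Context (dO : measure_display) (Omega : measurableType dO) (P : probability Omega R).
Variables (tau : nat -> nat -> Omega -> traj M) (theta v : nat -> Omega -> Theta)
  (xi : Omega -> nat).
Hypothesis run : svrpg_run pi g P N eta m B K theta0 tau theta v xi.

(** These events generate the history of the run; the sigma-algebra that they
    generate is used below as a measurable structure on the sample space. *)
Definition past_events k : set (set Omega) :=
  [set E | exists j i (U : set (traj M)),
     [/\ (j < k)%N, measurable U & E = tau j i @^-1` U]].

Local Notation Past k := (g_sigma_algebraType (past_events k)).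
Local Notation known k h := (@measurable_fun _ _ (Past k) _ setT h).
Local Notation knownV k h := (forall c, known k (fun w => h w 0 c)).

Lemma measurable_past k (E : set Omega) : (k <= K.+1)%N ->
  (past_events k).-sigma.-measurable E -> measurable E.
Proof.
move=> kK; apply: smallest_sub; first exact: sigma_algebra_measurable.
move=> _ [j [i [U [jk mU ->]]]]; rewrite -[X in measurable X]setTI.
by apply: (run_measurable run) => //; rewrite -ltnS (leq_trans jk).
Qed.

Lemma measurable_id_past k : (k <= K.+1)%N ->
  @measurable_fun _ _ Omega (Past k) setT id.
Proof. by move=> kK _ E mE; rewrite setTI preimage_id; exact: (measurable_past kK). Qed.

Lemma known_measurable d' (T : measurableType d') k (h : Omega -> T) :
  (k <= K.+1)%N -> known k h -> measurable_fun setT h.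
Proof. by move=> kK kh; exact: (measurableT_comp kh (measurable_id_past kK)). Qed.

Lemma measurable_id_mono k l : (k <= l)%N ->
  @measurable_fun _ _ (Past l) (Past k) setT id.
Proof.
move=> kl _ E mE; rewrite setTI preimage_id.
apply: sub_sigma_algebra2 mE => _ [j [i [U [jk mU ->]]]].
by exists j, i, U; split => //; exact: leq_trans kl.
Qed.

Lemma known_mono d' (T : measurableType d') k l (h : Omega -> T) :
  (k <= l)%N -> known k h -> known l h.
Proof. by move=> kl kh; exact: (measurableT_comp kh (measurable_id_mono kl)). Qed.

Lemma known_traj j i k : (j < k)%N -> known k (tau j i).
Proof.
move=> jk _ U mU; rewrite setTI; apply: sub_sigma_algebra.
by exists j, i, U.
Qed.

Definition epoch k := (k %/ m * m)%N.

Lemma epoch_le k : (epoch k <= k)%N. Proof. exact: leq_divM. Qed.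

Lemma dvdn_epoch k : (m %| epoch k)%N. Proof. exact: dvdn_mull. Qed.

Lemma epoch_lt k : ~~ (m %| k)%N -> (epoch k < k)%N.
Proof.
move=> mk; rewrite ltn_neqAle epoch_le andbT.
by apply: contra mk => /eqP <-; exact: dvdn_epoch.
Qed.

(** Random at a checkpoint, but determined by the past of iteration [k] and
    bounded by [max_batch k]. *)
Definition batch k w : nat := if (m %| k)%N then roundup (N (v^~ w) k) else B.

Definition max_batch k : nat :=
  if (m %| k)%N then roundup (alpha * sigma ^+ 2 / eps) else B.

Lemma batch_bounds k w : (0 < batch k w <= max_batch k)%N.
Proof.
rewrite /batch /max_batch; case: ifP => _; last by rewrite B_gt0 leqnn.
rewrite roundup_gt0/= roundup_mono ?aba_rule_ge0//.
exact: aba_rule_le.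
Qed.

Definition noise k w (t : traj M) : Theta :=
  if (m %| k)%N then outer_noise pi g (theta k w) t
  else inner_noise pi g (theta k w) (theta (epoch k) w) t.

Definition error k w : Theta := v k w - gradJ (theta k w).

Definition carried k w : Theta := if (m %| k)%N then 0 else error (epoch k) w.

Definition samples k w : Theta :=
  \sum_(0 <= i < max_batch k) batch_weight R (batch k w) i *: noise k w (tau k i w).

(** The error of an estimate is the sampling noise, plus the error carried over
    from the checkpoint inside an epoch. *)
Lemma errorE k w : (k <= K)%N -> error k w = samples k w + carried k w.
Proof.
move=> kK; have bb := batch_bounds k w.
have /andP[b0 bm] := bb.
have W1 := sum_batch_weight1 R bb.
rewrite /error /samples /carried /noise.
have [mk|mk] := boolP (m %| k)%N.
  rewrite (run_outer run w kK mk) addr0.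
  have -> : roundup (N (v^~ w) k) = batch k w by rewrite /batch mk.
  rewrite (minibatch_weight _ bm) /outer_noise.
  under [RHS]eq_bigr do rewrite scalerBr.
  by rewrite sumrB -scaler_suml W1 scale1r.
rewrite (run_inner run w kK mk)/=.
have -> : minibatch B = minibatch (batch k w) by rewrite /batch (negPf mk).
rewrite (minibatch_weight _ bm) /inner_noise -/(epoch k).
under [in RHS]eq_bigr do rewrite scalerBr.
rewrite sumrB -scaler_suml W1 scale1r /corrected_g.
exact: subr_shift.
Qed.

Lemma known_batch_weight k i : (forall j, (j < k)%N -> knownV k (v j)) ->
  known k (fun w => batch_weight R (batch k w) i).
Proof.
move=> kv; rewrite /batch; case: (m %| k)%N; last exact: measurable_cst.
have mw : measurable_fun setT (fun n : nat => batch_weight R n i) by [].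
apply: (measurableT_comp mw).
apply: (measurableT_comp (@measurable_roundup R)).
exact: (@measurable_aba_rule R d alpha b sigma eps m b_ge0 eps_gt0 _ (Past k) v k kv).
Qed.

Lemma measurable_noise k : knownV k (theta k) -> knownV k (theta (epoch k)) ->
  forall c, @measurable_fun _ _ (Past k * traj M)%type _ setT
    (fun z : Omega * traj M => noise k z.1 z.2 0 c).
Proof.
move=> k1 k2 c; rewrite /noise; case: (m %| k)%N.
  rewrite /outer_noise; under eq_fun do rewrite rowB.
  apply: measurable_funB.
    exact: (measurable_g_param A1 Hconst (X := Past k) c k1).
  exact: (measurableT_comp (measurable_gradJ_param Hconst (X := Past k) c k1) measurable_fst).
rewrite /inner_noise /corrected_g; under eq_fun do rewrite !rowB rowZ.
apply: measurable_funB; apply: measurable_funB.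
- exact: (measurable_g_param A1 Hconst (X := Past k) c k1).
- apply: measurable_funM.
    exact: (measurable_iweight A2 (X := Past k) k1 k2).
  exact: (measurable_g_param A1 Hconst (X := Past k) c k2).
- exact: (measurableT_comp (measurable_gradJ_param Hconst (X := Past k) c k1) measurable_fst).
- exact: (measurableT_comp (measurable_gradJ_param Hconst (X := Past k) c k2) measurable_fst).
Qed.

Lemma knownV_add k (h1 h2 : Omega -> Theta) : knownV k h1 -> knownV k h2 ->
  knownV k (fun w => h1 w + h2 w).
Proof. by move=> k1 k2 c; under eq_fun do rewrite mxE; exact: measurable_funD. Qed.

Lemma knownV_mono k l (h : Omega -> Theta) : (k <= l)%N -> knownV k h -> knownV l h.
Proof. by move=> kl kh c; exact: known_mono kl (kh c). Qed.

(** Parameters, step directions and batch sizes are determined by the samples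
    drawn so far, one iteration after the other. *)
Lemma run_known k : (k <= K.+1)%N ->
  (forall j, (j <= k)%N -> knownV k (theta j)) /\
  (forall j, (j < k)%N -> knownV k (v j)).
Proof.
elim: k => [|k IHk] kK.
  split => // j; rewrite leqn0 => /eqP-> c.
  by rewrite (_ : (fun w => _) = (fun=> theta0 0 c)); [exact: measurable_cst|apply/funext => w; rewrite (run_init run)].
have [kth kv] := IHk (ltnW kK).
have kth' j : (j <= k)%N -> knownV k.+1 (theta j).
  by move=> jk; apply: knownV_mono (leqnSn k) _; exact: kth.
have mgr j : (j <= k)%N -> knownV k.+1 (fun w => gradJ (theta j w)).
  by move=> jk c; exact: (measurable_gradJ_param Hconst (X := Past k.+1) c (kth' j jk)).
have kvk : knownV k.+1 (v k).
  have -> : v k = fun w => samples k w + carried k w + gradJ (theta k w).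
    by apply/funext => w; rewrite -errorE// subrK.
  apply: knownV_add (mgr k (leqnn k)); apply: knownV_add => [c|].
    rewrite /samples; under eq_fun do rewrite summxE.
    apply: measurable_sum => i; under eq_fun do rewrite mxE.
    apply: measurable_funM.
      exact: known_mono (leqnSn k) (known_batch_weight i kv).
    have kn := measurable_noise (kth k (leqnn k)) (kth _ (epoch_le k)) c.
    have kt : @measurable_fun _ _ (Past k.+1) (Past k * traj M)%type setT
        (fun w : Omega => (w, tau k i w)).
      apply/measurable_fun_pairP; split; last exact: known_traj.
      exact: measurable_id_mono.
    exact: (measurableT_comp kn kt).
  rewrite /carried; case: (boolP (m %| k)%N) => mk c.
    by under eq_fun do rewrite mxE; exact: measurable_cst.
  have ek := epoch_lt mk.
  rewrite /error; under eq_fun do rewrite rowB; apply: measurable_funB.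
    exact: known_mono (leqnSn k) (kv _ ek c).
  exact: mgr (epoch_le k) c.
have kvS j : (j < k.+1)%N -> knownV k.+1 (v j).
  rewrite ltnS leq_eqVlt => /orP[/eqP->//|jk].
  by apply: knownV_mono (leqnSn k) _; exact: kv.
split => // j; rewrite leq_eqVlt => /orP[/eqP->|jk]; last exact: kth'.
have -> : theta k.+1 = fun w => theta k w + eta *: v k w.
  by apply/funext => w; rewrite (run_step run).
apply: knownV_add; first exact: kth'.
by move=> c; under eq_fun do rewrite mxE; apply: measurable_funM; [exact: measurable_cst|exact: kvk].
Qed.


Lemma known_theta k : (k <= K.+1)%N -> forall j, (j <= k)%N -> knownV k (theta j).
Proof. by move=> kK; have [] := run_known kK. Qed.

Lemma known_v k : (k <= K.+1)%N -> forall j, (j < k)%N -> knownV k (v j).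
Proof. by move=> kK; have [] := run_known kK. Qed.

Lemma known_carried k : (k <= K)%N -> knownV k (carried k).
Proof.
move=> kK c; rewrite /carried; case: (boolP (m %| k)%N) => mk.
  by under eq_fun do rewrite mxE; exact: measurable_cst.
rewrite /error; under eq_fun do rewrite rowB; apply: measurable_funB.
  exact: (known_v (leqW kK) (epoch_lt mk)).
exact: (measurable_gradJ_param Hconst (X := Past k) c (known_theta (leqW kK) (epoch_le k))).
Qed.

Lemma sample_law k n (W : nat -> set (traj M)) E : (k <= K)%N ->
  (forall l, measurable (W l)) -> (past_events k).-sigma.-measurable E ->
  P (E `&` \bigcap_(l in [set: 'I_n]) (tau k l @^-1` W l)) =
  (\int[P]_(w in E) \prod_(l < n) mu (theta k w) (W l))%E.
Proof. by move=> kK mW mE; exact: (run_sample run (U := fun l : 'I_n => W l)). Qed.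

(** Leaving the other samples of the iteration unconstrained in the joint law. *)
Lemma run_cond_law k i : (k <= K)%N ->
  has_cond_law P (id : Omega -> Past k) (fun w => mu (theta k w) : giry (traj M) R) (tau k i).
Proof.
move=> kK E U mE mU; rewrite preimage_id.
pose W l := if l == i then U else setT.
have mW l : measurable (W l) by rewrite /W; case: ifP.
have := sample_law i.+1 kK mW mE.
have -> : \bigcap_(l in [set: 'I_i.+1]) (tau k l @^-1` W l) = tau k i @^-1` U.
  apply/seteqP; split => [w /(_ ord_max Logic.I)|w Uw l _]; rewrite /W /= ?eqxx//.
  by case: eqP => [->|].
move=> ->; apply: eq_integral => w _.
rewrite (bigD1 ord_max)//= /W eqxx big1 ?mule1// => l li.
rewrite ifN; first exact: probability_setT.
by apply: contra li => /eqP li; apply/eqP/val_inj.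
Qed.

Lemma run_cond_law2 k i j : (k <= K)%N -> (i < j)%N ->
  forall (E : set (Past k)) U V, measurable E -> measurable U -> measurable V ->
  P ((id : Omega -> Past k) @^-1` E `&` (tau k i @^-1` U `&` tau k j @^-1` V)) =
  (\int[P]_(w in (id : Omega -> Past k) @^-1` E) (mu (theta k w) U * mu (theta k w) V))%E.
Proof.
move=> kK ij E U V mE mU mV; rewrite preimage_id.
have ji : (j == i) = false by rewrite gtn_eqF.
pose W l := if l == i then U else if l == j then V else setT.
have mW l : measurable (W l) by rewrite /W; case: ifP => // _; case: ifP.
have := sample_law j.+1 kK mW mE.
have ij1 : (i < j.+1)%N by exact: ltnW.
have -> : \bigcap_(l in [set: 'I_j.+1]) (tau k l @^-1` W l) =
    tau k i @^-1` U `&` tau k j @^-1` V.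
  apply/seteqP; split => [w h|w [Uw Vw] l _].
    have := h (Ordinal ij1) Logic.I; have := h ord_max Logic.I.
    by rewrite /W /= eqxx ji eqxx.
  rewrite /W /=; case: eqP => [->//|_]; by case: eqP => [->|].
move=> ->; apply: eq_integral => w _.
rewrite (bigD1 (Ordinal ij1))//= /W eqxx; congr (_ * _)%E.
rewrite (bigD1 ord_max)//=; last by rewrite -val_eqE/= ji.
rewrite eqxx ji big1 ?mule1// => l /andP[li lj].
rewrite -!val_eqE/= in li lj; rewrite (negPf li) (negPf lj).
exact: probability_setT.
Qed.

Local Notation int1 := (rintegrable P).

Definition conditional_variance k w : R :=
  if (m %| k)%N then sigma ^+ 2
  else 2 * (Lg ^+ 2 + Gamma * alphaw) * enorm (theta k w - theta (epoch k) w) ^+ 2.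

Lemma noise_mean k w c : (\int[mu (theta k w)]_t (noise k w t 0 c)%:E = 0)%E.
Proof.
rewrite /noise; case: (m %| k)%N; first exact: (outer_noise_mean A1 Hconst).
exact: (inner_noise_mean A1 A2 Hconst).
Qed.

Lemma noise_sq k w :
  (\int[mu (theta k w)]_t (enorm (noise k w t) ^+ 2)%:E <= (conditional_variance k w)%:E)%E.
Proof.
rewrite /noise /conditional_variance; case: (m %| k)%N; first exact: outer_noise_sq.
exact: (inner_noise_sq A1 A2 Hconst).
Qed.

Lemma known_conditional_variance k : (k <= K)%N -> known k (conditional_variance k).
Proof.
move=> kK; rewrite /conditional_variance; case: (m %| k)%N; first exact: measurable_cst.
apply: measurable_funM; first exact: measurable_cst.
apply: measurable_enorm_sq => c; under eq_fun do rewrite rowB.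
apply: measurable_funB; first exact: (known_theta (leqW kK) (leqnn k)).
exact: (known_theta (leqW kK) (epoch_le k)).
Qed.

(** One iteration adds a conditionally centred term to an error that is already
    determined, so the second moments add up. *)
Lemma error_step k : (k <= K)%N -> int1 (conditional_variance k) ->
  int1 (fun w => enorm (carried k w) ^+ 2) ->
  int1 (fun w => enorm (error k w) ^+ 2) /\
  \int[P]_w (enorm (error k w) ^+ 2) <=
  \int[P]_w ((batch k w)%:R^-1 * conditional_variance k w) +
  \int[P]_w (enorm (carried k w) ^+ 2).
Proof.
move=> kK si ci.
have kK1 := leqW kK.
have mk : @measurable_fun _ _ (Past k) (giry (traj M) R) setT (fun w => mu (theta k w) : giry (traj M) R).
  exact: (measurable_traj_dist A2 (X := Past k) (known_theta kK1 (leqnn k))).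
have mt i : measurable_fun setT (tau k i) by exact: (run_measurable run).
have my := measurable_noise (known_theta kK1 (leqnn k)) (known_theta kK1 (epoch_le k)).
have ma i := known_batch_weight i (known_v kK1).
have a01 i w := batch_weight_bounds R (batch k w) i.
have := @minibatch_second_moment R d _ _ _ Omega (Past k) (traj M) P
  (id : Omega -> Past k) (fun w => mu (theta k w)) (measurable_id_past kK1) mk
  (tau k) mt (fun i => run_cond_law i kK) (fun i j ij => run_cond_law2 kK ij)
  (fun z => noise k z.1 z.2) (conditional_variance k) (carried k)
  (fun i w => batch_weight R (batch k w) i) my (noise_mean k) (noise_sq k) si
  (known_conditional_variance kK) (known_carried kK) ci ma a01 (max_batch k).
have -> : (fun w => enorm (error k w) ^+ 2) =
    (fun w => enorm (samples k w + carried k w) ^+ 2).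
  by apply/funext => w; rewrite errorE.
have -> : (fun w => (batch k w)%:R^-1 * conditional_variance k w) =
   (fun w => (\sum_(0 <= i < max_batch k) batch_weight R (batch k w) i ^+ 2) * conditional_variance k w).
  by apply/funext => w; rewrite sum_batch_weight_sq// batch_bounds.
by [].
Qed.

Lemma drift e k w : (e <= k <= K.+1)%N ->
  theta k w - theta e w = eta *: \sum_(e <= i < k) v i w.
Proof.
elim: k => [|k IHk] /andP[ek kK].
  by move: ek; rewrite leqn0 => /eqP->; rewrite big_geq// scaler0 subrr.
move: ek; rewrite leq_eqVlt => /orP[/eqP->|ek].
  by rewrite big_geq// scaler0 subrr.
rewrite (run_step run)// big_nat_recr//= scalerDr -IHk; last by rewrite -ltnS ek ltnW.
by rewrite addrAC.
Qed.

Lemma drift_sq_le e k w : (e <= k <= K.+1)%N ->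
  enorm (theta k w - theta e w) ^+ 2 <=
  eta ^+ 2 * ((k - e)%:R * \sum_(e <= i < k) enorm (v i w) ^+ 2).
Proof.
by move=> ek; rewrite drift// enormZ_sq ler_wpM2l ?sqr_ge0// enorm_sum_sq_le.
Qed.

Lemma run_measurable_v k : (k <= K)%N -> forall c, measurable_fun setT (fun w => v k w 0 c).
Proof.
move=> kK c; have kK1 : (k.+1 <= K.+1)%N by [].
exact: (known_measurable kK1 (known_v kK1 (ltnSn k) c)).
Qed.

Lemma run_measurable_theta k : (k <= K.+1)%N ->
  forall c, measurable_fun setT (fun w => theta k w 0 c).
Proof. by move=> kK c; exact: (known_measurable kK (known_theta kK (leqnn k) c)). Qed.

Lemma integrable_gradJ k : (k <= K.+1)%N ->
  int1 (fun w => enorm (gradJ (theta k w)) ^+ 2).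
Proof.
move=> kK; apply: (integrable_bounded _ (C := Gamma)).
  apply: measurable_enorm_sq => c.
  exact: (measurable_gradJ_param Hconst c (run_measurable_theta kK)).
by move=> w; rewrite ger0_norm ?sqr_ge0//; exact: (gradJ_bounded A1 Hconst).
Qed.

Lemma integrable_sum_v (s : seq nat) : 
  (forall j, (j \in s) -> int1 (fun w => enorm (v j w) ^+ 2)) ->
  int1 (fun w => \sum_(i <- s) enorm (v i w) ^+ 2).
Proof.
move=> h.
have -> : (fun w => \sum_(i <- s) enorm (v i w) ^+ 2) =
    (fun w => \sum_(i <- s) (if i \in s then enorm (v i w) ^+ 2 else 0)).
  by apply/funext => w; rewrite big_seq [RHS]big_seq; apply: eq_bigr => i ->.
apply: integrable_bigsum => i; case: (boolP (i \in s)) => [/h//|_].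
exact: integrable_constant.
Qed.

(** Step lengths need not be bounded, but they have finite second moments: those
    of the past bound the drift, hence the conditional variance, hence the next
    error, and the gradient itself is bounded. *)
Lemma run_integrable k : (k <= K)%N ->
  [/\ int1 (conditional_variance k), int1 (fun w => enorm (carried k w) ^+ 2),
    int1 (fun w => enorm (error k w) ^+ 2) & int1 (fun w => enorm (v k w) ^+ 2)].
Proof.
elim/ltn_ind: k => k IHk kK.
have vi j : (j < k)%N -> int1 (fun w => enorm (v j w) ^+ 2).
  by move=> jk; have [] := IHk j jk (ltnW (leq_trans jk kK)).
have si : int1 (conditional_variance k).
  have ms := known_measurable (leqW kK) (known_conditional_variance kK).
  rewrite /conditional_variance in ms *; case: (m %| k)%N ms => ms.
    exact: integrable_constant.
  apply: integrable_scale.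
  apply: (integrable_dominated (g := fun w =>
    eta ^+ 2 * ((k - epoch k)%:R * \sum_(epoch k <= i < k) enorm (v i w) ^+ 2))).
  - apply: measurable_enorm_sq => c; under eq_fun do rewrite rowB.
    apply: measurable_funB; first exact: run_measurable_theta (leqW kK) c.
    exact: run_measurable_theta (leq_trans (epoch_le k) (leqW kK)) c.
  - by move=> w; rewrite ger0_norm ?sqr_ge0// drift_sq_le// epoch_le leqW.
  - apply: integrable_scale; apply: integrable_scale; apply: integrable_sum_v => j.
    by rewrite mem_index_iota => /andP[_]; exact: vi.
have ci : int1 (fun w => enorm (carried k w) ^+ 2).
  rewrite /carried; case: (boolP (m %| k)%N) => mk.
    exact: integrable_constant.
  by have [] := IHk _ (epoch_lt mk) (leq_trans (epoch_le k) kK).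
have [ei _] := error_step kK si ci.
split => //.
apply: (integrable_dominated (g := fun w =>
   2 * enorm (error k w) ^+ 2 + 2 * enorm (gradJ (theta k w)) ^+ 2)).
- exact: measurable_enorm_sq (run_measurable_v kK).
- move=> w; rewrite ger0_norm ?sqr_ge0//.
  by have := enorm_sqD_le (error k w) (gradJ (theta k w)); rewrite subrK.
- by apply: integrable_add; apply: integrable_scale => //; exact: integrable_gradJ (leqW kK).
Qed.

Local Notation EV k := (\int[P]_w (enorm (v k w) ^+ 2)).
Local Notation EE k := (\int[P]_w (enorm (error k w) ^+ 2)).

Lemma Rintegral_sum_v a k : (k <= K.+1)%N ->
  \int[P]_w (\sum_(a <= i < k) enorm (v i w) ^+ 2) = \sum_(a <= i < k) EV i.
Proof.
move=> kK.
pose F i w := if (i < k)%N then enorm (v i w) ^+ 2 else 0.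
have Fi i : int1 (F i).
  rewrite /F; case: (ltnP i k) => ik; last exact: integrable_constant.
  by have [] := run_integrable (leq_trans ik kK).
transitivity (\int[P]_w (\sum_(i <- index_iota a k) F i w)).
  by apply: eq_Rintegral => w _; apply: eq_big_nat => i /andP[_ ik]; rewrite /F ik.
rewrite Rintegral_bigsum//; apply: eq_big_nat => i /andP[_ ik].
by apply: eq_Rintegral => w _; rewrite /F ik.
Qed.

(** At a checkpoint the adaptive batch size is calibrated so that the variance
    is a fraction of the mean squared step length over the previous epoch, up to
    a fraction of [eps]. *)
Lemma outer_error_le k : (k <= K)%N -> (m %| k)%N ->
  EE k <= (b / m%:R * (\sum_(k - m <= i < k) EV i) + eps) / alpha.
Proof.
move=> kK mk; have [si ci ei vi] := run_integrable kK.
have [_] := error_step kK si ci.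
have -> : \int[P]_w (enorm (carried k w) ^+ 2) = 0.
  rewrite -[RHS](Rintegral_constant P); apply: eq_Rintegral => w _.
  by rewrite /carried mk enorm0 expr0n.
rewrite addr0 => /le_trans; apply.
pose D w := b / m%:R * (\sum_(k - m <= i < k) enorm (v i w) ^+ 2) + eps.
have iS : int1 (fun w => \sum_(k - m <= i < k) enorm (v i w) ^+ 2).
  apply: integrable_sum_v => j; rewrite mem_index_iota => /andP[_ jk].
  by have [] := run_integrable (ltnW (leq_trans jk kK)).
have iD : int1 D.
  by apply: integrable_add; [exact: integrable_scale|exact: integrable_constant].
apply: (@le_trans _ _ (\int[P]_w (alpha^-1 * D w))).
  apply: Rintegral_mono.
  - apply: (integrable_dominated _ _ si).
      apply: (@measurable_funM _ _ _ setT (fun w => (batch k w)%:R^-1)).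
        have mb : measurable_fun setT (fun n : nat => n%:R^-1 : R) by [].
        apply: (measurableT_comp mb).
        rewrite /batch mk; apply: (measurableT_comp (@measurable_roundup R)).
        apply: measurable_aba_rule => // j jk.
        exact: run_measurable_v (ltnW (leq_trans jk kK)).
      exact: integrable_measurable si.
    have s0 w : 0 <= conditional_variance k w by rewrite /conditional_variance mk sqr_ge0.
    move=> w; have /andP[b1 _] := batch_bounds k w.
    rewrite ger0_norm ?mulr_ge0 ?invr_ge0 ?ler0n// ler_piMl// invf_le1 ?ler1n//.
    by rewrite ltr0n.
  - exact: integrable_scale.
  - move=> w; rewrite /conditional_variance mk.
    have /andP[b1 _] := batch_bounds k w.
    have D0 : 0 < D w by exact: aba_denom_gt0.
    rewrite ler_pdivrMl ?ltr0n// mulrCA ler_pdivlMl//.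
    rewrite -ler_pdivrMr//.
    have -> : batch k w = roundup (N (v^~ w) k) by rewrite /batch mk.
    exact: roundup_ge.
rewrite Rintegral_scale// /D Rintegral_add; [|exact: integrable_scale|exact: integrable_constant].
by rewrite Rintegral_scale// Rintegral_constant Rintegral_sum_v ?(leqW kK)// mulrC.
Qed.

(** Inside an epoch the error grows with the distance to the checkpoint, which
    is controlled by the step lengths taken since then. *)
Lemma inner_error_le k : (k <= K)%N -> ~~ (m %| k)%N ->
  0 <= Lg ^+ 2 + Gamma * alphaw ->
  EE k <= 2 * (Lg ^+ 2 + Gamma * alphaw) / B%:R * eta ^+ 2 *
    ((k - epoch k)%:R * \sum_(epoch k <= i < k) EV i) + EE (epoch k).
Proof.
move=> kK mk Q0; have [si ci ei vi] := run_integrable kK.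
have [_ /le_trans] := error_step kK si ci; apply.
set Q := 2 * _; have Q1 : 0 <= Q by rewrite mulr_ge0.
apply: lerD; last first.
  rewrite le_eqVlt; apply/orP; left; apply/eqP; apply: eq_Rintegral => w _.
  by rewrite /carried (negPf mk).
have iS : int1 (fun w => \sum_(epoch k <= i < k) enorm (v i w) ^+ 2).
  apply: integrable_sum_v => j; rewrite mem_index_iota => /andP[_ jk].
  by have [] := run_integrable (ltnW (leq_trans jk kK)).
have -> : \int[P]_w ((batch k w)%:R^-1 * conditional_variance k w) =
    \int[P]_w (B%:R^-1 * conditional_variance k w).
  by apply: eq_Rintegral => w _; rewrite /batch (negPf mk).
apply: (@le_trans _ _ (\int[P]_w ((Q / B%:R * eta ^+ 2 * (k - epoch k)%:R) *
    \sum_(epoch k <= i < k) enorm (v i w) ^+ 2))); last first.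
  by rewrite Rintegral_scale// Rintegral_sum_v ?(leqW kK)// !mulrA.
apply: Rintegral_mono; [exact: integrable_scale|exact: integrable_scale|].
move=> w; rewrite /conditional_variance (negPf mk) -/Q.
have := @drift_sq_le (epoch k) k w; rewrite epoch_le (leqW kK) => /(_ isT) h.
move: (enorm _ ^+ 2) (\sum_(_ <= i < _) _) h => x y' h.
have -> : Q / B%:R * eta ^+ 2 * (k - epoch k)%:R * y' =
    B%:R^-1 * (Q * (eta ^+ 2 * ((k - epoch k)%:R * y'))) by ring.
by rewrite ler_wpM2l ?invr_ge0 ?ler0n// ler_wpM2l.
Qed.


Hypothesis L_gt0 : 0 < L.
Hypothesis etaE : eta = 1 / (2 * L).

Lemma descent_step k w : (k <= K)%N ->
  2^-1 * enorm (gradJ (theta k w)) ^+ 2 + 4^-1 * enorm (v k w) ^+ 2 <=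
  2 * L * (J M pi (theta k.+1 w) - J M pi (theta k w)) + 2^-1 * enorm (error k w) ^+ 2.
Proof.
move=> kK; have [_ dJ _] := A1; have [lipJ _ _ _] := Hconst.
have := @smooth_lower_bound R d (J M pi) L (theta k w) (eta *: v k w) L_gt0 dJ lipJ.
rewrite -(run_step run)// enormZ_sq.
have -> : dotr (gradJ (theta k w)) (eta *: v k w) = eta * dotr (gradJ (theta k w)) (v k w).
  by rewrite /dotr mulr_sumr; apply: eq_bigr => i _; rewrite rowZ mulrCA.
have -> : enorm (error k w) ^+ 2 = enorm (v k w) ^+ 2 -
    2 * dotr (gradJ (theta k w)) (v k w) + enorm (gradJ (theta k w)) ^+ 2.
  rewrite !enorm_sqE /dotr mulr_sumr -sumrB -big_split/=.
  by apply: eq_bigr => i _; rewrite rowB; ring.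
move: (enorm _ ^+ 2) (enorm _ ^+ 2) (dotr _ _) (J M pi _) (J M pi _) => x y z j1 j0.
rewrite -(ler_pM2l (mulr_gt0 (ltr0Sn R 1) L_gt0)) => h.
have e1 : 2 * L * eta = 1 by rewrite etaE mul1r mulfV// mulf_neq0// ?pnatr_eq0// gt_eqF.
have e2 : 2 * L * (j0 + eta * z - L / 2 * (eta ^+ 2 * y)) = 2 * L * j0 + (2 * L * eta) * z
   - (2 * L * eta) ^+ 2 / 4 * y by field.
by move: h; rewrite e2 e1 expr1n; lra.
Qed.

Lemma descent_sum n w : (n <= K.+1)%N ->
  \sum_(0 <= k < n) (2^-1 * enorm (gradJ (theta k w)) ^+ 2 + 4^-1 * enorm (v k w) ^+ 2) <=
  2 * L * (J M pi (theta n w) - J M pi (theta 0%N w)) +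
  \sum_(0 <= k < n) 2^-1 * enorm (error k w) ^+ 2.
Proof.
elim: n => [|n IHn] nK; first by rewrite !big_geq// subrr mulr0 addr0.
rewrite !big_nat_recr//=; have h1 := IHn (ltnW nK); have h2 := @descent_step n w nK.
exact: add_telescoped h1 h2.
Qed.

Local Notation EG k := (\int[P]_w (enorm (gradJ (theta k w)) ^+ 2)).
Let Jmax := Rmax * (horizon M)%:R.

Lemma expected_descent :
  \sum_(0 <= k < K.+1) (2^-1 * EG k + 4^-1 * EV k) <=
  4 * L * Jmax + 2^-1 * \sum_(0 <= k < K.+1) EE k.
Proof.
pose F k w := if (k <= K)%N then 2^-1 * enorm (gradJ (theta k w)) ^+ 2 + 4^-1 * enorm (v k w) ^+ 2 else 0.
pose E k w := if (k <= K)%N then 2^-1 * enorm (error k w) ^+ 2 else 0.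
have iF k : int1 (F k).
  rewrite /F; case: (leqP k K) => kK; last exact: integrable_constant.
  have [_ _ _ vi] := run_integrable kK.
  by apply: integrable_add; apply: integrable_scale => //; exact: integrable_gradJ (leqW kK).
have iE k : int1 (E k).
  rewrite /E; case: (leqP k K) => kK; last exact: integrable_constant.
  by apply: integrable_scale; have [] := run_integrable kK.
have EF k : (0 <= k < K.+1)%N -> \int[P]_w F k w = 2^-1 * EG k + 4^-1 * EV k.
  move=> /andP[_ kK]; have kK1 : (k <= K)%N by [].
  have [_ _ _ vi] := run_integrable kK1; have gi := integrable_gradJ (leqW kK1).
  rewrite /F kK1 Rintegral_add; [|exact: integrable_scale|exact: integrable_scale].
  by rewrite !Rintegral_scale.
have EEk k : (0 <= k < K.+1)%N -> \int[P]_w E k w = 2^-1 * EE k.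
  move=> /andP[_ kK]; have kK1 : (k <= K)%N by [].
  by have [_ _ ei _] := run_integrable kK1; rewrite /E kK1 Rintegral_scale.
rewrite mulr_sumr -(eq_big_nat _ _ EF) -(eq_big_nat _ _ EEk) -!Rintegral_bigsum//.
rewrite -(Rintegral_constant P (4 * L * Jmax)) -Rintegral_add; [|exact: integrable_constant|exact: integrable_bigsum].
apply: Rintegral_mono.
- exact: integrable_bigsum.
- by apply: integrable_add; [exact: integrable_constant|exact: integrable_bigsum].
move=> w.
have -> : \sum_(0 <= k < K.+1) F k w = \sum_(0 <= k < K.+1)
    (2^-1 * enorm (gradJ (theta k w)) ^+ 2 + 4^-1 * enorm (v k w) ^+ 2).
  by apply: eq_big_nat => k /andP[_ kK]; rewrite /F -ltnS kK.
have -> : \sum_(0 <= k < K.+1) E k w = \sum_(0 <= k < K.+1) 2^-1 * enorm (error k w) ^+ 2.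
  by apply: eq_big_nat => k /andP[_ kK]; rewrite /E -ltnS kK.
apply: (le_trans (descent_sum w (leqnn _))); rewrite lerD2r.
have := J_bounded A2 (theta K.+1 w); have := J_bounded A2 (theta 0%N w).
rewrite -/Jmax !ler_norml => /andP[h1 h2] /andP[h3 h4].
by rewrite (_ : 4 * L * Jmax = 2 * L * (Jmax + Jmax)); [apply: ler_wpM2l; [rewrite mulr_ge0 ?(ltW L_gt0)//|lra]|ring].
Qed.

(** The output index is uniform and independent of the history of the run. *)
Lemma output_law_integral k (F : Omega -> \bar R) : (k <= K)%N -> known K.+1 F ->
  (forall w, 0 <= F w)%E ->
  (\int[P]_w (F w * (\1_(xi @^-1` [set k]) w)%:E) = (K.+1%:R^-1)%:E * \int[P]_w F w)%E.
Proof.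
move=> kK kF F0.
have mF := known_measurable (leqnn _) kF.
have mxi : measurable (xi @^-1` [set k]).
  by rewrite -[X in measurable X]setTI; exact: (run_measurable_output run).
have mid := measurable_id_past (leqnn K.+1).
rewrite -(@integral_density _ _ _ P (mrestr P mxi))//; last first.
  move=> U mU; rewrite [RHS]integral_mkcond.
  under eq_integral do rewrite patchE.
  transitivity (\int[P]_w (\1_(U `&` xi @^-1` [set k]) w)%:E)%E.
    by rewrite integral_indic ?setIT//; exact: measurableI.
  apply: eq_integral => w _; rewrite !indicE in_setI.
  by case: (w \in U); case: (w \in _).
have c0 : 0 <= K.+1%:R^-1 :> R by rewrite invr_ge0 ler0n.
pose m1 := measure_function_pushforward__canonical__measure_function_Measure (mrestr P mxi) mid.
pose m2 := measure_function_pushforward__canonical__measure_function_Measure P mid.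
transitivity (\int[m1]_w F w)%E; first by rewrite [RHS]ge0_integral_pushforward.
transitivity (\int[mscale (NngNum c0) m2]_w F w)%E; last first.
  by rewrite ge0_integral_mscale//= ge0_integral_pushforward.
apply: eq_measure_integral => E mE _.
by rewrite /m1 /m2 /= /mscale /pushforward /mrestr /= preimage_id (run_output run).
Qed.


(** The value of [theta] after iteration [K] is not constrained by the run, so
    the output gradient need not be measurable on the null event [K < xi]; the
    integral of a nonnegative function is monotone all the same. *)
Lemma ge0_le_integral_unmeasurable (f h : Omega -> \bar R) :
  (forall w, 0 <= f w)%E -> (forall w, f w <= h w)%E ->
  (\int[P]_w f w <= \int[P]_w h w)%E.
Proof.
move=> f0 fh; have h0 w : (0 <= h w)%E by exact: le_trans (fh w).
rewrite !ge0_integralTE//; apply: le_ereal_sup => _ [u uf <-].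
by exists u => //= w; exact: le_trans (uf w) (fh w).
Qed.

Lemma output_second_moment :
  (\int[P]_w (enorm (gradJ (theta (xi w) w)) ^+ 2)%:E <=
   (K.+1%:R^-1 * \sum_(0 <= k < K.+1) EG k)%:E)%E.
Proof.
have G0 : 0 <= Gamma := Gamma_ge0 Hconst.
pose I k w : R := \1_(xi @^-1` [set k]) w.
have mxi k : measurable (xi @^-1` [set k]).
  by rewrite -[X in measurable X]setTI; exact: (run_measurable_output run).
have mI k : measurable_fun setT (I k) by exact: measurable_indic.
have iI k : int1 (I k).
  apply: (integrable_bounded _ (C := 1) (mI k)) => w.
  by rewrite /I indicE; case: (_ \in _); rewrite ?normr1 ?normr0.
pose F k w : R := if (k <= K)%N then enorm (gradJ (theta k w)) ^+ 2 else 0.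
have F0 k w : 0 <= F k w by rewrite /F; case: ifP => // _; exact: sqr_ge0.
have FG k w : F k w <= Gamma.
  by rewrite /F; case: ifP => // _; exact: (gradJ_bounded A1 Hconst).
have kF k : known K.+1 (F k).
  rewrite /F; case: (leqP k K) => kK; last exact: measurable_cst.
  apply: measurable_enorm_sq => c.
  exact: (measurable_gradJ_param Hconst (X := Past K.+1) c (known_theta (leqnn K.+1) (leqW kK))).
have mF k : measurable_fun setT (F k) by exact: known_measurable (kF k).
have iF k : int1 (F k).
  by apply: (integrable_bounded _ (C := Gamma) (mF k)) => w; rewrite ger0_norm.
have iFI k : int1 (fun w => F k w * I k w).
  apply: (integrable_bounded _ (C := Gamma)).
    exact: measurable_funM.
  move=> w; rewrite /I indicE; case: (_ \in _); first by rewrite mulr1 ger0_norm.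
  by rewrite mulr0 normr0.
have output k (h : Omega -> R) : (k <= K)%N -> known K.+1 h -> (forall w, 0 <= h w) ->
    int1 h -> int1 (fun w => h w * I k w) ->
    \int[P]_w (h w * I k w) = K.+1%:R^-1 * \int[P]_w h w.
  move=> kK kh h0 ih ihI.
  suff : ((\int[P]_w (h w * I k w))%:E = (K.+1%:R^-1 * \int[P]_w h w)%:E)%E by case.
  rewrite EFin_Rintegral// EFinM EFin_Rintegral//.
  under eq_integral do rewrite EFinM.
  have khE : known K.+1 (EFin \o h) by exact/measurable_EFinP.
  have h0E w : (0 <= (EFin \o h) w)%E by rewrite lee_fin.
  exact: (output_law_integral kK khE h0E).
have rest : int1 (fun w => Gamma * (1 - \sum_(0 <= k < K.+1) I k w)).
  apply: integrable_scale; apply: integrable_add; first exact: integrable_constant.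
  have := integrable_scale (-1) (integrable_bigsum (index_iota 0 K.+1) iI).
  by under [X in rintegrable _ X]eq_fun do rewrite mulN1r.
have bound w : enorm (gradJ (theta (xi w) w)) ^+ 2 <=
    \sum_(0 <= k < K.+1) F k w * I k w + Gamma * (1 - \sum_(0 <= k < K.+1) I k w).
  have Iw k : I k w = (xi w == k)%:R.
    by rewrite /I indicE; congr (_%:R); congr nat_of_bool; apply/idP/eqP; rewrite inE.
  under eq_bigr do rewrite Iw; under [X in _ <= _ + _ * (1 - X)]eq_bigr do rewrite Iw.
  case: (leqP (xi w) K) => xK.
    have pick (h : nat -> R) : \sum_(0 <= k < K.+1) h k * (xi w == k)%:R = h (xi w).
      rewrite (bigD1_seq (xi w)) ?iota_uniq ?mem_index_iota//= eqxx mulr1 big1 ?addr0//.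
      by move=> k; rewrite eq_sym => /negPf->; rewrite mulr0.
    have p1 : \sum_(0 <= k < K.+1) (xi w == k)%:R = 1 :> R.
      by rewrite -[RHS](pick (fun=> 1)); apply: eq_bigr => k _; rewrite mul1r.
    by rewrite (pick (F^~ w)) p1 /F xK subrr mulr0 addr0.
  rewrite [X in Gamma * (1 - X)]big_nat [X in Gamma * (1 - X)]big1; last first.
    by move=> k /andP[_ kK]; rewrite gtn_eqF// (leq_ltn_trans _ xK).
  rewrite subr0 mulr1 (le_trans (gradJ_bounded A1 Hconst _))// lerDr.
  by rewrite sumr_ge0// => k _; rewrite mulr_ge0// ler0n.
have iS := integrable_bigsum (index_iota 0 K.+1) iFI.
apply: (@le_trans _ _ (\int[P]_w (\sum_(0 <= k < K.+1) F k w * I k w +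
    Gamma * (1 - \sum_(0 <= k < K.+1) I k w))%:E)%E).
  by apply: ge0_le_integral_unmeasurable => w; rewrite lee_fin ?sqr_ge0.
rewrite -EFin_Rintegral ?lee_fin; last exact: integrable_add.
rewrite Rintegral_add// Rintegral_bigsum//.
have E0 : \int[P]_w (Gamma * (1 - \sum_(0 <= k < K.+1) I k w)) = 0.
  have i1 := integrable_constant P 1.
  have i2 := integrable_scale (-1) (integrable_bigsum (index_iota 0 K.+1) iI).
  transitivity (\int[P]_w (Gamma * (1 + (-1) * \sum_(0 <= k < K.+1) I k w))).
    by apply: eq_Rintegral => w _; rewrite mulN1r.
  rewrite Rintegral_scale; last exact: integrable_add.
  rewrite Rintegral_add// Rintegral_constant Rintegral_scale; last exact: integrable_bigsum.
  rewrite Rintegral_bigsum//.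
  have -> : \sum_(0 <= k < K.+1) \int[P]_w I k w = \sum_(0 <= k < K.+1) (K.+1%:R^-1 : R).
    apply: eq_big_nat => k /andP[_ kK].
    have := @output k (fun=> 1) kK (measurable_cst _) (fun=> ler01) i1.
    rewrite Rintegral_constant mulr1 => <-.
      by apply: eq_Rintegral => w _; rewrite mul1r.
    by under [X in rintegrable _ X]eq_fun do rewrite mul1r.
  rewrite sumr_const_nat subn0.
  have -> : K.+1%:R^-1 *+ K.+1 = 1 :> R by rewrite -[LHS]mulr_natr mulVf ?pnatr_eq0.
  by rewrite mulN1r subrr mulr0.
rewrite E0 addr0 mulr_sumr le_eqVlt; apply/orP; left; apply/eqP.
apply: eq_big_nat => k /andP[_ kK]; rewrite output//.
by congr (_ * _); apply: eq_Rintegral => w _; rewrite /F -ltnS kK.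
Qed.

Hypothesis Q_gt0 : 0 < 2 * (Lg ^+ 2 + Gamma * alphaw).
Hypothesis alphaE : alpha = 48.
Hypothesis b_le6 : b <= 6.
Hypothesis mB : (m.-1)%:R ^+ 2 * (2 * (Lg ^+ 2 + Gamma * alphaw)) <= B%:R * L ^+ 2.

(** The inner errors cost a quarter of the squared step lengths, by the balance
    of [m] and [B]; the checkpoint errors, each spread over an epoch of length
    [m], cost [b / alpha <= 1 / 8] of them. *)
Lemma error_sum_le :
  \sum_(0 <= k < K.+1) EE k <=
  (4^-1 + 8^-1) * \sum_(0 <= k < K.+1) EV k + K.+1%:R * (eps / 48).
Proof.
have mBQ := mB; set Q := 2 * _ in mBQ; have Q0 : 0 <= Q by exact: ltW.
have Q0' : 0 <= Lg ^+ 2 + Gamma * alphaw by rewrite -(pmulr_rge0 _ (ltr0Sn R 1)) ltW.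
have EV0 k : 0 <= EV k by apply: Rintegral_ge0 => w _; exact: sqr_ge0.
pose c1 := Q / B%:R * eta ^+ 2.
have c1_ge0 : 0 <= c1 by rewrite mulr_ge0 ?sqr_ge0 ?divr_ge0 ?ler0n.
have step k : (k <= K)%N -> EE k <=
    c1 * ((k - epoch k)%:R * \sum_(epoch k <= i < k) EV i) +
    (b / m%:R * (\sum_(epoch k - m <= i < epoch k) EV i) + eps) / alpha.
  move=> kK; case: (boolP (m %| k)%N) => mk.
    have ek : epoch k = k by rewrite /epoch divnK.
    by rewrite ek subnn mul0r mulr0 add0r outer_error_le.
  apply: (le_trans (inner_error_le kK mk Q0')); rewrite lerD2l.
  exact: (outer_error_le (leq_trans (epoch_le k) kK) (dvdn_epoch k)).
apply: (@le_trans _ _ (\sum_(0 <= k < K.+1)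
   (c1 * ((k - epoch k)%:R * \sum_(epoch k <= i < k) EV i) +
    (b / m%:R / alpha * (\sum_(epoch k - m <= i < epoch k) EV i) + eps / 48)))).
  rewrite big_nat [leRHS]big_nat; apply: ler_sum => k /andP[_ kK].
  apply: (le_trans (step k kK)); rewrite lerD2l mulrDl alphaE.
  by rewrite le_eqVlt; apply/orP; left; apply/eqP; congr (_ + _); rewrite mulrAC.
move: (eps / 48) => e48.
rewrite !big_split/= -!mulr_sumr addrA sumr_const_nat subn0 [X in _ <= _ + X]mulr_natl lerD2r.
have h1 := current_epoch_sum_le EV0 m_gt0 K.+1.
have h2 := previous_epoch_sum_le EV0 m_gt0 K.+1.
rewrite mulrDl lerD//.
  apply: (le_trans (ler_wpM2l c1_ge0 h1)); rewrite mulrA ler_wpM2r ?sumr_ge0//.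
  have B0 : 0 < B%:R :> R by rewrite ltr0n.
  have L2 : 0 < L ^+ 2 by rewrite exprn_gt0.
  have -> : c1 * (m.-1)%:R ^+ 2 = 4^-1 * ((m.-1)%:R ^+ 2 * Q / (B%:R * L ^+ 2)).
    by rewrite /c1 etaE; field; rewrite !gt_eqF.
  by rewrite ler_piMr ?invr_ge0// ler_pdivrMr ?mulr_gt0// mul1r.
have m0 : 0 < m%:R :> R by rewrite ltr0n.
have b0 : 0 <= b / m%:R / alpha by rewrite !divr_ge0 ?ler0n ?(ltW alpha_gt0).
apply: (le_trans (ler_wpM2l b0 h2)); rewrite mulrA ler_wpM2r ?sumr_ge0//.
rewrite alphaE (_ : b / m%:R / 48 * m%:R = b / 48); last by field; rewrite gt_eqF.
by move: b_le6; lra.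
Qed.

Lemma mean_gradient_le :
  \sum_(0 <= k < K.+1) EG k <= 8 * L * Jmax + K.+1%:R * (eps / 48).
Proof.
have h1 := expected_descent; have h2 := error_sum_le.
have EV0 : 0 <= \sum_(0 <= k < K.+1) EV k.
  by apply: sumr_ge0 => k _; apply: Rintegral_ge0 => w _; exact: sqr_ge0.
move: h1; rewrite big_split/= -!mulr_sumr.
move: (\sum_(0 <= k < K.+1) EG k) (\sum_(0 <= k < K.+1) EV k) (\sum_(0 <= k < K.+1) EE k) h2 EV0.
move=> x y z; move: (K.+1%:R * (eps / 48)) (L * Jmax) => e j; lra.
Qed.

Lemma output_accuracy : 16 * L * Jmax <= K.+1%:R * eps ->
  ('E_P[fun w => (enorm (gradJ (theta (xi w) w)) ^+ 2)%R] <= eps%:E)%E.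
Proof.
move=> hK; rewrite unlock; apply: (le_trans output_second_moment).
rewrite lee_fin ler_pdivrMl ?ltr0n//; apply: (le_trans mean_gradient_le).
have : 0 <= K.+1%:R * eps by rewrite mulr_ge0 ?ler0n ?ltW.
move: hK; rewrite -!mulrA; move: (L * Jmax) => j.
by rewrite mulrA; move: (K.+1%:R * eps) => x; lra.
Qed.


(** At the first iteration the batch size is deterministic, so averaging does
    not bias the estimate. *)
Lemma first_step_mean c :
  int1 (fun w => v 0%N w 0 c) /\ \int[P]_w (v 0%N w 0 c) = gradJ theta0 0 c.
Proof.
have K0 := leq0n K; have K1 := leqW K0.
have th0 w : theta 0%N w = theta0 by exact: run_init run w.
pose W := batch_weight R (max_batch 0).
have batch0 w : batch 0 w = max_batch 0.
  rewrite /batch /max_batch dvdn0 /N /aba_rule sub0n big_geq// mulr0 add0r.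
  by [].
have [si _ _ _] := run_integrable K0.
have mk : @measurable_fun _ _ (Past 0) (giry (traj M) R) setT
    (fun w => mu (theta 0%N w) : giry (traj M) R).
  exact: (measurable_traj_dist A2 (X := Past 0) (known_theta K1 (leqnn 0))).
have my := measurable_noise (known_theta K1 (leqnn 0)) (known_theta K1 (epoch_le 0)).
have mt i : measurable_fun setT (tau 0%N i) by exact: (run_measurable run).
pose h i w := noise 0 w (tau 0%N i w) 0 c.
have mz i : @measurable_fun _ _ Omega (Past 0 * traj M)%type setT
    (fun w : Omega => (w, tau 0%N i w)).
  by apply/measurable_fun_pairP; split; [exact: measurable_id_past|exact: mt].
have ih i : int1 (h i).
  have [i2 _] := cond_law_integrable (measurable_id_past K1) mk (mt i) (run_cond_law i K0)
    (measurable_enorm_sq my) (fun z => sqr_ge0 _) (noise_sq 0) si.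
  apply: sq_integrable1; apply: (sq_integrable_dominated _ _ i2).
    exact: (measurableT_comp (my c) (mz i)).
  by move=> w; exact: enorm_coord_sq.
have h0 i : \int[P]_w h i w = 0.
  rewrite /Rintegral (cond_law_centered (measurable_id_past K1) mk (mt i)
    (run_cond_law i K0) (my c))//.
  - by move=> w; exact: noise_mean.
  - exact: ih.
have E w : v 0%N w 0 c = \sum_(0 <= i < max_batch 0) W i * h i w + gradJ theta0 0 c.
  have -> : v 0%N w = error 0 w + gradJ theta0 by rewrite /error th0 subrK.
  rewrite errorE// /carried dvdn0 addr0 mxE /samples summxE; congr (_ + _).
  by apply: eq_bigr => i _; rewrite rowZ batch0.
rewrite (_ : (fun w => v 0%N w 0 c) =
  fun w => \sum_(0 <= i < max_batch 0) W i * h i w + gradJ theta0 0 c); last first.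
  by apply/funext => w; exact: E.
have ihW i : int1 (fun w => W i * h i w) by exact: integrable_scale.
have iS := integrable_bigsum (index_iota 0 (max_batch 0)) ihW.
have ic := integrable_constant P (gradJ theta0 0 c).
split; first exact: integrable_add.
rewrite Rintegral_add// Rintegral_constant Rintegral_bigsum// big1 ?add0r// => i _.
by rewrite Rintegral_scale// h0 mulr0.
Qed.

(** The adaptive rule saves samples on every path on which some step moves, and
    the first estimate is unbiased, hence not almost surely zero. *)
Lemma expected_saving : 0 < b -> 0 < sigma -> (m <= K)%N -> gradJ theta0 != 0 ->
  ('E_P[fun w => sto_cost N m B K (v^~ w)] <
   (sto_cost (vanilla_rule alpha sigma eps) m B K (fun=> (0 : Theta)))%:E)%E.
Proof.
move=> b0 s0 mK g0; rewrite unlock.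
pose vanilla := @vanilla_rule R d alpha sigma eps.
set c := sto_cost _ _ _ _ (fun=> 0 : Theta).
have cE w : sto_cost vanilla m B K (v^~ w) = c by [].
pose D w := c - sto_cost N m B K (v^~ w).
have D0 w : 0 <= D w by rewrite subr_ge0 -(cE w) sto_cost_le.
have Kgt : (0 < K %/ m * m)%N by rewrite muln_gt0 m_gt0 divn_gt0// mK.
have Dv w : D w = 0 -> v 0%N w = 0.
  move=> /eqP; rewrite subr_eq0 => /eqP Dw; apply/eqP; apply: contrapT => /negP v0.
  have := @sto_cost_lt R d alpha b sigma eps m alpha_gt0 b_ge0 eps_gt0 B K (v^~ w) 0 b0 m_gt0 s0 Kgt v0.
  by rewrite cE Dw ltxx.
have mcost : measurable_fun setT (fun w => sto_cost N m B K (v^~ w)).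
  rewrite /sto_cost; apply: measurable_funD; first exact: measurable_cst.
  rewrite (_ : (fun w => _) = fun w => \sum_(k <- index_iota 0 (K %/ m).+1)
      (if (k <= K %/ m)%N then N (v^~ w) (k * m)%N else 0)); last first.
    by apply/funext => w; apply: eq_big_nat => k /andP[_ kK]; rewrite -ltnS kK.
  apply: measurable_sum => k; case: (leqP k (K %/ m)) => kK; last exact: measurable_cst.
  apply: measurable_aba_rule => // j jk; apply: run_measurable_v.
  apply: ltnW; apply: leq_trans jk _; apply: leq_trans (leq_divM K m).
  by rewrite leq_mul2r kK orbT.
have cost0 w : 0 <= sto_cost N m B K (v^~ w).
  rewrite /sto_cost addr_ge0 ?mulr_ge0 ?ler0n// sumr_ge0// => k _.
  exact: aba_rule_ge0.
have icost : int1 (fun w => sto_cost N m B K (v^~ w)).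
  apply: (integrable_bounded _ (C := c) mcost) => w.
  by rewrite ger0_norm// -subr_ge0 D0.
have iD : int1 D.
  have := integrable_add (integrable_constant P c) (integrable_scale (-1) icost).
  by under [X in rintegrable _ X]eq_fun do rewrite mulN1r.
rewrite -EFin_Rintegral// lte_fin.
have -> : \int[P]_w (sto_cost N m B K (v^~ w)) = c - \int[P]_w D w.
  have -> : \int[P]_w D w = \int[P]_w (c + (-1) * sto_cost N m B K (v^~ w)).
    by apply: eq_Rintegral => w _; rewrite mulN1r.
  rewrite Rintegral_add; [|exact: integrable_constant|exact: integrable_scale].
  by rewrite Rintegral_constant Rintegral_scale// mulN1r opprB addrC subrK.
rewrite ltrBlDr ltrDl lt_neqAle eq_sym Rintegral_ge0 ?andbT//.
apply: contra g0 => /eqP ED.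
have mD := integrable_measurable iD.
have aeD : ae_eq P setT (EFin \o D) (cst 0%E).
  apply/ae_eq_integral_abs => //; first exact/measurable_EFinP.
  under eq_integral do rewrite gee0_abs ?lee_fin//.
  by rewrite -(EFin_Rintegral iD) ED.
apply/eqP/rowP => i; rewrite [RHS]mxE.
have [iv <-] := first_step_mean i.
rewrite -[RHS](Rintegral_constant P) /Rintegral; congr fine.
apply: ae_eq_integral => //.
- by case/integrableP : iv.
- apply: filterS aeD => w /(_ Logic.I) /= [Dw] _.
  by rewrite (Dv w Dw) mxE.
Qed.

End run.

(** * Complexity *)

Theorem corollary3 (R : realType) (dS dA : measure_display)
    (S : measurableType dS) (A : measurableType dA)
    (M : mdp R S A) (d : nat) (pi : policy R S A d)
    (g : traj M -> 'rV[R]_d -> 'rV[R]_d)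
    (G C_H Rmax sigma L Lg Gamma alphaw : R) (theta0 : 'rV[R]_d)
    (A1 : unbiased_gradient pi g)
    (A2 : regular_policy M pi G C_H Rmax)
    (A3 : bounded_variance pi g sigma)
    (L_gt0 : 0 < L) (alphaw_gt0 : 0 < alphaw)
    (Hconst : smoothness_constants pi g L Lg Gamma alphaw)
    (Q_gt0 : 0 < 2 * (Lg ^+ 2 + Gamma * alphaw)) :
  let Q := 2 * (Lg ^+ 2 + Gamma * alphaw) in
  let eta := 1 / (2 * L) in
  let alpha : R := 48 in
  let beta : R := 6 in
  exists C : R, forall eps : R, 0 < eps ->
  let m := roundup ((L ^+ 2 * sigma ^+ 2 / (Q * eps)) `^ (1 / 3)) in
  let B := roundup ((Q * sigma ^+ 4 / (L ^+ 2 * eps ^+ 2)) `^ (1 / 3)) in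
  let aba := aba_rule alpha beta sigma eps m in
  let vanilla := vanilla_rule alpha sigma eps in
  exists K0 : nat,
    (forall (K : nat) (dO : measure_display) (Omega : measurableType dO)
        (P : probability Omega R) (tau : nat -> nat -> Omega -> traj M)
        (theta v : nat -> Omega -> 'rV[R]_d) (xi : Omega -> nat),
      (K0 <= K)%N ->
      svrpg_run pi g P aba eta m B K theta0 tau theta v xi ->
      ('E_P[fun w => (enorm (grad (J M pi) (theta (xi w) w)) ^+ 2)%R]
         <= eps%:E)%E /\
      forall w : Omega,
        sto_cost aba m B K (v^~ w) <= sto_cost vanilla m B K (v^~ w) /\
        (sto_cost aba m B K (v^~ w) < sto_cost vanilla m B K (v^~ w) <->
         0 < sigma /\ exists2 i : nat, (i < K %/ m * m)%N & v i w != 0)) /\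
    (forall (K : nat) (dO : measure_display) (Omega : measurableType dO)
        (P : probability Omega R) (tau : nat -> nat -> Omega -> traj M)
        (theta v : nat -> Omega -> 'rV[R]_d) (xi : Omega -> nat),
      (K0 <= K)%N -> (m <= K)%N -> 0 < sigma -> grad (J M pi) theta0 != 0 ->
      svrpg_run pi g P aba eta m B K theta0 tau theta v xi ->
      ('E_P[fun w => sto_cost aba m B K (v^~ w)]
         < (sto_cost vanilla m B K (fun=> 0%R))%:E)%E) /\
    (forall (K : nat) (dO : measure_display) (Omega : measurableType dO)
        (P : probability Omega R) (tau : nat -> nat -> Omega -> traj M)
        (theta v : nat -> Omega -> 'rV[R]_d) (xi : Omega -> nat),
      (K0 <= K)%N ->
      svrpg_run pi g P vanilla eta m B K theta0 tau theta v xi ->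
      ('E_P[fun w => (enorm (grad (J M pi) (theta (xi w) w)) ^+ 2)%R]
         <= eps%:E)%E) /\
    (forall v : nat -> 'rV[R]_d,
      sto_cost vanilla m B K0 v <=
        C * (eps `^ (- (5 / 3)) + eps `^ (- 1))).
Proof.
move=> Q eta alpha beta.
have [_ _ R0 _ _] := A2; have [sigma_ge0 _] := A3.
(* The initial gap [8 * L * max |J|] has to stay below [K.+1 * eps / 2]. *)
pose c := 16 * L * (Rmax * (horizon M)%:R).
have c0 : 0 <= c by rewrite !mulr_ge0 ?ler0n ?(ltW L_gt0).
have alpha0 : 0 < alpha by rewrite ltr0n.
have beta0 : 0 < beta by rewrite ltr0n.
eexists => eps eps0 m B aba vanilla.
(* The vanilla rule is the adaptive rule that ignores the step lengths. *)
have vanillaE : vanilla = @aba_rule R d alpha 0 sigma eps m.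
  apply/funext => v; apply/funext => k.
  by rewrite /vanilla /vanilla_rule /aba_rule mul0r mul0r add0r.
have m0 : (0 < m)%N := roundup_gt0 _.
have B0 : (0 < B)%N := roundup_gt0 _.
have mB := rounded_balance sigma L_gt0 Q_gt0 eps0.
(* Rounding down is enough, as a run makes [K.+1] estimates, and it keeps the
   threshold of order [1 / eps] for large [eps] as well. *)
exists (Num.truncn (c / eps)).
have Kle K : (Num.truncn (c / eps) <= K)%N -> c <= K.+1%:R * eps.
  move=> hK; rewrite -ler_pdivrMr//; apply: le_trans (ltW (truncnS_gt _)) _.
  by rewrite ler_nat ltnS.
split; [|split; [|split]].
- move=> K dO Omega P tau theta v xi hK run; split.
    exact: (output_accuracy A1 A2 A3 Hconst alpha0 (ltW beta0) eps0 m0 B0 run L_gt0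
      erefl Q_gt0 erefl (lexx _) mB (Kle K hK)).
  move=> w; split; first exact: sto_cost_le.
  exact: sto_cost_lt_iff.
- move=> K dO Omega P tau theta v xi hK mK s0 g0 run.
  exact: (expected_saving A1 A2 A3 Hconst alpha0 (ltW beta0) eps0 m0 B0 run beta0 s0 mK g0).
- move=> K dO Omega P tau theta v xi hK; rewrite vanillaE => run.
  exact: (output_accuracy A1 A2 A3 Hconst alpha0 (lexx 0) eps0 m0 B0 run L_gt0
      erefl Q_gt0 erefl (ler0n _ _) mB (Kle K hK)).
- move=> v; apply: (vanilla_cost_le sigma L_gt0 Q_gt0 eps0 v c0).
  by rewrite truncn_le divr_ge0 ?(ltW eps0).
Qed.
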